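(* Let $\Lambda\in\{-1,0,1\}$ and let $L\subset\mathbb X_\Lambda$ be a lightlike tetrahedron with edge lengths $\alpha,\beta,\alpha+\beta$, where $\alpha,\beta>0$ (opposite edges having equal lengths), and put $\gamma=-(\alpha+\beta)$. Then for $\Lambda=\pm1$ $$\mathrm{vol}(L)=\frac1{2\Lambda}\Big(\mathrm{Cl}_\Lambda(2\alpha)+\mathrm{Cl}_\Lambda(2\beta)+\mathrm{Cl}_\Lambda(2\gamma)\Big)+\frac1\Lambda\Big(\alpha\log|s_\Lambda(\alpha)|+\beta\log|s_\Lambda(\beta)|+\gamma\log|s_\Lambda(\gamma)|\Big),$$ and for $\Lambda=0$ $$\mathrm{vol}(L)=-\frac13\,\alpha\beta\gamma .$$ Here $\mathrm{Cl}_\Lambda(x)=-\int_0^x\log|2s_\Lambda(\tfrac\theta2)|\,d\theta$.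
   Context: $s_\Lambda=\sinh$, $\theta\mapsto\theta$, $\sin$ for $\Lambda=-1,0,1$. $\mathbb C_\Lambda=\mathbb R[\ell]/(\ell^2+\Lambda)$, with conjugation $\overline{x+\ell y}=x-\ell y$ and $|z|^2=z\overline z$. For a $2\times2$-matrix over $\mathbb C_\Lambda$ put $\begin{pmatrix}a&b\\c&d\end{pmatrix}^\circ=\begin{pmatrix}\overline d&-\overline b\\-\overline c&\overline a\end{pmatrix}$. The space $\mathbb X_\Lambda=\{x\in\mathrm{Mat}(2,\mathbb C_\Lambda):x^\circ=x,\ \det x>0\}/\mathbb R^\times$ is 3d anti-de Sitter, Minkowski, de Sitter space (the first and last modulo the antipodal map) for $\Lambda=-1,0,1$. Coordinates: $x=\begin{pmatrix}x_2+\ell x_4&\ell(x_3-x_1)\\ \ell(x_3+x_1)&x_2-\ell x_4\end{pmatrix}$. The group $\mathrm{PGL}^+(2,\mathbb C_\Lambda)=\{A\in\mathrm{Mat}(2,\mathbb C_\Lambda):|\det A|^2>0\}/\mathbb C_\Lambda^\times$ acts by $A\rhd x=AxA^\circ$ and preserves the Lorentzian metric of constant curvature $\Lambda$ which at the identity matrix (using representatives with $x_2>0$ and determinant $1$) is $-dx_1^2+dx_3^2+dx_4^2$. $\mathrm{vol}$ is the associated volume; it is the $\mathrm{PGL}^+(2,\mathbb C_\Lambda)$-invariant volume with density $dx_1dx_3dx_4$ at the identity matrix, and for $\Lambda=0$ it is Lebesgue measure on the affine hyperplane $x_2=1$. Geodesics and geodesic planes in $\mathbb X_\Lambda$ are its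 intersections with projective lines and planes of the projectivization of the real 4-space $\{x=x^\circ\}$; a geodesic is timelike, lightlike or spacelike according to its tangent vectors; a plane is lightlike if it contains a lightlike but no timelike geodesic. A lightlike tetrahedron is a non-degenerate convex geodesic 3-simplex in $\mathbb X_\Lambda$ (the image of a cone $\{\sum_{i=1}^4a_ix_i':a_i\ge0,\sum a_i\ne0\}$ with $x_i'$ linearly independent, all of whose elements represent points of $\mathbb X_\Lambda$) whose faces lie in lightlike planes and such that every geodesic starting at a vertex and intersecting the interior is spacelike. Its edges are spacelike segments; opposite edges have equal lengths, and the three lengths are of the form $\alpha,\beta,\alpha+\beta$ with $\alpha,\beta>0$ (and $\alpha+\beta<\pi$ if $\Lambda=1$). *)

(* Defs.v *)
From HB Require Import structures.
From mathcomp Require Import all_boot all_order all_algebra.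
From mathcomp Require Import all_classical all_reals all_analysis.
From mathcomp Require Import ring lra.

Set Implicit Arguments.
Unset Strict Implicit.
Unset Printing Implicit Defensive.

Import Order.TTheory GRing.Theory Num.Theory.
Import numFieldNormedType.Exports.
Local Open Scope classical_set_scope.
Local Open Scope ring_scope.

(* The ring R[l]/(l^2 + Lam); [GC a b] stands for a + l b. *)
Record gcplx (R : realType) (Lam : R) := GC { gre : R; gim : R }.
Arguments GC {R} Lam.
Arguments gre {R Lam}.
Arguments gim {R Lam}.

Section GComplexRing.
Context {R : realType} (Lam : R).
Local Notation C := (gcplx Lam).

Lemma gcplx_pairK :
  cancel (fun z : C => (gre z, gim z)) (fun p => GC Lam p.1 p.2).
Proof. by case. Qed.

HB.instance Definition _ := Choice.copy C (can_type gcplx_pairK).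

Definition gc_add (z w : C) := GC Lam (gre z + gre w) (gim z + gim w).
Definition gc_opp (z : C) := GC Lam (- gre z) (- gim z).
Definition gc_mul (z w : C) :=
  GC Lam (gre z * gre w - Lam * gim z * gim w) (gre z * gim w + gim z * gre w).

Lemma gc_addA : associative gc_add.
Proof. by move=> [a b] [c d] [e f]; congr GC => /=; ring. Qed.
Lemma gc_addC : commutative gc_add.
Proof. by move=> [a b] [c d]; congr GC => /=; ring. Qed.
Lemma gc_add0 : left_id (GC Lam 0 0) gc_add.
Proof. by move=> [a b]; congr GC => /=; ring. Qed.
Lemma gc_addN : left_inverse (GC Lam 0 0) gc_opp gc_add.
Proof. by move=> [a b]; congr GC => /=; ring. Qed.

HB.instance Definition _ :=
  GRing.isZmodule.Build C gc_addA gc_addC gc_add0 gc_addN.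

Lemma gc_mulA : associative gc_mul.
Proof. by move=> [a b] [c d] [e f]; congr GC => /=; ring. Qed.
Lemma gc_mulC : commutative gc_mul.
Proof. by move=> [a b] [c d]; congr GC => /=; ring. Qed.
Lemma gc_mul1 : left_id (GC Lam 1 0) gc_mul.
Proof. by move=> [a b]; congr GC => /=; ring. Qed.
Lemma gc_mulDl : left_distributive gc_mul +%R.
Proof. by move=> [a b] [c d] [e f]; congr GC => /=; ring. Qed.
Lemma gc_oner_neq0 : GC Lam 1 0 != 0.
Proof. by apply/eqP => -[] /eqP; rewrite oner_eq0. Qed.

HB.instance Definition _ := GRing.Zmodule_isComNzRing.Build C
  gc_mulA gc_mulC gc_mul1 gc_mulDl gc_oner_neq0.

End GComplexRing.

Section Space.
Context {R : realType} (Lam : R).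
Local Notation C := (gcplx Lam).

Definition gconj (z : C) : C := GC Lam (gre z) (- gim z).

Definition gnorm2 (z : C) : R := gre (z * gconj z).

Definition mx2 {T : Type} (a b c d : T) : 'M[T]_2 :=
  \matrix_(i, j) if i == 0 then (if j == 0 then a else b)
                 else (if j == 0 then c else d).

Definition circ (A : 'M[C]_2) : 'M[C]_2 :=
  mx2 (gconj (A 1 1)) (- gconj (A 0 1)) (- gconj (A 1 0)) (gconj (A 0 0)).

(* Vectors of R^4 are numbered from 1: [co x k] is x_k for k = 1, ..., 4. *)
Definition co (x : 'rV[R]_4) (k : nat) : R := x 0 (inord k.-1).

Definition vec4 (a b c d : R) : 'rV[R]_4 := \row_i [:: a; b; c; d]`_i.

(* The real 4-space {x | x = x^o} is handled through its coordinates
   (x_1, x_2, x_3, x_4), see [circ_mxX], [circ_fixed] and [crdK] below. *)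
Definition mxX (x : 'rV[R]_4) : 'M[C]_2 :=
  mx2 (GC Lam (co x 2) (co x 4)) (GC Lam 0 (co x 3 - co x 1))
      (GC Lam 0 (co x 3 + co x 1)) (GC Lam (co x 2) (- co x 4)).

Definition crd (M : 'M[C]_2) : 'rV[R]_4 :=
  vec4 ((gim (M 1 0) - gim (M 0 1)) / 2) (gre (M 0 0))
       ((gim (M 1 0) + gim (M 0 1)) / 2) (gim (M 0 0)).

(* This determinant has no l-component, see [det_mxX]. *)
Definition detX (x : 'rV[R]_4) : R := gre (\det (mxX x)).

(* The space X_Lam, given by the representatives of its points: two of them
   represent the same point iff they differ by a factor in R^*.  Likewise a
   subset of X_Lam is given by the R^*-stable set of all representatives. *)
Definition XX : set 'rV[R]_4 := [set x | 0 < detX x].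

(* The action A |> x = A x A^o, for |det A|^2 > 0. *)
Definition act (A : 'M[C]_2) (x : 'rV[R]_4) : 'rV[R]_4 :=
  crd (A *m mxX x *m circ A).

Definition idX : 'rV[R]_4 := vec4 0 1 0 0.

Definition mink (v w : 'rV[R]_4) : R :=
  - (co v 1 * co w 1) + co v 3 * co w 3 + co v 4 * co w 4.

(* The Lorentzian metric at the point represented by x; a tangent vector is a
   vector of R^4 modulo R x, to be rescaled together with x.
   With B the symmetric bilinear form such that B x x = detX x, this is
     (B x x * B v w - B x v * B x w) / (Lam * (B x x) ^+ 2)
   with the factor Lam cancelled, so that it makes sense for Lam = 0 as well:
   for Lam = -1, 1 it is the metric induced by the form Lam * B on the
   hypersurface detX x = 1, and for Lam = 0 it is the one induced by mink on
   the affine hyperplane x_2 = 1.  By [metric_inv] and [metric_unique] it is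
   the unique PGL^+(2, C_Lam)-invariant metric with value mink at the
   identity matrix. *)
Definition metric (x v w : 'rV[R]_4) : R :=
  (mink (co x 2 *: v - co v 2 *: x) (co x 2 *: w - co w 2 *: x)
   + Lam * (mink x x * mink v w - mink x v * mink x w)) / detX x ^+ 2.

Record inv_metric (g : 'rV[R]_4 -> 'rV[R]_4 -> 'rV[R]_4 -> R) : Prop := {
  inv_metric_scale : forall x v w c, XX x -> c != 0 ->
    g (c *: x) (c *: v) (c *: w) = g x v w;
  inv_metric_tangent : forall x v w a b, XX x ->
    g x (v + a *: x) (w + b *: x) = g x v w;
  inv_metric_act : forall (A : 'M[C]_2) x v w, 0 < gnorm2 (\det A) -> XX x ->
    g (act A x) (act A v) (act A w) = g x v w;
  inv_metric_id : forall v w, g idX v w = mink v w }.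

(* Geodesics and geodesic planes are given by the linear subspaces of R^4 of
   dimension 2 and 3 which meet X_Lam. *)
Definition geodesic (l : {vspace 'rV[R]_4}) : Prop :=
  \dim l = 2%N /\ exists2 x, x \in l & XX x.

Definition geodesic_plane (P : {vspace 'rV[R]_4}) : Prop :=
  \dim P = 3%N /\ exists2 x, x \in P & XX x.

Definition tangent_to (l : {vspace 'rV[R]_4}) (x v : 'rV[R]_4) : Prop :=
  [/\ x \in l, XX x, v \in l & v \notin <[x]>%VS].

Definition timelike (l : {vspace 'rV[R]_4}) : Prop :=
  geodesic l /\ forall x v, tangent_to l x v -> metric x v v < 0.

Definition lightlike (l : {vspace 'rV[R]_4}) : Prop :=
  geodesic l /\ forall x v, tangent_to l x v -> metric x v v = 0.

Definition spacelike (l : {vspace 'rV[R]_4}) : Prop :=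
  geodesic l /\ forall x v, tangent_to l x v -> 0 < metric x v v.

Definition lightlike_plane (P : {vspace 'rV[R]_4}) : Prop :=
  [/\ geodesic_plane P,
      exists2 l : {vspace 'rV[R]_4}, (l <= P)%VS & lightlike l &
      forall l : {vspace 'rV[R]_4}, (l <= P)%VS -> ~ timelike l].

(* The rows of V are the vectors x'_1, ..., x'_4 spanning the cone. *)
Definition cone (V : 'M[R]_4) : set 'rV[R]_4 :=
  [set x | exists a : 'rV[R]_4,
    [/\ forall i, 0 <= a 0 i, \sum_i a 0 i != 0 & x = a *m V]].

Definition cone_interior (V : 'M[R]_4) : set 'rV[R]_4 :=
  [set x | exists2 a : 'rV[R]_4, forall i, 0 < a 0 i & x = a *m V].

Definition simplex (V : 'M[R]_4) : set 'rV[R]_4 :=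
  [set x | exists2 c : R, c != 0 & cone V (c *: x)].

(* The face opposite to vertex j. *)
Definition face_span (V : 'M[R]_4) (j : 'I_4) : {vspace 'rV[R]_4} :=
  (\sum_(i < 4 | i != j) <[row i V]>)%VS.

Definition lightlike_tetrahedron (V : 'M[R]_4) : Prop :=
  [/\ row_free V,
      cone V `<=` XX,
      forall j, lightlike_plane (face_span V j) &
      forall i (l : {vspace 'rV[R]_4}), geodesic l -> row i V \in l ->
        (exists2 x, x \in l & cone_interior V x) -> spacelike l].

(* Length of the spacelike geodesic segment which is the image of
   t |-> (1 - t) x + t y for 0 <= t <= 1. *)
Definition seg_length (x y : 'rV[R]_4) : R :=
  \int[@lebesgue_measure R]_(t in `[0, 1])
    Num.sqrt (metric ((1 - t) *: x + t *: y) (y - x) (y - x)).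

Definition edge_length (V : 'M[R]_4) (i j : nat) : R :=
  seg_length (row (inord i) V) (row (inord j) V).

Definition has_edge_lengths (V : 'M[R]_4) (a b c : R) : Prop :=
  [/\ edge_length V 0 1 = a /\ edge_length V 2 3 = a,
      edge_length V 0 2 = b /\ edge_length V 1 3 = b &
      edge_length V 0 3 = c /\ edge_length V 1 2 = c].

(* The volume of the metric, computed in the chart x_2 = 1, whose complement
   in X_Lam is contained in a projective plane, hence is a null set. *)
Definition chart (y : R * (R * R)) : 'rV[R]_4 := vec4 y.1 1 y.2.1 y.2.2.

Definition chart_tangent (i : 'I_3) : 'rV[R]_4 := delta_mx 0 (lift (inord 1) i).

Definition gram (y : R * (R * R)) : 'M[R]_3 :=
  \matrix_(i, j) metric (chart y) (chart_tangent i) (chart_tangent j).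

Definition vol (S : set 'rV[R]_4) : \bar R :=
  (\int[@lebesgue_measure R \x (@lebesgue_measure R \x @lebesgue_measure R)]_(
     y in [set y | S (chart y)]) (Num.sqrt `|\det (gram y)|)%:E)%E.

Definition s_ (t : R) : R :=
  if Lam == 1 then sin t
  else if Lam == -1 then (expR t - expR (- t)) / 2
  else t.

Definition oriented_int (f : R -> R) (x : R) : R :=
  if 0 <= x then \int[@lebesgue_measure R]_(t in `[0, x]) f t
  else - \int[@lebesgue_measure R]_(t in `[x, 0]) f t.

Definition Cl (x : R) : R :=
  - oriented_int (fun t => ln `|2 * s_ (t / 2)|) x.

End Space.

Lemma mulmx2E (K : comNzRingType) (A B : 'M[K]_2) i j :
  (A *m B) i j = A i 0 * B 0 j + A i 1 * B 1 j.
Proof.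
rewrite mxE !big_ord_recl big_ord0 addr0.
by congr (_ * _ + A i _ * B _ j); apply/val_inj.
Qed.

Lemma det_mx22 (K : comNzRingType) (A : 'M[K]_2) :
  \det A = A 0 0 * A 1 1 - A 0 1 * A 1 0.
Proof.
rewrite (expand_det_row _ 0) !big_ord_recl big_ord0 addr0 /cofactor !det_mx11.
rewrite !mxE /= expr0 expr1 mul1r mulN1r mulrN.
by congr (A _ _ * A _ _ - A _ _ * A _ _); apply/val_inj.
Qed.

Lemma mulmx3D (K : comNzRingType) (A X Y B : 'M[K]_2) :
  A *m (X + Y) *m B = A *m X *m B + A *m Y *m B.
Proof. by rewrite mulmxDr mulmxDl. Qed.

Lemma mulmx3Z (K : comNzRingType) (A X B : 'M[K]_2) a :
  A *m (a *: X) *m B = a *: (A *m X *m B).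
Proof. by rewrite -scalemxAr -scalemxAl. Qed.

Lemma mulmx3M (K : comNzRingType) (A B X C D : 'M[K]_2) :
  A *m B *m X *m (C *m D) = A *m (B *m X *m C) *m D.
Proof. by rewrite !mulmxA. Qed.

Section Facts.
Context {R : realType} (Lam : R).
Local Notation C := (gcplx Lam).

Lemma gcE (z w : C) : gre z = gre w -> gim z = gim w -> z = w.
Proof. by case: z w => [a b] [c d] /= -> ->. Qed.

Lemma greD (z w : C) : gre (z + w) = gre z + gre w. Proof. by []. Qed.
Lemma gimD (z w : C) : gim (z + w) = gim z + gim w. Proof. by []. Qed.
Lemma greN (z : C) : gre (- z) = - gre z. Proof. by []. Qed.
Lemma gimN (z : C) : gim (- z) = - gim z. Proof. by []. Qed.
Lemma greM (z w : C) : gre (z * w) = gre z * gre w - Lam * gim z * gim w.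
Proof. by []. Qed.
Lemma gimM (z w : C) : gim (z * w) = gre z * gim w + gim z * gre w.
Proof. by []. Qed.
Definition gE := (greD, gimD, greN, gimN, greM, gimM).

Lemma co_vec4 (a b c d : R) (k : nat) : (0 < k <= 4)%N ->
  co (vec4 a b c d) k = [:: a; b; c; d]`_k.-1.
Proof. by case: k => // k /= lek; rewrite /co /vec4 mxE inordK. Qed.

Lemma coD x y k : co (x + y : 'rV[R]_4) k = co x k + co y k.
Proof. by rewrite /co mxE. Qed.
Lemma coN x k : co (- x : 'rV[R]_4) k = - co x k.
Proof. by rewrite /co mxE. Qed.
Lemma coZ a x k : co (a *: x : 'rV[R]_4) k = a * co x k.
Proof. by rewrite /co mxE. Qed.
Definition coE := (coD, coN, coZ).

Lemma co_inj (x y : 'rV[R]_4) :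
  co x 1 = co y 1 -> co x 2 = co y 2 -> co x 3 = co y 3 -> co x 4 = co y 4 ->
  x = y.
Proof.
move=> h1 h2 h3 h4; apply/rowP => i; rewrite -[i]inord_val.
by case: i => -[|[|[|[|//]]]].
Qed.

Lemma mx2P (T : Type) (A B : 'M[T]_2) :
  A 0 0 = B 0 0 -> A 0 1 = B 0 1 -> A 1 0 = B 1 0 -> A 1 1 = B 1 1 -> A = B.
Proof.
have ord2 (i : 'I_2) : i = 0 \/ i = 1.
  by case: i => -[|[|//]] ?; [left|right]; apply/val_inj.
by move=> h00 h01 h10 h11; apply/matrixP => i j;
  case: (ord2 i) => ->; case: (ord2 j) => ->.
Qed.

Lemma circ_mxX x : circ (mxX Lam x) = mxX Lam x.
Proof.
apply: mx2P; rewrite /circ /mxX /mx2 !mxE /=; apply: gcE;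
  by rewrite /= ?gE /=; ring.
Qed.

Lemma crdK : cancel (@mxX R Lam) (@crd R Lam).
Proof.
move=> x; apply: co_inj; rewrite /crd co_vec4 //= /mxX /mx2 !mxE //=; by field.
Qed.

Lemma circ_fixed (M : 'M[C]_2) : circ M = M -> mxX Lam (crd M) = M.
Proof.
move=> fixM.
have h i j : circ M i j = M i j by rewrite fixM.
have := (h 0 0, h 0 1, h 1 0, h 1 1).
rewrite /circ /mx2 !mxE /= => -[[[h00 h01] h10] h11].
have {h00} := (congr1 gre h00, congr1 gim h00).
have {h01} := (congr1 gre h01, congr1 gim h01).
have {h10} := (congr1 gre h10, congr1 gim h10).
rewrite ?gE /= => -[e1 e2] [e3 e4] [e5 e6].
apply: mx2P; rewrite /mxX /mx2 !mxE /=; apply: gcE; rewrite /= /crd ?co_vec4 //=;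
  lra.
Qed.

Lemma det_mxX x : \det (mxX Lam x) = GC Lam (co x 2 ^+ 2 + Lam * mink x x) 0.
Proof.
rewrite det_mx22 /mxX /mx2 !mxE /= /mink; apply: gcE; rewrite /= ?gE /=; ring.
Qed.

Lemma detXE x : detX Lam x = co x 2 ^+ 2 + Lam * mink x x.
Proof. by rewrite /detX det_mxX. Qed.

Lemma circE (A : 'M[C]_2) :
  (circ A 0 0 = gconj (A 1 1)) * (circ A 0 1 = - gconj (A 0 1)) *
  (circ A 1 0 = - gconj (A 1 0)) * (circ A 1 1 = gconj (A 0 0)).
Proof. by do !split; rewrite /circ /mx2 mxE. Qed.

Lemma circM (A B : 'M[C]_2) : circ (A *m B) = circ B *m circ A.
Proof.
apply: mx2P; rewrite mulmx2E !circE !mulmx2E; apply: gcE;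
  rewrite /gconj ?gE /= ?gE /=; ring.
Qed.

Lemma circK : involutive (@circ R Lam).
Proof.
move=> A; apply: mx2P; rewrite /circ /mx2 !mxE /=; apply: gcE;
  rewrite /= ?gE /= ?opprK //.
Qed.

Lemma det_circ (A : 'M[C]_2) : \det (circ A) = gconj (\det A).
Proof.
rewrite !det_mx22 /circ /mx2 !mxE /=; apply: gcE; rewrite /= ?gE /=; ring.
Qed.

Lemma mxX_act (A : 'M[C]_2) x : mxX Lam (act A x) = A *m mxX Lam x *m circ A.
Proof. by apply: circ_fixed; rewrite !circM circK circ_mxX mulmxA. Qed.

Lemma detX_act (A : 'M[C]_2) x : detX Lam (act A x) = gnorm2 (\det A) * detX Lam x.
Proof.
rewrite {1}/detX mxX_act !det_mulmx det_circ detXE det_mxX /gnorm2 ?gE /=; ring.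
Qed.

Lemma mxXD x y : mxX Lam (x + y) = mxX Lam x + mxX Lam y.
Proof.
apply: mx2P; rewrite /mxX /mx2 !mxE /=; apply: gcE;
  rewrite /= ?gE /= ?coE; ring.
Qed.

Lemma mxXZ a x : mxX Lam (a *: x) = GC Lam a 0 *: mxX Lam x.
Proof.
apply: mx2P; rewrite /mxX /mx2 !mxE /=; apply: gcE;
  rewrite /= ?gE /= ?coE; ring.
Qed.

Lemma mxX_inj : injective (@mxX R Lam). Proof. exact: can_inj crdK. Qed.

Lemma actD (A : 'M[C]_2) x y : act A (x + y) = act A x + act A y.
Proof.
apply: mxX_inj; apply: (etrans (mxX_act A _)).
apply: (etrans (congr1 (fun M => A *m M *m circ A) (mxXD x y))).
apply: (etrans (mulmx3D _ _ _ _)); apply/esym/(etrans (mxXD _ _)).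
exact: (congr2 (fun M N : 'M[C]_2 => M + N) (mxX_act A x) (mxX_act A y)).
Qed.

Lemma actZ (A : 'M[C]_2) a x : act A (a *: x) = a *: act A x.
Proof.
apply: mxX_inj; apply: (etrans (mxX_act A _)).
apply: (etrans (congr1 (fun M => A *m M *m circ A) (mxXZ a x))).
apply: (etrans (mulmx3Z _ _ _ _)); apply/esym/(etrans (mxXZ _ _)).
exact: (congr1 (fun M : 'M[C]_2 => GC Lam a 0 *: M) (mxX_act A x)).
Qed.

Lemma actM (A B : 'M[C]_2) x : act (A *m B) x = act A (act B x).
Proof.
apply: mxX_inj; apply: (etrans (mxX_act _ _)).
apply: (etrans (congr1 (mulmx (A *m B *m mxX Lam x)) (circM A B))).
apply: (etrans (mulmx3M _ _ _ _ _)); apply/esym/(etrans (mxX_act _ _)).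
exact: (congr1 (fun M : 'M[C]_2 => A *m M *m circ A) (mxX_act B x)).
Qed.

Definition bilX (v w : 'rV[R]_4) : R := co v 2 * co w 2 + Lam * mink v w.

Lemma bilX_act (A : 'M[C]_2) v w :
  bilX (act A v) (act A w) = gnorm2 (\det A) * bilX v w.
Proof.
have pol x y : bilX x y = (detX Lam (x + y) - detX Lam x - detX Lam y) / 2.
  by rewrite /bilX !detXE /mink !coE; field.
rewrite (pol (act A v) (act A w)) (pol v w) -(actD A v w).
move: (detX_act A (v + w)) (detX_act A v) (detX_act A w).
generalize (detX Lam (act A (v + w))) (detX Lam (act A v)) (detX Lam (act A w)).
by move=> ? ? ? -> -> ->; field.
Qed.

Definition metric_num (x v w : 'rV[R]_4) : R :=
  mink (co x 2 *: v - co v 2 *: x) (co x 2 *: w - co w 2 *: x)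
  + Lam * (mink x x * mink v w - mink x v * mink x w).

Lemma metric_num_bilX x v w :
  Lam * metric_num x v w = bilX x x * bilX v w - bilX x v * bilX x w.
Proof. rewrite /metric_num /bilX /mink !coE; ring. Qed.

Lemma co2_act0 (A : 'M[C]_2) x : Lam = 0 ->
  co (act A x) 2 = gre (\det A) * co x 2.
Proof.
rewrite /act /crd co_vec4 //= mulmx2E !mulmx2E !circE det_mx22.
rewrite /gconj /mxX /mx2 !mxE /= ?gE /= ?gE /=.
move: (gre (A 0 0)) (gim (A 0 0)) (gre (A 0 1)) (gim (A 0 1))
  (gre (A 1 0)) (gim (A 1 0)) (gre (A 1 1)) (gim (A 1 1)) => *.
by subst Lam; ring.
Qed.

Lemma mink_act0 (A : 'M[C]_2) v w : Lam = 0 -> co v 2 = 0 -> co w 2 = 0 ->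
  mink (act A v) (act A w) = gre (\det A) ^+ 2 * mink v w.
Proof.
move=> L0 v0 w0.
pose p := gre (A 0 0); pose q := gre (A 0 1).
pose r := gre (A 1 0); pose t := gre (A 1 1).
have h4 u : co u 2 = 0 -> co (act A u) 4 =
  (p * co u 4 + q * (co u 3 + co u 1)) * t - (p * (co u 3 - co u 1) - q * co u 4) * r.
  move: L0; rewrite /act /crd co_vec4 //= ?mulmx2E ?circE.
  rewrite /gconj /mxX /mx2 !mxE /= ?gE /= ?gE /= /p /q /r /t.
  move: (gre (A 0 0)) (gim (A 0 0)) (gre (A 0 1)) (gim (A 0 1))
    (gre (A 1 0)) (gim (A 1 0)) (gre (A 1 1)) (gim (A 1 1)).
  by move=> ? ? ? ? ? ? ? ? L0 ->; subst Lam; field.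
have h1 u : co u 2 = 0 -> co (act A u) 1 =
  ((r * co u 4 + t * (co u 3 + co u 1)) * t - (r * (co u 3 - co u 1) - t * co u 4) * r
   - (- p * co u 4 - q * (co u 3 + co u 1)) * q
   - (p * (co u 3 - co u 1) - q * co u 4) * p) / 2.
  move: L0; rewrite /act /crd co_vec4 //= ?mulmx2E ?circE.
  rewrite /gconj /mxX /mx2 !mxE /= ?gE /= ?gE /= /p /q /r /t.
  move: (gre (A 0 0)) (gim (A 0 0)) (gre (A 0 1)) (gim (A 0 1))
    (gre (A 1 0)) (gim (A 1 0)) (gre (A 1 1)) (gim (A 1 1)).
  by move=> ? ? ? ? ? ? ? ? L0 ->; subst Lam; field.
have h3 u : co u 2 = 0 -> co (act A u) 3 =
  ((r * co u 4 + t * (co u 3 + co u 1)) * t - (r * (co u 3 - co u 1) - t * co u 4) * r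
   + (- p * co u 4 - q * (co u 3 + co u 1)) * q
   + (p * (co u 3 - co u 1) - q * co u 4) * p) / 2.
  move: L0; rewrite /act /crd co_vec4 //= ?mulmx2E ?circE.
  rewrite /gconj /mxX /mx2 !mxE /= ?gE /= ?gE /= /p /q /r /t.
  move: (gre (A 0 0)) (gim (A 0 0)) (gre (A 0 1)) (gim (A 0 1))
    (gre (A 1 0)) (gim (A 1 0)) (gre (A 1 1)) (gim (A 1 1)).
  by move=> ? ? ? ? ? ? ? ? L0 ->; subst Lam; field.
have -> : gre (\det A) = p * t - q * r.
  rewrite det_mx22 ?gE /= /p /q /r /t.
  move: (gre (A 0 0)) (gim (A 0 0)) (gre (A 0 1)) (gim (A 0 1))
    (gre (A 1 0)) (gim (A 1 0)) (gre (A 1 1)) (gim (A 1 1)).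
  by move=> *; rewrite L0; ring.
rewrite /mink.
move: (h1 v v0) (h1 w w0) (h3 v v0) (h3 w w0) (h4 v v0) (h4 w w0).
generalize (co (act A v) 1) (co (act A w) 1) (co (act A v) 3) (co (act A w) 3)
  (co (act A v) 4) (co (act A w) 4).
by move=> ? ? ? ? ? ? -> -> -> -> -> ->; field.
Qed.

Lemma metric_num0 x v w : Lam = 0 -> metric_num x v w =
  mink (co x 2 *: v - co v 2 *: x) (co x 2 *: w - co w 2 *: x).
Proof. by rewrite /metric_num => ->; rewrite mul0r addr0. Qed.

Lemma minkZ a v w : mink (a *: v) (a *: w) = a ^+ 2 * mink v w :> R.
Proof. by rewrite /mink !coE; ring. Qed.

Lemma act_lin0 (A : 'M[C]_2) x v : Lam = 0 ->
  co (act A x) 2 *: act A v - co (act A v) 2 *: act A x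
    = gre (\det A) *: act A (co x 2 *: v - co v 2 *: x).
Proof.
move=> L0.
have -> : act A (co x 2 *: v - co v 2 *: x)
    = co x 2 *: act A v - co v 2 *: act A x.
  apply: (etrans (actD A _ _)); congr (_ + _); first exact: actZ.
  by rewrite -!scaleNr; exact: actZ.
move: (co2_act0 A x L0) (co2_act0 A v L0).
generalize (co (act A x) 2) (co (act A v) 2) (act A x) (act A v).
by move=> ? ? ? ? -> ->; rewrite scalerBr !scalerA.
Qed.

Lemma metric_num_act (A : 'M[C]_2) x v w :
  metric_num (act A x) (act A v) (act A w)
    = gnorm2 (\det A) ^+ 2 * metric_num x v w.
Proof.
have [L0|L0] := eqVneq Lam 0; last first.
  apply: (mulfI L0); rewrite mulrCA !metric_num_bilX.
  move: (bilX_act A x x) (bilX_act A v w) (bilX_act A x v) (bilX_act A x w).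
  generalize (bilX (act A x) (act A x)) (bilX (act A v) (act A w))
    (bilX (act A x) (act A v)) (bilX (act A x) (act A w)).
  by move=> ? ? ? ? -> -> -> ->; ring.
have n2 : gnorm2 (\det A) = gre (\det A) ^+ 2.
  rewrite /gnorm2 gE /=; generalize (gre (\det A)) (gim (\det A)) => ? ?.
  by rewrite L0; ring.
apply: (etrans (metric_num0 _ _ _ L0)).
apply: (etrans (congr2 mink (act_lin0 A x v L0) (act_lin0 A x w L0))).
apply: (etrans (minkZ _ _ _)).
rewrite (metric_num0 _ _ _ L0) n2.
have m0 u : co (co x 2 *: u - co u 2 *: x) 2 = 0 by rewrite !coE; ring.
move: (mink_act0 A L0 (m0 v) (m0 w)).
generalize (gre (\det A)) => a e; apply: (etrans (congr1 ( *%R (a ^+ 2)) e)).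
by rewrite mulrA -expr2.
Qed.

Lemma metric_inv : inv_metric Lam (metric Lam).
Proof.
split=> [x v w c|x v w a b|A x v w|v w].
- rewrite /XX /= => dx c0; rewrite /metric.
  have -> : detX Lam (c *: x) = c ^+ 2 * detX Lam x.
    by rewrite !detXE /mink !coE; ring.
  by rewrite /mink !coE; field; rewrite c0 gt_eqF.
- by move=> _; rewrite /metric; congr (_ / _); rewrite /mink !coE; ring.
- rewrite /XX /= => dA dx.
  have -> : metric Lam x v w = metric_num x v w / detX Lam x ^+ 2 by [].
  apply: (etrans (congr2 (fun a b => a / b ^+ 2) (metric_num_act A x v w)
    (detX_act A x))).
  by field; rewrite !gt_eqF.
- rewrite /metric !detXE /idX /mink !coE !co_vec4 //=.
  by field.
Qed.

Lemma act_scalar d (v : 'rV[R]_4) : act (GC Lam d 0)%:M v = d ^+ 2 *: v.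
Proof.
apply: mxX_inj; rewrite mxX_act mxXZ mul_scalar_mx.
have -> : circ (GC Lam d 0)%:M = (GC Lam d 0)%:M.
  by apply: mx2P; rewrite /circ /mx2 !mxE /=; apply: gcE;
    rewrite /= ?gE /= ?oppr0.
rewrite mul_mx_scalar scalerA; congr (_ *: _).
by apply: gcE; rewrite gE /=; ring.
Qed.

Lemma inv_metric_pull (x : 'rV[R]_4) : XX Lam x ->
  exists T : 'rV[R]_4 -> 'rV[R]_4, forall g, inv_metric Lam g ->
    forall v w, g x v w = mink (T v) (T w).
Proof.
wlog x2 : x / 0 <= co x 2 => [hw dx|].
  have [|/ltW x2] := leP 0 (co x 2); first by move=> /hw; apply.
  have [||T hT] := hw (- x); rewrite ?coN ?oppr_ge0 //.
    by move: dx; rewrite /XX /= !detXE /mink !coN !mulrNN sqrrN.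
  exists (fun v => T (- v)) => g gi v w; rewrite -(hT g gi).
  have n1 : (-1 : R) != 0 by rewrite oppr_eq0 oner_eq0.
  by rewrite -(@inv_metric_scale _ _ _ gi x v w (-1) dx n1) !scaleN1r.
rewrite /XX /= => dx; set s := Num.sqrt (detX Lam x).
have s0 : 0 < s by rewrite sqrtr_gt0.
have s2 : s ^+ 2 = detX Lam x by rewrite sqr_sqrtr // ltW.
pose u := x + s *: idX; pose d := detX Lam u.
pose A := mxX Lam u.
pose B := mxX Lam (vec4 (- co u 1) (co u 2) (- co u 3) (- co u 4)).
pose c := 2 * (co x 2 + s).
have c0 : 0 < c by rewrite mulr_gt0 // ltr_wpDl.
have dE : d = s * c.
  have -> : d = detX Lam x + 2 * co x 2 * s + s ^+ 2.
    by rewrite /d !detXE /mink /u /idX !coE !co_vec4 //=; ring.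
  by rewrite -s2 /c; ring.
have d0 : 0 < d by rewrite dE mulr_gt0.
have AB : A *m B = (GC Lam d 0)%:M.
  apply: mx2P; rewrite mulmx2E /A /B /mxX /mx2 !mxE /= !co_vec4 //=; apply: gcE;
    rewrite /= ?gE /= ?/d ?detXE /mink; ring.
have nA : 0 < gnorm2 (\det A).
  by rewrite det_mxX -detXE -/d /gnorm2 gE /= oppr0 mulr0 subr0 mulr_gt0.
have Aid : act A idX = c *: x.
  have mxX_id : mxX Lam idX = 1%:M.
    by apply: mx2P; rewrite /mxX /idX !co_vec4 //= /mx2 !mxE /=; apply: gcE;
      rewrite /= ?(subr0, addr0, oppr0).
  have -> : act A idX = crd (A *m A).
    by rewrite /act mxX_id mulmx1 circ_mxX.
  have s2' : s ^+ 2 = co x 2 ^+ 2 + Lam * mink x x by rewrite s2 detXE.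
  apply: co_inj; rewrite /crd co_vec4 //= !mulmx2E /A /mxX /mx2 !mxE /= ?gE /=;
    rewrite /u /idX !coE !co_vec4 //= /c.
  - by field.
  - by move: s2'; rewrite /mink => ?; lra.
  - by field.
  - by ring.
exists (fun v => (c / d ^+ 2) *: act B v) => g gi v w.
have hv z : c *: z = act A ((c / d ^+ 2) *: act B z).
  apply/esym/(etrans (actZ _ _ _)).
  apply: (etrans (congr1 ( *:%R (c / d ^+ 2)) (esym (actM A B z)))).
  by rewrite AB act_scalar scalerA divfK // expf_neq0 // gt_eqF.
have cn0 : c != 0 by rewrite gt_eqF.
rewrite -(@inv_metric_scale _ _ _ gi x v w c dx cn0) (hv v) (hv w) -Aid.
have XXid : XX Lam idX.
  by rewrite /XX /= detXE /idX /mink !co_vec4 //= !mulr0 oppr0 !addr0 mulr0 addr0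
    expr1n ltr01.
apply: (etrans (@inv_metric_act _ _ _ gi A idX _ _ nA XXid)).
exact: inv_metric_id gi _ _.
Qed.

Lemma metric_unique g : inv_metric Lam g ->
  forall x v w, XX Lam x -> g x v w = metric Lam x v w.
Proof.
by move=> gi x v w /inv_metric_pull[T hT]; rewrite !hT //; exact: metric_inv.
Qed.

End Facts.

(* Main.v *)
(* With Q the quadratic form det, the volume form in the chart x_2 = 1 has density
   Q^-2, which is homogeneous of degree -4; hence the volume can be computed in
   any linear coordinates of R^4.  The edge lengths determine the Gram matrix of
   the normalised vertices, whose entries are c(0), c(alpha), c(beta) and
   c(alpha + beta) with c = cosh, 1, cos.

   For Lam = 1, -1 choose coordinates (X, W, u, p) in which Q is
   u^2 + 2 u p + W^2 + Lam X^2, the first vertex is (0, 0, 1, 0) and the other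
   three have u = 0.  At W = 1 the tetrahedron is the set of all (X, u, p) with
   u >= 0 and p in an interval depending on X alone.  With X = s(t) / c(t) the
   end points of this interval are c(z) / c(t) for two piecewise affine functions
   z of t, and the integral of Q^-2 over u and p is Lam / (2 (1 + Lam X^2)) times
   the difference of the values of z c(z) / s(z).  Since dX / (1 + Lam X^2) = dt,
   the volume is Lam (Psi alpha + Psi beta - Psi (alpha + beta)), where Psi is a
   primitive of z c(z) / s(z), and integration by parts relates Psi to the
   Clausen function.  For Lam = 0 the volume is one sixth of a determinant, which
   is found from the edge lengths. *)
Require Import Defs.
From HB Require Import structures.
From mathcomp Require Import all_boot all_order all_algebra.
From mathcomp Require Import all_classical all_reals all_analysis.
From mathcomp Require Import fingroup perm measurable_realfun ring lra.
Set Implicit Arguments.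
Unset Strict Implicit.
Unset Printing Implicit Defensive.
Import Order.TTheory GRing.Theory Num.Theory.
Import numFieldNormedType.Exports.
Local Open Scope classical_set_scope.
Local Open Scope ring_scope.

(** * Changes of variables *)

(** The coordinates adapted to the tetrahedron do not preserve the chart [x_2 = 1]. Comparing
    superlevel sets of homogeneous functions in R^4 needs only the determinants of linear maps and
    no projective Jacobian.

    The vertices have the following origin. On [u = 0] the form degenerates to [W^2 + Lam X^2], so
    lengths in this face are read off from the points [(X, W) = (s t, c t)] of a curve, one of them
    being the sum of the other two. With [h = (alpha + beta) / 2] and [de = (beta - alpha) / 2] the
    parameters [-h], [h], [de] have the differences [alpha + beta], [beta], [alpha]. The coordinates
    [p] remain free and record the products with the first vertex.

    For [Lam = 1, -1] the Gram matrix determines the volume, since the two quadratic forms have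
    equal determinants. For [Lam = 0] the bilinear form has rank one and sees no length, so the
    squared lengths themselves enter a determinant of Cayley-Menger type.

    For [Lam = 1] the function [z c(z) / s(z)] has a pole at [pi]. An auxiliary bound [m] above
    [alpha + beta] keeps away from it, so that [Psi] is differentiable at [alpha + beta]. *)

Section AffineSubstitution.
Context {R : realType}.
Notation mu := (@lebesgue_measure R).

(** Lebesgue measure is determined by its values on half-open intervals. Their preimages are again
    intervals, with the ends exchanged if [c] is negative. *)
Lemma affine_preimage_measure (c d : R) : c != 0 ->
  forall A, measurable A ->
    mu A = (`|c|%:E * pushforward mu (fun x : R => (c * x + d : measurableTypeR R)%R) A)%E.
Proof.
move=> c0.
have mf : measurable_fun setT (fun x : R => (c * x + d : measurableTypeR R)%R).
  by apply: measurable_funD => //; apply: measurable_funM.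
pose cn : {nonneg R} := NngNum (normr_ge0 c).
pose nu := mscale cn (pushforward mu (fun x : R => (c * x + d : measurableTypeR R)%R)).
suff h : forall X, ocitv X -> mu X = nu mf X.
  by move=> A mA; rewrite (lebesgue_measure_unique h).
move=> _ [[a b] _ <-]; rewrite /nu /mscale /= /pushforward.
have [cpos|cneg|c00] := ltgtP 0 c; last by rewrite -c00 eqxx in c0.
- have -> : (fun x : R => c * x + d) @^-1` `]a, b] = `](a - d) / c, (b - d) / c]%classic.
    apply/seteqP; split => x /=; rewrite !in_itv /=.
      by rewrite ltr_pdivrMr// ler_pdivlMr// ltrBlDr lerBrDr ![x * c]mulrC.
    by rewrite ltr_pdivrMr// ler_pdivlMr// ltrBlDr lerBrDr ![x * c]mulrC.
  rewrite !lebesgue_measure_itv /= !lte_fin ltr_pM2r ?invr_gt0// ltrD2r.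
  case: ifP => _; last by rewrite mule0.
  rewrite -!EFinB -EFinM; congr EFin; rewrite gtr0_norm//; field.
  by rewrite gt_eqF.
- have -> : (fun x : R => c * x + d) @^-1` `]a, b] = `[(b - d) / c, (a - d) / c[%classic.
    apply/seteqP; split => x /=; rewrite !in_itv /=.
      by rewrite ltr_ndivlMr// ler_ndivrMr// ltrBlDr lerBrDr ![x * c]mulrC andbC.
    by rewrite ltr_ndivlMr// ler_ndivrMr// ltrBlDr lerBrDr ![x * c]mulrC andbC.
  rewrite !lebesgue_measure_itv /= !lte_fin ltr_nM2r ?invr_lt0// ltrD2r.
  case: ifP => _; last by rewrite mule0.
  rewrite -!EFinB -EFinM; congr EFin; rewrite ltr0_norm//; field.
  by rewrite lt_eqF.
Qed.

Lemma ge0_integral_affine (c d : R) (f : R -> \bar R) : c != 0 ->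
  measurable_fun setT f -> (forall x, (0 <= f x)%E) ->
  (\int[mu]_x f x = `|c|%:E * \int[mu]_x f (c * x + d)%R)%E.
Proof.
move=> c0 mf f0.
have mphi : measurable_fun setT (fun x : R => (c * x + d : measurableTypeR R)%R).
  by apply: measurable_funD => //; apply: measurable_funM.
pose cn : {nonneg R} := NngNum (normr_ge0 c).
pose nu := mscale cn (pushforward mu (fun x : R => (c * x + d : measurableTypeR R)%R)).
transitivity (\int[nu mphi]_x f x)%E.
  by apply: eq_measure_integral => A mA _; rewrite /nu /mscale /=; apply: affine_preimage_measure.
rewrite /nu ge0_integral_mscale//; congr (_ * _)%E.
by rewrite ge0_integral_pushforward.
Qed.

Lemma eq_integral_except (r : R) (D : set R) (f g : R -> \bar R) : measurable D ->
  measurable_fun D f -> measurable_fun D g ->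
  (forall x, D x -> x != r -> f x = g x) ->
  (\int[mu]_(x in D) f x = \int[mu]_(x in D) g x)%E.
Proof.
move=> mD mf mg fg; have mDr : measurable (D `\ r) by exact: measurableD.
have sub : D `\ r `<=` D by move=> x [].
rewrite -[LHS](integral_setD1 (r := r) mDr (measurable_funS mD sub mf)).
rewrite -[RHS](integral_setD1 (r := r) mDr (measurable_funS mD sub mg)).
by apply: eq_integral => x /set_mem[Dx /= /eqP]; exact: fg.
Qed.

End AffineSubstitution.

Section ProductMeasure.
Local Open Scope ereal_scope.
Context d1 d2 (T1 : measurableType d1) (T2 : measurableType d2) (R : realType).
Variable m1 : {sigma_finite_measure set T1 -> \bar R}.
Variable m2 : {sigma_finite_measure set T2 -> \bar R}.

(* The constant [product_measure1] carries a canonical sigma-finite structure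
   only for subprobabilities; this alias of it is always sigma-finite, so that
   Tonelli's theorem applies to iterated products. *)
Definition prodm : set (T1 * T2) -> \bar R := m1 \x m2.

Let prodm0 : prodm set0 = 0. Proof. exact: measure0. Qed.
Let prodm_ge0 A : 0 <= prodm A. Proof. exact: measure_ge0. Qed.
Let prodm_sigma_additive : semi_sigma_additive prodm.
Proof. exact: measure_semi_sigma_additive. Qed.

HB.instance Definition _ := isMeasure.Build _ _ _ prodm
  prodm0 prodm_ge0 prodm_sigma_additive.

Let prodm_sigma_finite : sigma_finite setT prodm.
Proof.
have /sigma_finiteP[F [TF ndF Ffin]] := sigma_finiteT m1.
have /sigma_finiteP[G [TG ndG Gfin]] := sigma_finiteT m2.
exists (fun n => F n `*` G n) => [|n].
  apply/esym/seteqP; split => // -[x y] _.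
  have [i _ Fx] : (\bigcup_i F i) x by rewrite -TF.
  have [j _ Gy] : (\bigcup_i G i) y by rewrite -TG.
  exists (maxn i j) => //; split.
    by move: x Fx; exact/subsetPset/ndF/leq_maxl.
  by move: y Gy; exact/subsetPset/ndG/leq_maxr.
have [mF Foo] := Ffin n; have [mG Goo] := Gfin n; split; first exact: measurableX.
by rewrite /prodm product_measure1E// lte_mul_pinfty// ge0_fin_numE.
Qed.

HB.instance Definition _ := Measure_isSigmaFinite.Build _ _ _ prodm
  prodm_sigma_finite.

Lemma tonelli1 (f : T1 * T2 -> \bar R) : measurable_fun setT f ->
  (forall p, 0 <= f p) -> \int[prodm]_p f p = \int[m1]_x \int[m2]_y f (x, y).
Proof. exact: fubini_tonelli1. Qed.

Lemma tonelli2 (f : T1 * T2 -> \bar R) : measurable_fun setT f ->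
  (forall p, 0 <= f p) -> \int[prodm]_p f p = \int[m2]_y \int[m1]_x f (x, y).
Proof. exact: fubini_tonelli2. Qed.

End ProductMeasure.
Notation "m1 \X m2" := (prodm m1 m2) (at level 40, left associativity) : ereal_scope.

(** * Maps with constant Jacobian *)

Section JacobianFactor.
Context {R : realType}.
Notation mu := (@lebesgue_measure R).

(** A change of variables is described by its effect on integrals of nonnegative functions. In this
    form it passes to compositions, and by Tonelli's theorem to products with an identity map,
    without any differentiation. *)
Definition has_jacobian d1 d2 (T1 : measurableType d1) (T2 : measurableType d2)
    (m1 : set T1 -> \bar R) (m2 : set T2 -> \bar R) (phi : T1 -> T2) (k : R) :=
  [/\ measurable_fun setT phi, 0 <= k &
    forall f : T2 -> \bar R, measurable_fun setT f -> (forall x, (0 <= f x)%E) ->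
      (\int[m2]_x f x = k%:E * \int[m1]_x f (phi x))%E].

Lemma jacobian_id d (T : measurableType d) (m : set T -> \bar R) :
  has_jacobian m m id 1.
Proof. by split => // f _ _; rewrite mul1e. Qed.

Lemma jacobian_comp d1 d2 d3 (T1 : measurableType d1) (T2 : measurableType d2)
    (T3 : measurableType d3) (m1 : set T1 -> \bar R) (m2 : set T2 -> \bar R)
    (m3 : set T3 -> \bar R) (phi : T1 -> T2) (psi : T2 -> T3) k l :
  has_jacobian m1 m2 phi k -> has_jacobian m2 m3 psi l ->
  has_jacobian m1 m3 (psi \o phi) (l * k).
Proof.
move=> [mphi k0 hphi] [mpsi l0 hpsi]; split => [||f mf f0].
- exact: measurableT_comp.
- exact: mulr_ge0.
- rewrite hpsi// EFinM -muleA; congr (_ * _)%E.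
  by apply: (hphi (f \o psi)) => [|x]; [exact: measurableT_comp|exact: f0].
Qed.

Lemma jacobian_affine (c d : R) : c != 0 ->
  has_jacobian mu mu (fun x : R => c * x + d) `|c|.
Proof.
move=> c0; split => // [|f mf f0]; last exact: ge0_integral_affine.
by apply: measurable_funD => //; apply: measurable_funM.
Qed.

Lemma jacobian_swap d1 d2 (T1 : measurableType d1) (T2 : measurableType d2)
    (m1 : {sigma_finite_measure set T1 -> \bar R})
    (m2 : {sigma_finite_measure set T2 -> \bar R}) :
  has_jacobian (m1 \X m2)%E (m2 \X m1)%E (fun p => (p.2, p.1)) 1.
Proof.
have msw : measurable_fun setT (fun p : T1 * T2 => (p.2, p.1)).
  by apply: measurable_fun_pair.
split => // f mf f0; rewrite mul1e tonelli1// tonelli2//.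
exact: (measurableT_comp mf msw).
Qed.

Lemma jacobian_assoc d1 d2 d3 (T1 : measurableType d1) (T2 : measurableType d2)
    (T3 : measurableType d3) (m1 : {sigma_finite_measure set T1 -> \bar R})
    (m2 : {sigma_finite_measure set T2 -> \bar R})
    (m3 : {sigma_finite_measure set T3 -> \bar R}) :
  has_jacobian (m1 \X (m2 \X m3))%E ((m1 \X m2) \X m3)%E
    (fun p => ((p.1, p.2.1), p.2.2)) 1.
Proof.
have mas : measurable_fun setT (fun p : T1 * (T2 * T3) => ((p.1, p.2.1), p.2.2)).
  apply: measurable_fun_pair; last exact: measurableT_comp.
  by apply: measurable_fun_pair => //; exact: measurableT_comp.
split => // f mf f0; rewrite mul1e.
rewrite tonelli1// (tonelli1 m1 m2 (measurable_fun_fubini_tonelli_F f mf f0)); last first.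
  by move=> x; apply: integral_ge0.
rewrite (tonelli1 _ _ (measurableT_comp mf mas)); last by move=> p; exact: f0.
apply: eq_integral => x _; apply/esym.
apply: (tonelli1 m2 m3 (f := fun p => f (x, p.1, p.2))) => //.
exact: (measurableT_comp (measurableT_comp mf mas) (pair1_measurable x)).
Qed.

Lemma jacobian_unassoc d1 d2 d3 (T1 : measurableType d1) (T2 : measurableType d2)
    (T3 : measurableType d3) (m1 : {sigma_finite_measure set T1 -> \bar R})
    (m2 : {sigma_finite_measure set T2 -> \bar R})
    (m3 : {sigma_finite_measure set T3 -> \bar R}) :
  has_jacobian ((m1 \X m2) \X m3)%E (m1 \X (m2 \X m3))%E
    (fun p => (p.1.1, (p.1.2, p.2))) 1.
Proof.
have mas : measurable_fun setT (fun p : T1 * T2 * T3 => (p.1.1, (p.1.2, p.2))).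
  apply: measurable_fun_pair; first exact: measurableT_comp.
  by apply: measurable_fun_pair => //; exact: measurableT_comp.
split => // f mf f0; rewrite mul1e.
have [_ _ h] := jacobian_assoc m1 m2 m3.
rewrite (h _ (measurableT_comp mf mas) (fun p => f0 _)) mul1e.
by apply: eq_integral => -[? []].
Qed.

Lemma jacobian_prodr d1 d2 d3 (T1 : measurableType d1) (T2 : measurableType d2)
    (T3 : measurableType d3) (m1 : {sigma_finite_measure set T1 -> \bar R})
    (m2 : {sigma_finite_measure set T2 -> \bar R})
    (m3 : {sigma_finite_measure set T3 -> \bar R}) (phi : T2 -> T3) k :
  has_jacobian m2 m3 phi k ->
  has_jacobian (m1 \X m2)%E (m1 \X m3)%E (fun p => (p.1, phi p.2)) k.
Proof.
move=> [mphi k0 h].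
have mas : measurable_fun setT (fun p : T1 * T2 => (p.1, phi p.2)).
  by apply: measurable_fun_pair => //; exact: measurableT_comp.
split => // f mf f0; have mfa := measurableT_comp mf mas.
rewrite (tonelli1 _ _ mf f0) (tonelli1 _ _ mfa (fun p => f0 _)) -ge0_integralZl//; last 2 first.
- exact: (measurable_fun_fubini_tonelli_F _ mfa (fun p => f0 _)).
- by move=> x _; apply: integral_ge0 => y _; exact: f0.
apply: eq_integral => x _; rewrite h//.
exact: (measurableT_comp mf).
Qed.

Lemma jacobian_prodl d1 d2 d3 (T1 : measurableType d1) (T2 : measurableType d2)
    (T3 : measurableType d3) (m1 : {sigma_finite_measure set T1 -> \bar R})
    (m2 : {sigma_finite_measure set T2 -> \bar R})
    (m3 : {sigma_finite_measure set T3 -> \bar R}) (phi : T2 -> T3) k :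
  has_jacobian m2 m3 phi k ->
  has_jacobian (m2 \X m1)%E (m3 \X m1)%E (fun p => (phi p.1, p.2)) k.
Proof.
move=> h; rewrite -[k]mul1r -[k in 1 * k]mulr1.
exact: (jacobian_comp (jacobian_comp (jacobian_swap m2 m1)
  (jacobian_prodr m1 h)) (jacobian_swap m1 m3)).
Qed.

Lemma jacobian_swap12 d1 d2 d3 (T1 : measurableType d1) (T2 : measurableType d2)
    (T3 : measurableType d3) (m1 : {sigma_finite_measure set T1 -> \bar R})
    (m2 : {sigma_finite_measure set T2 -> \bar R})
    (m3 : {sigma_finite_measure set T3 -> \bar R}) :
  has_jacobian (m1 \X (m2 \X m3))%E (m2 \X (m1 \X m3))%E
    (fun p => (p.2.1, (p.1, p.2.2))) 1.
Proof.
have -> : 1 = 1 * (1 * 1) :> R by rewrite !mul1r.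
exact: (jacobian_comp (jacobian_comp (jacobian_assoc m1 m2 m3)
  (jacobian_prodl m3 (jacobian_swap m1 m2))) (jacobian_unassoc m2 m1 m3)).
Qed.

(** For a fixed second component the map is affine on the line, so integrating over the line first
    reduces everything to dimension one. *)
Lemma jacobian_shear d (T : measurableType d)
    (m : {sigma_finite_measure set T -> \bar R}) (c : R) (g : T -> R) :
  c != 0 -> measurable_fun setT g ->
  has_jacobian (mu \X m)%E (mu \X m)%E (fun p => (c * p.1 + g p.2, p.2)) `|c|.
Proof.
move=> c0 mg.
have msh : measurable_fun setT (fun p : R * T => (c * p.1 + g p.2, p.2)).
  apply: measurable_fun_pair => //; apply: measurable_funD.
    exact: measurable_funM.
  exact: measurableT_comp.
split => // f mf f0; have mfs := measurableT_comp mf msh.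
apply: (etrans (tonelli2 mu m mf f0)); apply/esym.
apply: (etrans (congr1 (mule `|c|%:E) (tonelli2 mu m mfs (fun p => f0 _)))).
rewrite -ge0_integralZl//; last 2 first.
- exact: (@measurable_fun_fubini_tonelli_G _ _ (measurableTypeR R) T R mu _ mfs (fun p => f0 _)).
- by move=> x _; apply: integral_ge0 => y _; exact: f0.
apply: eq_integral => y _; apply/esym.
apply: (@ge0_integral_affine _ c (g y) (fun x => f (x, y))) => //.
exact: (measurableT_comp mf).
Qed.

End JacobianFactor.

(** * Linear changes of variables in R^4 *)

Lemma lup_decomposition (F : fieldType) n (A : 'M[F]_n.+1) :
  exists (s : 'S_n.+1) (L U : 'M[F]_n.+1),
    [/\ A = perm_mx s *m L *m U, \det L = 1,
        forall i j : 'I_n.+1, (i <= j)%N -> L i j = (i == j)%:R &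
        forall i j : 'I_n.+1, (j < i)%N -> U i j = 0].
Proof.
have := cormen_lup_correct A; have /is_perm_mxP[s] := cormen_lup_perm A.
have := cormen_lup_detL A; have := @cormen_lup_lower _ _ A; have := @cormen_lup_upper _ _ A.
case: (cormen_lup A) => -[P L] U Uup Llow Ldet Ps PL.
exists s^-1%g, L, U; split => //.
rewrite -mulmxA; move: PL; rewrite [P]Ps -!mulmxE => <-.
by rewrite mulmxA -perm_mxM mulVg perm_mx1 mul1mx.
Qed.

Section LinearChange.
Context {R : realType}.
Notation mu := (@lebesgue_measure R).
Notation T3 := (R * (R * R))%type.
Notation T4 := (R * (R * (R * R)))%type.
Notation mu3 := (mu \X (mu \X mu))%E.
Notation mu4 := (mu \X (mu \X (mu \X mu)))%E.

(* The chart coordinate [x_2] comes first. *)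
Definition toV (p : T4) : 'rV[R]_4 := vec4 p.2.1 p.1 p.2.2.1 p.2.2.2.
Definition ofV (x : 'rV[R]_4) : T4 := (co x 2, (co x 1, (co x 3, co x 4))).

Lemma toVK : cancel toV ofV.
Proof. by case=> a [b [c d]]; rewrite /ofV /toV !co_vec4. Qed.

Lemma ofVK : cancel ofV toV.
Proof. by move=> x; apply: co_inj; rewrite /toV !co_vec4. Qed.

Definition linT (M : 'M[R]_4) (p : T4) : T4 := ofV (toV p *m M).

Definition lin_jac (M : 'M[R]_4) (k : R) := has_jacobian mu4 mu4 (linT M) k.

Lemma lin_jac_mul M N k l : lin_jac M k -> lin_jac N l -> lin_jac (M *m N) (l * k).
Proof.
move=> hM hN; rewrite /lin_jac.
have -> : linT (M *m N) = linT N \o linT M.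
  by apply/funext => p; rewrite /linT /= ofVK mulmxA.
exact: jacobian_comp hM hN.
Qed.

Lemma lin_jac1 : lin_jac 1%:M 1.
Proof.
rewrite /lin_jac; have -> : linT 1%:M = id.
  by apply/funext => p; rewrite /linT mulmx1 toVK.
exact: jacobian_id.
Qed.

Notation o0 := (inord 0 : 'I_4).
Notation o1 := (inord 1 : 'I_4).
Notation o2 := (inord 2 : 'I_4).
Notation o3 := (inord 3 : 'I_4).

Lemma ord4P (i : 'I_4) : [\/ i = o0, i = o1, i = o2 | i = o3].
Proof.
rewrite -[i]inord_val; case: i => -[|[|[|[|//]]]] /= _;
  by [exact: Or41|exact: Or42|exact: Or43|exact: Or44].
Qed.

Lemma inord4_eq i j : (i < 4)%N -> (j < 4)%N -> ((inord i : 'I_4) == inord j) = (i == j).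
Proof. by move=> i4 j4; rewrite -val_eqE /= !inordK. Qed.

Lemma lin_tperm (x : 'rV[R]_4) i j k :
  (x *m tperm_mx i j) 0 k = x 0 (tperm i j k).
Proof. by rewrite -xcolE xcolEsub mxE. Qed.

(** The components of [T4] carry the vector indices 1, 0, 2, 3 in this order. The transpositions (0
    1), (0 2) and (2 3) are therefore those of neighbouring components, which swapping and
    reassociating products provide. *)
Lemma lin_jac_tperm01 : lin_jac (tperm_mx o0 o1) 1.
Proof.
have -> : lin_jac (tperm_mx o0 o1) 1 = has_jacobian mu4 mu4
    (fun p : T4 => (p.2.1, (p.1, p.2.2))) 1; last exact: jacobian_swap12.
congr has_jacobian; apply/funext => -[a [b [c d]]] /=.
rewrite /linT /ofV /co !lin_tperm /= tpermR tpermL !tpermD ?inord4_eq//.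
by rewrite -!/(co _ 1) -!/(co _ 2) -!/(co _ 3) -!/(co _ 4) /toV !co_vec4.
Qed.

Lemma lin_jac_tperm02 : lin_jac (tperm_mx o0 o2) 1.
Proof.
have -> : lin_jac (tperm_mx o0 o2) 1 = has_jacobian mu4 mu4
    (fun p : T4 => (p.1, (p.2.2.1, (p.2.1, p.2.2.2)))) 1; last first.
  exact: (jacobian_prodr mu (jacobian_swap12 mu mu mu)).
congr has_jacobian; apply/funext => -[a [b [c d]]] /=.
rewrite /linT /ofV /co !lin_tperm /= tpermR tpermL !tpermD ?inord4_eq//.
by rewrite -!/(co _ 1) -!/(co _ 2) -!/(co _ 3) -!/(co _ 4) /toV !co_vec4.
Qed.

Lemma lin_jac_tperm23 : lin_jac (tperm_mx o2 o3) 1.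
Proof.
have -> : lin_jac (tperm_mx o2 o3) 1 = has_jacobian mu4 mu4
    (fun p : T4 => (p.1, (p.2.1, (p.2.2.2, p.2.2.1)))) 1; last first.
  exact: (jacobian_prodr mu (jacobian_prodr mu (jacobian_swap mu mu))).
congr has_jacobian; apply/funext => -[a [b [c d]]] /=.
rewrite /linT /ofV /co !lin_tperm /= tpermR tpermL !tpermD ?inord4_eq//.
by rewrite -!/(co _ 1) -!/(co _ 2) -!/(co _ 3) -!/(co _ 4) /toV !co_vec4.
Qed.

Lemma lin_jac_permM (s t : 'S_4) : lin_jac (perm_mx s) 1 -> lin_jac (perm_mx t) 1 ->
  lin_jac (perm_mx (s * t)) 1.
Proof. by move=> hs ht; rewrite perm_mxM -[1]mulr1; exact: lin_jac_mul. Qed.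

(** Conjugating [(j k)] by [(i j)] gives [(i k)]; this produces all transpositions from those of
    neighbours. *)
Lemma lin_jac_tpermJ i j k : lin_jac (tperm_mx i j) 1 -> lin_jac (tperm_mx j k) 1 ->
  i != k -> j != k -> lin_jac (tperm_mx i k) 1.
Proof.
move=> hij hjk ik jk; rewrite /tperm_mx; have -> : tperm i k = (tperm i j * tperm j k * tperm i j)%g.
  rewrite -{1}[tperm i j]tpermV -mulgA -/(conjg (tperm j k) (tperm i j)) tpermJ.
  by rewrite tpermR tpermD.
exact: (lin_jac_permM (lin_jac_permM hij hjk) hij).
Qed.

Lemma lin_jac_perm (s : 'S_4) : lin_jac (perm_mx s) 1.
Proof.
have sym i j : lin_jac (tperm_mx i j) 1 -> lin_jac (tperm_mx j i) 1
  by rewrite /tperm_mx tpermC.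
have h01 := lin_jac_tperm01; have h02 := lin_jac_tperm02; have h23 := lin_jac_tperm23.
have h12 : lin_jac (tperm_mx o1 o2) 1.
  by apply: (lin_jac_tpermJ (sym _ _ h01) h02); rewrite inord4_eq.
have h03 : lin_jac (tperm_mx o0 o3) 1.
  by apply: (lin_jac_tpermJ h02 h23); rewrite inord4_eq.
have h13 : lin_jac (tperm_mx o1 o3) 1.
  by apply: (lin_jac_tpermJ h12 h23); rewrite inord4_eq.
have hid i : lin_jac (tperm_mx i i) 1 by rewrite /tperm_mx tperm1 perm_mx1; exact: lin_jac1.
have hall i j : lin_jac (tperm_mx i j) 1.
  case: (ord4P i) => ->; case: (ord4P j) => ->.
  - exact: hid. - exact: h01. - exact: h02. - exact: h03.
  - exact: (sym _ _ h01). - exact: hid. - exact: h12. - exact: h13.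
  - exact: (sym _ _ h02). - exact: (sym _ _ h12). - exact: hid. - exact: h23.
  - exact: (sym _ _ h03). - exact: (sym _ _ h13). - exact: (sym _ _ h23). - exact: hid.
have [ts -> _] := prod_tpermP s; elim: ts => [|[i j] ts IH].
  by rewrite big_nil perm_mx1; exact: lin_jac1.
by rewrite big_cons; exact: (lin_jac_permM (hall i j) IH).
Qed.

(** As vectors are rows, multiplication by such a matrix on the right changes the coordinate [k]
    alone, so it is a shear combined with a scaling. *)
Definition column_elementary (k : 'I_4) (E : 'M[R]_4) :=
  forall i j, j != k -> E i j = (i == j)%:R.

Lemma sum4 (F : 'I_4 -> R) : \sum_i F i = F o0 + F o1 + F o2 + F o3.
Proof.
rewrite !big_ord_recl big_ord0 addr0 !addrA.
by congr (F _ + F _ + F _ + F _); apply/val_inj; rewrite /= ?inordK.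
Qed.

Lemma lin_jac_column1 (E : 'M[R]_4) : column_elementary o1 E -> E o1 o1 != 0 ->
  lin_jac E `|E o1 o1|.
Proof.
move=> hE E11.
pose g (y : T3) := E o0 o1 * y.1 + E o2 o1 * y.2.1 + E o3 o1 * y.2.2.
have mg : measurable_fun setT g.
  apply: measurable_funD; first apply: measurable_funD; apply: measurable_funM => //;
    exact: measurableT_comp.
have -> : lin_jac E `|E o1 o1| = has_jacobian mu4 mu4
    (fun p : T4 => (E o1 o1 * p.1 + g p.2, p.2)) `|E o1 o1|.
  congr has_jacobian; apply/funext => -[a [b [c d]]] /=.
  rewrite /linT /ofV /co !mxE !sum4 /g /=.
  rewrite !(hE _ o0) ?(hE _ o2) ?(hE _ o3) ?inord4_eq//=.
  rewrite -!/(co _ 1) -!/(co _ 2) -!/(co _ 3) -!/(co _ 4) /toV !co_vec4//=.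
  by rewrite !(mulr0, mulr1, addr0, add0r); congr (_, _); ring.
exact: jacobian_shear.
Qed.

Lemma lin_jac_column k (E : 'M[R]_4) : column_elementary k E -> E k k != 0 ->
  lin_jac E `|E k k|.
Proof.
move=> hE Ekk; pose s := tperm k o1.
pose E' := \matrix_(i, j) E (s i) (s j).
have E'11 : E' o1 o1 = E k k by rewrite mxE tpermR.
have hE' : column_elementary o1 E'.
  move=> i j jn; rewrite mxE hE ?(inj_eq perm_inj)//.
  by rewrite -(inj_eq (@perm_inj _ s)) /s tpermK tpermL.
have EE : E = perm_mx s *m E' *m perm_mx s.
  apply/matrixP => i j; rewrite -row_permE -[s in _ *m perm_mx s]invgK -col_permE.
  by rewrite !mxE tpermV !tpermK.
rewrite [X in lin_jac X]EE -E'11 -[`|_|]mulr1 -[_ * 1]mul1r.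
apply: lin_jac_mul; last exact: lin_jac_perm.
apply: lin_jac_mul; first exact: lin_jac_perm.
by apply: lin_jac_column1; rewrite ?E'11.
Qed.

Definition columns_of (A : pred 'I_4) (U : 'M[R]_4) : 'M[R]_4 :=
  \matrix_(i, j) if A j then U i j else (i == j)%:R.

(** A triangular matrix is the product of its columns, each completed by the identity matrix. The
    vanishing of row [k] in the columns of [A] prevents the new factor from disturbing them. *)
Lemma columns_of_add (A : pred 'I_4) k (U : 'M[R]_4) : ~~ A k ->
  (forall j, A j -> U k j = 0) ->
  columns_of (predU1 k A) U = columns_of (pred1 k) U *m columns_of A U.
Proof.
move=> Ak Uk; apply/matrixP => i j; rewrite !mxE /=.
under eq_bigr do rewrite !mxE /=.
have [->|jk] := eqVneq j k.
  rewrite (negbTE Ak) /= (bigD1 k)//= !eqxx mulr1 big1 ?addr0// => l lk.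
  by rewrite (negbTE lk) mulr0.
rewrite /=; case: ifP => Aj.
  rewrite (bigD1 i)//= [X in _ + X]big1.
    case: eqVneq => [->|ik]; first by rewrite Uk// mulr0 addr0.
    by rewrite eqxx mul1r addr0.
  move=> l li; case: eqVneq => [->|lk]; first by rewrite Uk// mulr0.
  by rewrite eq_sym (negbTE li) mul0r.
rewrite (bigD1 j)//= (negbTE jk) eqxx mulr1 big1 ?addr0// => l lj.
by rewrite (negbTE lj) mulr0.
Qed.

Lemma lin_jac_columns (s : seq 'I_4) (U : 'M[R]_4) : uniq s ->
  (forall i, U i i != 0) ->
  pairwise (fun k j => U k j == 0) s ->
  lin_jac (columns_of (mem s) U) (\prod_(k <- s) `|U k k|).
Proof.
move=> us Uii; elim: s us => [|k s IH] /= us tri.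
  rewrite big_nil (_ : columns_of _ _ = 1%:M); first exact: lin_jac1.
  by apply/matrixP => i j; rewrite !mxE.
have -> : columns_of (mem (k :: s)) U = columns_of (predU1 k (mem s)) U.
  by apply/matrixP => i j; rewrite !mxE /= inE.
have /andP[ks {}us] := us; have /andP[/allP Uk {}tri] := tri.
rewrite columns_of_add//; last by move=> j js; exact/eqP/Uk.
rewrite big_cons mulrC; apply: lin_jac_mul.
  have {1}-> : U k k = columns_of (pred1 k) U k k by rewrite mxE /= eqxx.
  apply: lin_jac_column; last by rewrite mxE /= eqxx.
  by move=> i j jk; rewrite mxE /= (negbTE jk).
exact: IH.
Qed.

Lemma columns_of_all (s : seq 'I_4) U : (forall i, i \in s) -> columns_of (mem s) U = U.
Proof. by move=> hs; apply/matrixP => i j; rewrite !mxE (_ : mem s j)//; exact: hs. Qed.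

Notation ords := [:: o0; o1; o2; o3].

Lemma ordsP i : i \in ords.
Proof. by case: (ord4P i) => ->; rewrite !inE eqxx ?orbT. Qed.

Lemma prod_ords (F : 'I_4 -> R) : \prod_(i <- ords) F i = \prod_i F i.
Proof.
rewrite !big_cons big_nil mulr1 !big_ord_recl big_ord0 mulr1.
by congr (F _ * (F _ * (F _ * F _))); apply/val_inj; rewrite /= ?inordK.
Qed.

(** Splitting off column [k] requires [U k j = 0] for all columns [j] still to come, hence the
    descending order here and the ascending one for lower triangular matrices. *)
Lemma lin_jac_upper (U : 'M[R]_4) : (forall i j : 'I_4, (j < i)%N -> U i j = 0) ->
  (forall i, U i i != 0) -> lin_jac U (\prod_i `|U i i|).
Proof.
move=> tri Uii; rewrite -prod_ords -(perm_big _ (permEl (perm_rev ords))).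
rewrite -[X in lin_jac X](@columns_of_all (rev ords)); last first.
  by move=> i; rewrite mem_rev ordsP.
apply: lin_jac_columns => //; first by rewrite rev_uniq /= !inE !inord4_eq.
by rewrite /rev /= !tri ?inordK// !eqxx.
Qed.

Lemma lin_jac_lower (U : 'M[R]_4) : (forall i j : 'I_4, (i < j)%N -> U i j = 0) ->
  (forall i, U i i != 0) -> lin_jac U (\prod_i `|U i i|).
Proof.
move=> tri Uii; rewrite -prod_ords -[X in lin_jac X](@columns_of_all ords); last first.
  exact: ordsP.
apply: lin_jac_columns => //; first by rewrite /= !inE !inord4_eq.
by rewrite /= !tri ?inordK// !eqxx.
Qed.

(** In the LUP decomposition the permutation and the unipotent factor [L] have Jacobian 1, so only
    the diagonal of [U] contributes. *)
Theorem lin_jac_det (M : 'M[R]_4) : \det M != 0 -> lin_jac M `|\det M|.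
Proof.
move=> dM; have [s [L [U [ME Ldet Llow Uup]]]] := lup_decomposition M.
have dU : `|\det M| = \prod_i `|U i i|.
  rewrite {1}ME !det_mulmx det_perm Ldet mulr1 normrM normrX normrN1 expr1n mul1r.
  rewrite -det_tr det_trig ?normr_prod; first by apply: eq_bigr => i _; rewrite mxE.
  by apply/is_trig_mxP => i j ij; rewrite mxE Uup.
have Uii i : U i i != 0.
  apply: contraNneq dM => Ui; rewrite -normr_eq0 dU (bigD1 i)//= Ui normr0 mul0r//.
have Lii i : L i i = 1 by rewrite Llow// eqxx.
have L1 : \prod_i `|L i i| = 1 by rewrite big1// => i _; rewrite Lii normr1.
rewrite dU [X in lin_jac X]ME -[\prod_i _]mulr1 -[X in _ * X]mulr1.
apply: lin_jac_mul; last exact: lin_jac_upper.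
apply: lin_jac_mul; first exact: lin_jac_perm.
rewrite -L1; apply: lin_jac_lower => [i j ij|i]; last by rewrite Lii oner_neq0.
by rewrite Llow 1?ltnW// -val_eqE /= ltn_eqF.
Qed.

End LinearChange.

(** * Integration over projective space *)

Section ProjectiveIntegral.
Context {R : realType}.
Notation mu := (@lebesgue_measure R).
Notation T3 := (R * (R * R))%type.
Notation T4 := (R * (R * (R * R)))%type.
Notation mu3 := (mu \X (mu \X mu))%E.
Notation mu4 := (mu \X (mu \X (mu \X mu)))%E.

Definition proj_int (F : 'rV[R]_4 -> R) : \bar R :=
  (\int[mu3]_y (F (toV (1%R, y)))%:E)%E.

Record density (F : 'rV[R]_4 -> R) : Prop := {
  density_measurable : measurable_fun setT (F \o toV);
  density_ge0 : forall x, 0 <= F x;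
  density_homogeneous : forall c x, c != 0 -> F (c *: x) = c ^- 4 * F x }.

Lemma density_lin F (M : 'M[R]_4) : \det M != 0 ->
  density F -> density (fun x => F (x *m M)).
Proof.
move=> dM [mF F0 hF]; split => [|x|c x c0] //=; last by rewrite -scalemxAl hF.
have [mM _ _] := lin_jac_det dM.
have -> : (fun x : 'rV_4 => F (x *m M)) \o toV = (F \o toV) \o linT M.
  by apply/funext => p; rewrite /= /linT ofVK.
exact: measurableT_comp.
Qed.

Definition superlevel (F : 'rV[R]_4 -> R) (x : 'rV[R]_4) : \bar R :=
  ((1 <= F x)%R%:R)%:E.

(** The contribution of a single line through the origin, with [|t| ^+ 3] the Jacobian of scaling
    the three chart coordinates by [t]. It cancels in the end, for which it has to be positive and
    finite. *)
Definition radial_mass : \bar R :=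
  (\int[mu]_t (`|t| ^+ 3 * (t ^+ 4 <= 1)%R%:R)%:E)%E.

Lemma measurable_natb d (T : measurableType d) (f : T -> bool) :
  measurable_fun setT f -> measurable_fun setT (fun x => (f x)%:R : R).
Proof.
move=> mf; rewrite [X in measurable_fun _ X](_ : _ = fun x => if f x then 1 else 0).
  exact: measurable_fun_ifT.
by apply/funext => x; case: (f x).
Qed.

(** Substitute [r * t] for [t] with [r] the fourth root of [a]: the weight contributes [r ^+ 3] and
    the differential one more [r]. *)
Lemma radial_mass_scale (a : R) : 0 <= a ->
  (\int[mu]_t (`|t| ^+ 3 * (t ^+ 4 <= a)%R%:R)%:E = a%:E * radial_mass)%E.
Proof.
rewrite le_eqVlt => /predU1P[<-|a0].
  rewrite mul0e integral0_eq// => t _.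
  have [->|t0] := eqVneq t 0; first by rewrite normr0 expr0n mul0r.
  by rewrite leNgt exprn_even_gt0//= t0 mulr0.
pose r := Num.sqrt (Num.sqrt a).
have r0 : 0 < r by rewrite !sqrtr_gt0.
have r4 : r ^+ 4 = a by rewrite -[4%N]/(2 * 2)%N exprM !sqr_sqrtr ?sqrtr_ge0// ltW.
have mf b : measurable_fun setT (fun t : R => (`|t| ^+ 3 * (t ^+ 4 <= b)%R%:R)%:E).
  apply/measurable_EFinP; apply: measurable_funM.
    by apply: measurable_funX; exact: normr_measurable.
  by apply: measurable_natb; apply: measurable_fun_ler => //; exact: measurable_funX.
have f0 b (t : R) : (0 <= (`|t| ^+ 3 * (t ^+ 4 <= b)%R%:R)%:E)%E.
  by rewrite lee_fin mulr_ge0// exprn_ge0.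
rewrite (ge0_integral_affine 0 (lt0r_neq0 r0) (mf a) (f0 a)).
rewrite /radial_mass -r4 -ge0_integralZl//; last first.
  have maff : measurable_fun setT (fun t : R => r * t + 0).
    by apply: measurable_funD => //; exact: measurable_funM.
  exact: (measurableT_comp (mf _) maff).
rewrite -ge0_integralZl// ?lee_fin ?exprn_ge0 ?ltW//; last exact: mf.
apply: eq_integral => t _; rewrite -!EFinM addr0 normrM (gtr0_norm r0).
by rewrite [in X in _ * (_ * X)]exprMn ger_pMr ?exprn_gt0// exprMn; congr EFin; ring.
Qed.

Lemma radial_mass_gt0 : (0 < radial_mass)%E.
Proof.
have mf : measurable_fun setT (fun t : R => (`|t| ^+ 3 * (t ^+ 4 <= 1)%R%:R)%:E).
  apply/measurable_EFinP; apply: measurable_funM.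
    by apply: measurable_funX; exact: normr_measurable.
  by apply: measurable_natb; apply: measurable_fun_ler => //; exact: measurable_funX.
apply: (@lt_le_trans _ _ (\int[mu]_(t in `[2^-1%R, 1%R]) (8^-1)%:E)%E).
  rewrite integral_cst//= lebesgue_measure_itv/= lte_fin ifT; last by lra.
  by rewrite -EFinB -EFinM lte_fin; lra.
apply: (@le_trans _ _ (\int[mu]_(t in `[2^-1%R, 1%R]) (`|t| ^+ 3 * (t ^+ 4 <= 1)%R%:R)%:E)%E).
  apply: ge0_le_integral => //.
  - by apply: measurable_funTS; exact: mf.
  - move=> t /=; rewrite in_itv/= => /andP[t2 t1]; rewrite lee_fin.
    have t0 : 0 <= t by lra.
    rewrite exprn_ile1// mulr1 ger0_norm//.
    have : 2^-1 ^+ 3 <= t ^+ 3 by rewrite lerXn2r// nnegrE; lra.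
    by apply: le_trans; rewrite exprVn; lra.
apply: ge0_subset_integral => // t _; rewrite lee_fin mulr_ge0// exprn_ge0//.
Qed.

Lemma radial_mass_lty : (radial_mass < +oo)%E.
Proof.
have mf : measurable_fun setT (fun t : R => (`|t| ^+ 3 * (t ^+ 4 <= 1)%R%:R)%:E).
  apply/measurable_EFinP; apply: measurable_funM.
    by apply: measurable_funX; exact: normr_measurable.
  by apply: measurable_natb; apply: measurable_fun_ler => //; exact: measurable_funX.
apply: (@le_lt_trans _ _ (\int[mu]_(t in `[(-1)%R, 1%R]) (1%:E))%E); last first.
  rewrite integral_cst//= lebesgue_measure_itv/= lte_fin ifT; last by lra.
  by rewrite -EFinB -EFinM ltry.
rewrite [leRHS]integral_mkcond; apply: ge0_le_integral => //.
- by apply: (measurable_restrictT _ _).1 => //; exact: measurable_itv.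
- move=> t _; rewrite patchE; case: ifPn => [_ /=|].
    case: (leP (t ^+ 4) 1) => t4; rewrite ?mulr0 lee_fin// mulr1.
    rewrite exprn_ile1//; rewrite leNgt; apply/negP => t1.
    have : 1 < `|t| ^+ 4 by rewrite exprn_egt1.
    by rewrite -normrX ger0_norm ?exprn_even_ge0// ltNge t4.
  rewrite notin_setE /= in_itv/= -ler_norml => /negP; rewrite -ltNge => t1.
  have : 1 < `|t| ^+ 4 by rewrite exprn_egt1.
  by rewrite -normrX ger0_norm ?exprn_even_ge0// ltNge => /negbTE ->; rewrite mulr0.
Qed.

Lemma measurable_toV1 F : density F -> measurable_fun setT (fun y : T3 => F (toV (1, y))).
Proof. by move=> [mF _ _]; exact: (measurableT_comp mF (pair1_measurable (1 : R))). Qed.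

Lemma toV_scale (t : R) (y : T3) :
  toV (t, (t * y.1, (t * y.2.1, t * y.2.2))) = t *: toV (1, y).
Proof. by apply: co_inj; rewrite coZ /toV !co_vec4//= mulr1. Qed.

Lemma jacobian_scale3 (t : R) : t != 0 ->
  has_jacobian mu3 mu3 (fun y : T3 => (t * y.1, (t * y.2.1, t * y.2.2))) (`|t| ^+ 3).
Proof.
move=> t0; have h : has_jacobian mu mu ( *%R t) `|t|.
  have -> : ( *%R t) = (fun x => t * x + 0) by apply/funext => x; rewrite addr0.
  exact: jacobian_affine.
have -> : `|t| ^+ 3 = `|t| * `|t| * `|t| by ring.
exact: (jacobian_comp (jacobian_prodl _ h) (jacobian_prodr mu
  (jacobian_comp (jacobian_prodl mu h) (jacobian_prodr mu h)))).
Qed.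

Lemma superlevel_homog F (t : R) (y : T3) : density F -> t != 0 ->
  superlevel F (t *: toV (1, y)) = ((t ^+ 4 <= F (toV (1, y)))%R%:R)%:E.
Proof.
move=> [_ _ hF] t0; rewrite /superlevel hF// mulrC ler_pdivlMr ?mul1r//.
by rewrite exprn_even_gt0//= t0.
Qed.

Lemma measurable_superlevel F : density F ->
  measurable_fun setT (fun p : T4 => superlevel F (toV p)).
Proof.
move=> [mF _ _]; apply/measurable_EFinP; apply: measurable_natb.
by apply: measurable_fun_ler.
Qed.

Lemma superlevel_ge0 F x : (0 <= superlevel F x)%E.
Proof. by rewrite lee_fin. Qed.

(* The Lebesgue measure of [F >= 1], computed along the rays through the points
   of the chart x_2 = 1: this turns the projective change of variables into a
   linear one in R^4. *)
Lemma superlevel_mass F : density F ->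
  (\int[mu4]_p superlevel F (toV p) = radial_mass * proj_int F)%E.
Proof.
move=> dF; have mF1 := measurable_toV1 dF; have F0 := density_ge0 dF.
pose G (p : T4) : \bar R := (`|p.1| ^+ 3 * (p.1 ^+ 4 <= F (toV (1, p.2)))%R%:R)%:E.
have mG : measurable_fun setT G.
  apply/measurable_EFinP; apply: measurable_funM.
    by apply: measurable_funX; apply: (measurableT_comp (@normr_measurable R setT)).
  apply: measurable_natb; apply: measurable_fun_ler; first exact: measurable_funX.
  exact: (measurableT_comp mF1 (@measurable_snd _ _ R T3)).
have G0 p : (0 <= G p)%E by rewrite lee_fin mulr_ge0// exprn_ge0.
apply: (etrans (tonelli1 mu mu3 (measurable_superlevel dF) (fun p => superlevel_ge0 F _))).
transitivity (\int[mu]_t \int[mu3]_y G (t, y))%E.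
  have mS := measurable_fun_fubini_tonelli_F (m2 := mu3) _ (measurable_superlevel dF) (fun p => superlevel_ge0 F _).
  have mG' := measurable_fun_fubini_tonelli_F (m2 := mu3) _ mG G0.
  (* The slice [t = 0] is left out because scaling by [t] degenerates there. *)
  apply: (eq_integral_except (r := 0) measurableT mS mG') => t _ t0.
  have [_ k0 h] := jacobian_scale3 t0.
  have mSt := measurableT_comp (measurable_superlevel dF) (pair1_measurable (t : R)).
  have e := h (fun y => superlevel F (toV (t, y))) mSt (fun y => superlevel_ge0 F _).
  rewrite [LHS]e.
  rewrite -ge0_integralZl//; last 2 first.
  - have msc : measurable_fun setT (fun y : T3 => (t, (t * y.1, (t * y.2.1, t * y.2.2)))).
      by have [msc _ _] := jacobian_scale3 t0; exact: (measurableT_comp (pair1_measurable (t : R)) msc).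
    exact: (measurableT_comp (measurable_superlevel dF) msc).
  - by move=> y _; exact: superlevel_ge0.
  apply: eq_integral => y _ /=; rewrite toV_scale superlevel_homog//.
apply: (etrans (esym (tonelli1 mu mu3 mG G0))).
apply: (etrans (tonelli2 mu mu3 mG G0)).
transitivity (\int[mu3]_y ((F (toV (1, y)))%:E * radial_mass))%E.
  by apply: eq_integral => y _; rewrite -radial_mass_scale.
rewrite ge0_integralZr// 1?muleC//; first exact/measurable_EFinP.
- by move=> y _; rewrite lee_fin.
- exact: ltW radial_mass_gt0.
Qed.

(** By [superlevel_mass] both sides are, up to the factor [radial_mass], integrals over R^4, where
    [lin_jac_det] relates them; the factor is then cancelled. *)
Theorem proj_int_lin F (M : 'M[R]_4) : \det M != 0 -> density F ->
  proj_int F = (`|\det M|%:E * proj_int (fun x => F (x *m M)))%E.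
Proof.
move=> dM dF; have [_ _ h] := lin_jac_det dM.
have := h _ (measurable_superlevel dF) (fun p => superlevel_ge0 F _).
have -> : (fun p => superlevel F (toV (linT M p))) =
    (fun p => superlevel (fun x => F (x *m M)) (toV p)).
  by apply/funext => p; rewrite /linT ofVK.
rewrite !superlevel_mass//; last exact: density_lin.
have Kfin : radial_mass = (fine radial_mass)%:E.
  by rewrite fineK// ge0_fin_numE ?radial_mass_lty// ltW// radial_mass_gt0.
have K0 : fine radial_mass != 0.
  by rewrite gt_eqF// -lte_fin -Kfin radial_mass_gt0.
rewrite Kfin muleCA => /(congr1 (mule (fine radial_mass)^-1%:E)).
by rewrite !muleA -!EFinM mulVf// mul1r mul1e.
Qed.

End ProjectiveIntegral.

Section Determinants.
Variable K : comNzRingType.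

(** Giving the entries by a function of natural numbers lets the deletion of rows and columns
    compute through [bump], so that the expansions can be iterated. *)
Lemma det_nat2 (f : nat -> nat -> K) :
  \det (\matrix_(i < 2, j < 2) f i j) = f 0%N 0%N * f 1%N 1%N - f 0%N 1%N * f 1%N 0%N.
Proof. by rewrite det_mx22 !mxE. Qed.

Lemma det_nat3 (f : nat -> nat -> K) :
  \det (\matrix_(i < 3, j < 3) f i j) =
    f 0%N 0%N * (f 1%N 1%N * f 2%N 2%N - f 1%N 2%N * f 2%N 1%N)
    - f 0%N 1%N * (f 1%N 0%N * f 2%N 2%N - f 1%N 2%N * f 2%N 0%N)
    + f 0%N 2%N * (f 1%N 0%N * f 2%N 1%N - f 1%N 1%N * f 2%N 0%N).
Proof.
rewrite (expand_det_row _ 0) !big_ord_recl big_ord0 /cofactor.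
pose g k i j := f (bump 0 i) (bump k j).
have e (k : 'I_3) : row' 0 (col' k (\matrix_(i < 3, j < 3) f i j)) =
    \matrix_(i < 2, j < 2) g k i j.
  by apply/matrixP => i j; rewrite !mxE.
by rewrite !e !det_nat2 !mxE /g /= /bump /=; ring.
Qed.

Lemma det_nat4 (f : nat -> nat -> K) :
  let minor k := f 1%N (bump k 0%N) * (f 2%N (bump k 1%N) * f 3%N (bump k 2%N) - f 2%N (bump k 2%N) * f 3%N (bump k 1%N))
    - f 1%N (bump k 1%N) * (f 2%N (bump k 0%N) * f 3%N (bump k 2%N) - f 2%N (bump k 2%N) * f 3%N (bump k 0%N))
    + f 1%N (bump k 2%N) * (f 2%N (bump k 0%N) * f 3%N (bump k 1%N) - f 2%N (bump k 1%N) * f 3%N (bump k 0%N)) in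
  \det (\matrix_(i < 4, j < 4) f i j) =
    f 0%N 0%N * minor 0%N - f 0%N 1%N * minor 1%N + f 0%N 2%N * minor 2%N - f 0%N 3%N * minor 3%N.
Proof.
rewrite (expand_det_row _ 0) !big_ord_recl big_ord0 /cofactor !mxE /=.
pose g k i j := f (bump 0 i) (bump k j).
have e (k : 'I_4) : row' 0 (col' k (\matrix_(i < 4, j < 4) f i j)) =
    \matrix_(i < 3, j < 3) g k i j.
  by apply/matrixP => i j; rewrite !mxE.
by rewrite !e !det_nat3 /g /= /bump /=; ring.
Qed.
End Determinants.

Section VolumeForm.
Context {R : realType} (Lam : R).

(** With [eta = diag(-1, 1, 1)] and [q = 1 + Lam * m] this is the entry of
    [(q eta - Lam (eta y)(eta y)^T) / q^2]. It is a rank-one perturbation of a multiple of [eta],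
    whose determinant is [- q^-4] because [q - Lam * m = 1]. *)
Definition gram_coef (y : R * (R * R)) (i j : nat) : R :=
  let x := [:: y.1; y.2.1; y.2.2] in let s := [:: -1; 1; 1] in
  let m := - y.1 ^+ 2 + y.2.1 ^+ 2 + y.2.2 ^+ 2 in
  ((1 + Lam * m) * (s`_i * (i == j)%:R) - Lam * (s`_i * x`_i * (s`_j * x`_j)))
  / (1 + Lam * m) ^+ 2.

Lemma gramE (y : R * (R * R)) :
  gram Lam y = \matrix_(i < 3, j < 3) gram_coef y i j.
Proof.
case: y => a [b c] /=; apply/matrixP => i j; rewrite !mxE /gram_coef /metric detXE /chart.
have co_delta (k : 'I_3) n : (0 < n <= 4)%N -> co (chart_tangent k : 'rV[R]_4) n = (bump 1 k == n.-1)%:R.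
  move=> n4; rewrite /co /chart_tangent mxE eqxx /= -val_eqE /= !inordK//.
    by rewrite eq_sym.
  by case/andP: n4 => n0; rewrite -ltnS prednK.
rewrite /mink !coE !co_delta// !co_vec4//=.
by case: i => -[|[|[|//]]] ?; case: j => -[|[|[|//]]] ?; rewrite /= /bump /=;
  congr (_ / _ ^+ 2); ring.
Qed.

Lemma sqrt_det_gram (y : R * (R * R)) :
  Num.sqrt `|\det (gram Lam y)| = (detX Lam (chart y)) ^- 2.
Proof.
set q := detX Lam (chart y).
have qE : q = 1 + Lam * (- y.1 ^+ 2 + y.2.1 ^+ 2 + y.2.2 ^+ 2).
  by rewrite /q detXE /chart /mink !co_vec4//= expr1n; congr (_ + _ * _); ring.
have -> : \det (gram Lam y) = - (q ^- 2) ^+ 2.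
  rewrite gramE det_nat3 /gram_coef /= -qE.
  (* Where the form vanishes both sides are [0], as the inverse of [0] is [0]. *)
  have [->|q0] := eqVneq q 0; first by rewrite expr0n invr0; ring.
  by move: q0; rewrite qE; move: (y.1) (y.2.1) (y.2.2) => a b c q0; field.
by rewrite normrN normrX sqrtr_sqr normr_id ger0_norm// invr_ge0 sqr_ge0.
Qed.

(** Both signs occur because [a] and [- a] represent the same point. *)
Definition orthant (a : 'rV[R]_4) : bool :=
  [&& 0 <= co a 1, 0 <= co a 2, 0 <= co a 3 & 0 <= co a 4] ||
  [&& co a 1 <= 0, co a 2 <= 0, co a 3 <= 0 & co a 4 <= 0].

Definition cone_density (Q : 'rV[R]_4 -> R) (a : 'rV[R]_4) : R :=
  (orthant a)%:R * Q a ^- 2.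

Lemma measurable_co (M : 'M[R]_4) k :
  measurable_fun setT (fun p : R * (R * (R * R)) => co (toV p *m M) k).
Proof.
have mi i : measurable_fun setT (fun p : R * (R * (R * R)) => (toV p) 0 i).
  have -> : (fun p : R * (R * (R * R)) => (toV p) 0 i) =
      (fun p => [:: p.2.1; p.1; p.2.2.1; p.2.2.2]`_i).
    by apply/funext => p; rewrite mxE.
  by case: i => -[|[|[|[|//]]]] ? /=; do ?apply: measurableT_comp.
rewrite /co [X in measurable_fun _ X](_ : _ =
    fun p => \sum_i toV p 0 i * M i (inord k.-1)); last first.
  by apply/funext => p; rewrite mxE.
by apply: measurable_sum => i; exact: measurable_funM.
Qed.

Lemma measurable_cone_density (Q : 'rV[R]_4 -> R) : measurable_fun setT (Q \o toV) ->
  measurable_fun setT (cone_density Q \o toV).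
Proof.
move=> mQ; have mco k : measurable_fun setT (fun p : R * (R * (R * R)) => co (toV p) k).
  have := measurable_co 1%:M k; congr (measurable_fun _ _).
  by apply/funext => p; rewrite mulmx1.
apply: measurable_funM; last first.
  rewrite [X in measurable_fun _ X](_ : _ = fun p => (Q (toV p) ^+ 2) `^ (-1)).
    exact: (measurableT_comp (measurable_powR (-1)) (measurable_funX 2 mQ)).
  by apply/funext => p; rewrite powR_inv1// sqr_ge0.
apply: measurable_natb; apply: measurable_or; do ![apply: measurable_and];
  exact: measurable_fun_ler.
Qed.

Lemma density_cone (Q : 'rV[R]_4 -> R) : measurable_fun setT (Q \o toV) ->
  (forall c x, Q (c *: x) = c ^+ 2 * Q x) -> density (cone_density Q).
Proof.
move=> mQ hQ; split => [|x|c x c0]; first exact: measurable_cone_density.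
  by rewrite mulr_ge0// invr_ge0 sqr_ge0.
rewrite /cone_density hQ exprMn invfM -exprM mulrCA; congr (_ * (_ * _)).
rewrite /orthant !coZ; have [cpos|cneg|c00] := ltgtP 0 c; last by rewrite -c00 eqxx in c0.
  by rewrite !pmulr_rge0// !pmulr_rle0.
by rewrite !nmulr_rge0// !nmulr_rle0// orbC.
Qed.

(** The entries of [x *m invmx V] are the coefficients of [x] in the generators of the cone, and the
    sign of the factor in [simplex] selects the half of [orthant]. The zero vector satisfies
    [orthant] but represents no point. *)
Lemma simplex_orthant (V : 'M[R]_4) x : V \in unitmx -> x != 0 ->
  simplex V x <-> orthant (x *m invmx V).
Proof.
move=> uV x0; set a := x *m invmx V.
have xE : x = a *m V by rewrite /a mulmxKV.
have a0 : a != 0 by apply: contraNneq x0 => a0; rewrite xE a0 mul0mx.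
have ord4 (P : 'I_4 -> Prop) : (forall k, (0 < k <= 4)%N -> P (inord k.-1)) -> forall i, P i.
  by move=> hP i; rewrite -[i]inord_val; apply: (hP i.+1); rewrite ltn_ord.
have sumn0 (b : 'rV[R]_4) : (forall i, 0 <= b 0 i) -> b != 0 -> \sum_i b 0 i != 0.
  move=> b0; apply: contraNneq => /eqP; rewrite psumr_eq0// => /allP h.
  by apply/eqP/rowP => i; rewrite mxE; apply/eqP/h; rewrite mem_index_enum.
split => [[c c0 [b [b0 bs e]]]|].
  have aE : a = c^-1 *: b.
    apply: (can_inj (mulmxK uV)); rewrite -xE -scalemxAl -e scalerA mulVf// scale1r//.
  rewrite aE /orthant !coZ /co; have [cpos|cneg] := ltP 0 c^-1.
    by rewrite !mulr_ge0// ltW.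
  by rewrite [X in _ || X]andbA !mulr_le0_ge0// orbT.
case/orP => /and4P[h1 h2 h3 h4].
  exists 1; rewrite ?oner_neq0// scale1r; exists a; split => //.
    by apply: ord4 => -[|[|[|[|[|//]]]]].
  apply: sumn0 => //; by apply: ord4 => -[|[|[|[|[|//]]]]].
have na i : 0 <= (- a) 0 i.
  rewrite mxE oppr_ge0; move: i; by apply: ord4 => -[|[|[|[|[|//]]]]].
exists (-1); rewrite ?oppr_eq0 ?oner_neq0// scaleN1r; exists (- a); split => //.
  by apply: sumn0; rewrite ?oppr_eq0.
by rewrite mulNmx -xE.
Qed.

Lemma density_simplex (V : 'M[R]_4) : density (cone_density (fun a => detX Lam (a *m V))).
Proof.
apply: density_cone => [|c x].
  rewrite [X in measurable_fun _ X](_ : _ = fun p => co (toV p *m V) 2 ^+ 2 +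
     Lam * (- (co (toV p *m V) 1 * co (toV p *m V) 1) + co (toV p *m V) 3 * co (toV p *m V) 3 +
       co (toV p *m V) 4 * co (toV p *m V) 4)); last first.
    by apply/funext => p; rewrite /= detXE.
  apply: measurable_funD; first by apply: measurable_funX; exact: measurable_co.
  apply: measurable_funM => //; apply: measurable_funD; first apply: measurable_funD.
  - by apply: measurableT_comp => //; apply: measurable_funM; exact: measurable_co.
  - by apply: measurable_funM; exact: measurable_co.
  - by apply: measurable_funM; exact: measurable_co.
by rewrite -scalemxAl !detXE /mink !coZ; ring.
Qed.

(** This is the substitution of barycentric coordinates: [V] turns the simplex into the orthant, and
    the density [detX ^- 2] is pulled back along it. *)
Lemma vol_simplex (V : 'M[R]_4) : V \in unitmx ->
  vol Lam (simplex V) =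
    (`|\det V|%:E * proj_int (cone_density (fun a => detX Lam (a *m V))))%E.
Proof.
move=> uV; have dV : \det V != 0 by move: uV; rewrite unitmxE unitfE.
pose Q := fun a : 'rV_4 => detX Lam (a *m V).
have dQ : density (cone_density Q) by exact: density_simplex.
have dF : density (fun x => cone_density Q (x *m invmx V)).
  by apply: density_lin => //; rewrite det_inv invr_eq0.
have <- : proj_int (fun x => cone_density Q (x *m invmx V)) =
    (`|\det V|%:E * proj_int (cone_density Q))%E.
  rewrite (proj_int_lin dV dF); congr (_ * proj_int _)%E.
  by apply/funext => x; rewrite mulmxK.
rewrite -[LHS]/(\int[@lebesgue_measure R \X (@lebesgue_measure R \X @lebesgue_measure R)]_(
  y in [set y | simplex V (chart y)]) (Num.sqrt `|\det (gram Lam y)|)%:E)%E.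
rewrite integral_mkcond; apply: eq_integral => y _; rewrite patchE /=.
have x0 : toV (1, y) != 0.
  apply/eqP => /(congr1 (fun x : 'rV_4 => co x 2)) /eqP.
  by rewrite /toV co_vec4//= /co mxE oner_eq0.
rewrite /cone_density /Q mulmxKV// sqrt_det_gram.
have -> : (y \in [set y | simplex V (chart y)]) = orthant (toV (1, y) *m invmx V).
  by apply/idP/idP => [/set_mem/(simplex_orthant uV x0)//|h];
    apply/mem_set/(simplex_orthant uV x0).
by case: ifP => _; rewrite ?mul1r ?mul0r.
Qed.

End VolumeForm.

(** * Trigonometry of curvature Lam *)

Section Calculus.
Context {R : realType}.
Notation mu := (@lebesgue_measure R).
Implicit Types (f g F : R -> R) (x a b : R).

Lemma is_deriveD1 f g x df dg : is_derive x 1 f df -> is_derive x 1 g dg ->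
  is_derive x 1 (fun t => f t + g t) (df + dg).
Proof. by move=> ? ?; exact: is_deriveD. Qed.

Lemma is_deriveB1 f g x df dg : is_derive x 1 f df -> is_derive x 1 g dg ->
  is_derive x 1 (fun t => f t - g t) (df - dg).
Proof. by move=> ? ?; exact: is_deriveB. Qed.

Lemma is_deriveM1 f g x df dg : is_derive x 1 f df -> is_derive x 1 g dg ->
  is_derive x 1 (fun t => f t * g t) (f x * dg + g x * df).
Proof. by move=> ? ?; exact: is_deriveM. Qed.

Lemma is_deriveZ1 f x df c : is_derive x 1 f df ->
  is_derive x 1 (fun t => c * f t) (c * df).
Proof. by move=> ?; exact: is_deriveZ. Qed.

Lemma is_deriveV1 f x df : f x != 0 -> is_derive x 1 f df ->
  is_derive x 1 (fun t => (f t)^-1) (- (f x ^- 2 * df)).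
Proof.
move=> fx [dfx <-]; split; first exact: derivableV.
by rewrite deriveV// -mulNr.
Qed.

Lemma is_derive_comp1 f g x df dg : is_derive (g x) 1 f df -> is_derive x 1 g dg ->
  is_derive x 1 (fun t => f (g t)) (df * dg).
Proof. by move=> ? ?; exact: is_derive1_comp. Qed.

Lemma is_derive_continuous f x df : is_derive x 1 f df -> {for x, continuous f}.
Proof. by move=> [dfx _]; apply/differentiable_continuous/derivable1_diffP. Qed.

Lemma is_derive_affine c d x : is_derive x 1 (fun t => c * t + d) c.
Proof.
have h := is_deriveD1 (is_deriveZ1 c (is_derive_id x 1)) (is_derive_cst d x 1).
by apply: (is_derive_eq h); rewrite addr0 mulr1.
Qed.

Lemma FTC_cc f F a b : a < b ->
  (forall x, a <= x <= b -> is_derive x 1 F (f x)) ->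
  (forall x, a <= x <= b -> {for x, continuous f}) ->
  (\int[mu]_(x in `[a, b]) (f x)%:E = (F b - F a)%:E)%E.
Proof.
move=> ab dF cf; rewrite (@continuous_FTC2 _ f F)//.
- apply: continuous_in_subspaceT => x /set_mem /=; rewrite in_itv/=; exact: cf.
- split=> [x||].
  + by rewrite in_itv/= => /andP[ax xb]; have [] := dF x; rewrite ?ltW.
  + have /is_derive_continuous h : is_derive a 1 F (f a) by apply: dF; rewrite lexx ltW.
    exact: cvg_at_right_filter.
  + have /is_derive_continuous h : is_derive b 1 F (f b) by apply: dF; rewrite lexx ltW.
    exact: cvg_at_left_filter.
- move=> x; rewrite in_itv/= => /andP[ax xb]; rewrite derive1E.
  by have [] := dF x; rewrite ?ltW.
Qed.

Lemma continuous_measurable_oo f a b :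
  (forall x, a < x < b -> {for x, continuous f}) -> measurable_fun `]a, b[ f.
Proof.
move=> cf; apply: open_continuous_measurable_fun => //.
by move=> x /set_mem /=; rewrite in_itv/=; exact: cf.
Qed.

(* Only the right limit of the primitive at the left end is required, so that
   the integrand may be singular there. *)
Lemma ge0_FTC_oc f F a b l : a < b ->
  (forall x, a < x <= b -> 0 <= f x) ->
  (forall x, a < x <= b -> is_derive x 1 F (f x)) ->
  (forall x, a < x <= b -> {for x, continuous f}) ->
  F x @[x --> a^'+] --> l ->
  (\int[mu]_(x in `[a, b]) (f x)%:E = (F b - l)%:E)%E.
Proof.
move=> ab f0 dF cf Fl.
have moo : measurable_fun `]a, b[ f.
  by apply: continuous_measurable_oo => x /andP[ax xb]; apply: cf; rewrite ax ltW.
have moc : measurable_fun `]a, b] f by apply/measurable_fun_itv_bndo_bndcP.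
rewrite -integral_itv_obnd_cbnd; last exact/measurable_EFinP.
(* Monotone convergence along the intervals [[u n, b]], which exhaust []a, b]]. The denominator
   [n.+2] keeps even [u 0] below [b]. *)
pose u (n : nat) := a + (b - a) / n.+2%:R.
have ua n : a < u n by rewrite ltrDl divr_gt0// subr_gt0.
have ub n : u n < b.
  rewrite -ltrBrDl ltr_pdivrMr// ltr_pMr ?subr_gt0//.
  by rewrite ltr1n.
have uE : `]a, b]%classic = \bigcup_n `[u n, b]%classic.
  apply/seteqP; split => [x /=|x [n _] /=]; rewrite !in_itv/=; last first.
    by move=> /andP[ux ->]; rewrite (lt_le_trans (ua n)).
  move=> /andP[ax xb]; exists (Num.bound ((b - a) / (x - a))) => //=.
  rewrite in_itv/= xb andbT -lerBrDl ler_pdivrMr// -ler_pdivrMl ?subr_gt0// mulrC.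
  apply: (@le_trans _ _ (Num.bound ((b - a) / (x - a)))%:R); last by rewrite ler_nat -addn2 leq_addr.
  by apply/ltW; apply: archi_boundP; apply: divr_ge0; rewrite subr_ge0 ltW.
have := @ge0_nondecreasing_set_cvg_integral _ (measurableTypeR R) _ (fun n => `[u n, b]%classic) (EFin \o f) mu.
rewrite -uE => h.
have {}h : (\int[mu]_(x in `[u n, b]) (f x)%:E @[n --> \oo] --> \int[mu]_(x in `]a, b]) (f x)%:E)%E.
  apply: h => //.
  - apply/nondecreasing_seqP => n; rewrite subsetEset => x /=; rewrite !in_itv/= => /andP[ux ->].
    rewrite andbT (le_trans _ ux)// lerD2l ler_pM2l ?subr_gt0// lef_pV2 ?posrE//.
    by rewrite ler_nat.
  - move=> n; apply/measurable_EFinP; apply: measurable_funS moc => //.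
    by move=> x /=; rewrite !in_itv/= => /andP[ux ->]; rewrite (lt_le_trans (ua n)).
  - move=> n x /=; rewrite in_itv/= lee_fin => /andP[ux xb]; apply: f0.
    by rewrite xb (lt_le_trans (ua n)).
apply: (cvg_unique _ h) => //.
have -> : (fun n => \int[mu]_(x in `[u n, b]) (f x)%:E)%E = (fun n => (F b - F (u n))%:E).
  apply/funext => n; apply: FTC_cc => // x /andP[ux xb].
    by apply: dF; rewrite xb (lt_le_trans (ua n)).
  by apply: cf; rewrite xb (lt_le_trans (ua n)).
apply: cvg_EFin; first exact: nearW.
apply: cvgB; first exact: cvg_cst.
have /cvg_at_rightP := Fl; apply; split => //.
rewrite -[X in _ --> X]addr0; apply: cvgD; first exact: cvg_cst.
rewrite -(mulr0 (b - a)); apply: cvgM; first exact: cvg_cst.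
by have := @cvg_harmonic R; rewrite -cvg_shiftS.
Qed.

End Calculus.

Section Trigonometry.
Context {R : realType} (Lam : R).
Hypothesis HLam : [\/ Lam = 1, Lam = -1 | Lam = 0].

Definition c_ (t : R) : R :=
  if Lam == 1 then cos t else if Lam == -1 then (expR t + expR (- t)) / 2 else 1.

(* The inverse function of [c_ / s_], written so that its derivative
   [- (y ^ 2 + Lam)^-1] and its limit [0] at infinity do not depend on [Lam]. *)
Definition acot (y : R) : R :=
  if Lam == 1 then pi / 2 - atan y
  else if Lam == -1 then (ln (y + 1) - ln (y - 1)) / 2 else y^-1.

(** The range of [c_ / s_] on [arclen]: all reals for cot, the reals above 1 for coth, the positive
    ones for [z^-1]. *)
Definition acot_dom (y : R) := (Lam = -1 -> 1 < y) /\ (Lam = 0 -> 0 < y).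

Definition arclen (z : R) := 0 < z /\ (Lam = 1 -> z < pi).

Lemma N1_neq1 : ((-1 : R) == 1) = false.
Proof. by apply/eqP => h; lra. Qed.

Lemma zero_neq1 : ((0 : R) == 1) = false. Proof. by rewrite eq_sym oner_eq0. Qed.

Lemma zero_neqN1 : ((0 : R) == -1) = false. Proof. by rewrite eq_sym oppr_eq0 oner_eq0. Qed.

Lemma s_E : s_ Lam = if Lam == 1 then @sin R else if Lam == -1
  then (fun t => (expR t - expR (- t)) / 2) else id.
Proof. by apply/funext => t; rewrite /s_; case: ifP => // _; case: ifP. Qed.

Lemma c_E : c_ = if Lam == 1 then @cos R else if Lam == -1
  then (fun t => (expR t + expR (- t)) / 2) else cst 1.
Proof. by apply/funext => t; rewrite /c_; case: ifP => // _; case: ifP. Qed.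

Definition lamE := (N1_neq1, zero_neq1, zero_neqN1, @eqxx R).

Lemma is_derive_expN (t : R) : is_derive t (1 : R) (fun t => expR (- t)) (- expR (- t)).
Proof.
have h := is_derive_comp1 (is_derive_expR (- t)) (is_deriveNid t 1).
by apply: (is_derive_eq h); rewrite mulrN1.
Qed.

Lemma is_derive_s (t : R) : is_derive t 1 (s_ Lam) (c_ t).
Proof.
rewrite s_E c_E; case: HLam => ->; rewrite !lamE.
- exact: is_derive_sin.
- have h := is_deriveM1 (is_deriveB1 (is_derive_expR t) (is_derive_expN t)) (is_derive_cst (2^-1 : R) t 1).
  by apply: (is_derive_eq h); rewrite mulr0 add0r opprK mulrC.
- exact: is_derive_id.
Qed.

Lemma is_derive_c (t : R) : is_derive t 1 c_ (- Lam * s_ Lam t).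
Proof.
rewrite s_E c_E; case: HLam => ->; rewrite !lamE.
- by apply: is_derive_eq; rewrite mulN1r.
- have h := is_deriveM1 (is_deriveD1 (is_derive_expR t) (is_derive_expN t)) (is_derive_cst (2^-1 : R) t 1).
  by apply: (is_derive_eq h); rewrite mulr0 add0r opprK mul1r mulrC.
- by apply: is_derive_eq; rewrite oppr0 mul0r.
Qed.

Lemma s_0 : s_ Lam 0 = 0.
Proof. by rewrite s_E; case: HLam => ->; rewrite !lamE ?sin0// oppr0 subrr mul0r. Qed.

Lemma c_0 : c_ 0 = 1.
Proof. by rewrite c_E; case: HLam => ->; rewrite !lamE ?cos0// oppr0 expR0; lra. Qed.

Lemma s_N t : s_ Lam (- t) = - s_ Lam t.
Proof. by rewrite s_E; case: HLam => ->; rewrite !lamE ?sinN// opprK; lra. Qed.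

Lemma c_N t : c_ (- t) = c_ t.
Proof. by rewrite c_E; case: HLam => ->; rewrite !lamE ?cosN// opprK addrC. Qed.

Lemma s_D a b : s_ Lam (a + b) = s_ Lam a * c_ b + c_ a * s_ Lam b.
Proof.
rewrite s_E c_E; case: HLam => ->; rewrite !lamE ?sinD ?mulr1 ?mul1r//.
by rewrite opprD !expRD; field.
Qed.

Lemma c_D a b : c_ (a + b) = c_ a * c_ b - Lam * s_ Lam a * s_ Lam b.
Proof.
rewrite s_E c_E; case: HLam => ->; rewrite !lamE ?cosD ?mul1r ?mul0r ?subr0//.
by rewrite opprD !expRD; field.
Qed.

Lemma c2s2 t : c_ t ^+ 2 + Lam * s_ Lam t ^+ 2 = 1.
Proof. by rewrite -c_0 -(subrr t) c_D c_N s_N; ring. Qed.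

Lemma s_gt0 z : arclen z -> 0 < s_ Lam z.
Proof.
move=> [z0 zpi]; rewrite s_E; case: HLam zpi => -> zpi; rewrite !lamE//.
  by rewrite sin_gt0_pi// z0 zpi.
by rewrite divr_gt0// subr_gt0 ltr_expR; lra.
Qed.

Lemma acot_domP y : acot_dom y -> 0 < y ^+ 2 + Lam.
Proof.
move=> [h1 h0]; case: HLam => L; rewrite L.
- by rewrite ltr_wpDl// sqr_ge0.
- by rewrite subr_gt0 exprn_egt1// h1.
- by rewrite addr0 exprn_gt0// h0.
Qed.

Lemma acot_dom_le y y' : acot_dom y -> y <= y' -> acot_dom y'.
Proof. by move=> [h1 h0] yy; split => L; rewrite (lt_le_trans _ yy)// ?h1 ?h0. Qed.

Lemma acotE : acot = if Lam == 1 then (fun y => pi / 2 - atan y)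
  else if Lam == -1 then (fun y => (ln (y + 1) - ln (y - 1)) / 2) else GRing.inv.
Proof. by apply/funext => t; rewrite /acot; case: ifP => // _; case: ifP. Qed.

Lemma is_derive_acot (y : R) : acot_dom y -> is_derive y 1 acot (- (y ^+ 2 + Lam)^-1).
Proof.
rewrite acotE => dy; have := acot_domP dy; case: dy; case: HLam => ->; rewrite !lamE => h1 h0 y2.
- have h := is_deriveB1 (is_derive_cst (pi / 2 : R) y 1) (is_derive1_atan y).
  by apply: (is_derive_eq h); rewrite sub0r addrC.
- have {}h1 : 1 < y by exact: h1.
  have y1 : 0 < y + 1 by lra.
  have y1' : 0 < y - 1 by lra.
  have e1 := is_derive_comp1 (g := fun t => t + 1) (is_derive1_ln y1) (is_deriveD1 (is_derive_id y 1) (is_derive_cst (1 : R) y 1)).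
  have e2 := is_derive_comp1 (g := fun t => t - 1) (is_derive1_ln y1') (is_deriveB1 (is_derive_id y 1) (is_derive_cst (1 : R) y 1)).
  have h := is_deriveM1 (is_deriveB1 e1 e2) (is_derive_cst (2^-1 : R) y 1).
  by apply: (is_derive_eq h) => /=; field; rewrite !gt_eqF//; nra.
- have {}h0 : y != 0 by rewrite gt_eqF// h0.
  have h := is_deriveV1 h0 (is_derive_id y 1).
  by apply: (is_derive_eq h); rewrite mulr1 addr0.
Qed.

Lemma acot_arc y : acot_dom y -> arclen (acot y) /\ c_ (acot y) = y * s_ Lam (acot y).
Proof.
rewrite /arclen acotE s_E c_E; case; case: HLam => ->; rewrite !lamE => h1 h0.
- have a1 := atan_gtNpi2 y; have a2 := atan_ltpi2 y; split; first by split; lra.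
  have ca : 0 < cos (atan y) by apply: cos_gt0_pihalf; rewrite a1.
  rewrite cosB sinB cos_pihalf sin_pihalf !mul0r !mul1r add0r subr0.
  by rewrite -{2}[y]atanK /tan divfK// gt_eqF.
- have {}h1 : 1 < y by exact: h1.
  have y1 : 0 < y + 1 by lra.
  have y1' : 0 < y - 1 by lra.
  set z := (_ / 2).
  have e2 : expR z * (y - 1) = expR (- z) * (y + 1).
    have : expR (z + z) = (y + 1) / (y - 1).
      have -> : z + z = ln (y + 1) - ln (y - 1) by rewrite /z; lra.
      by rewrite expRD expRN !lnK// posrE.
    rewrite expRD => e; apply: (mulfI (lt0r_neq0 (expR_gt0 z))).
    by rewrite !mulrA expRxMexpNx_1 mul1r e divfK// gt_eqF.
  split; last by rewrite mulrA; congr (_ / 2); lra.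
  split => [|/eqP]; last by rewrite N1_neq1.
  by rewrite divr_gt0// subr_gt0 ltr_ln ?posrE//; lra.
- have {}h0 : 0 < y by exact: h0.
  split; last by rewrite mulfV// gt_eqF.
  by split=> [|/eqP]; rewrite ?invr_gt0// zero_neq1.
Qed.

Lemma cot_dom z : arclen z -> acot_dom (c_ z / s_ Lam z).
Proof.
move=> az; have sz := s_gt0 az; have [z0 _] := az; split => L.
  rewrite ltr_pdivlMr// mul1r; rewrite s_E c_E L !lamE.
  by have := expR_gt0 (- z); lra.
by rewrite divr_gt0// c_E L !lamE ltr01.
Qed.

Lemma acotK z : arclen z -> acot (c_ z / s_ Lam z) = z.
Proof.
move=> az; have sz := s_gt0 az; have [z0 zpi] := az; move: sz zpi.
rewrite acotE s_E c_E; case: HLam => ->; rewrite !lamE => sz zpi.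
- have {}zpi : z < pi by exact: zpi.
  have -> : cos z / sin z = tan (pi / 2 - z).
    by rewrite /tan cosB sinB cos_pihalf sin_pihalf !mul0r !mul1r add0r subr0.
  by rewrite tanK ?in_itv/=; lra.
- have e1 := expR_gt0 z; have e2 := expR_gt0 (- z).
  have -> : (expR z + expR (- z)) / 2 / ((expR z - expR (- z)) / 2) + 1 =
      expR z / ((expR z - expR (- z)) / 2) by field; lra.
  have -> : (expR z + expR (- z)) / 2 / ((expR z - expR (- z)) / 2) - 1 =
      expR (- z) / ((expR z - expR (- z)) / 2) by field; lra.
  have e3 : 0 < expR z - expR (- z) by lra.
  by rewrite !ln_div ?posrE ?expR_gt0 ?divr_gt0// !expRK; lra.
- by rewrite div1r invrK.
Qed.

Lemma cvg_acot : acot y @[y --> +oo] --> 0.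
Proof.
rewrite acotE; case: HLam => ->; rewrite !lamE.
- by rewrite -[X in _ --> X](subrr (pi / 2)); apply: cvgB; [exact: cvg_cst|exact: cvgy_atan].
(* Writing the quotient as [1 + 2 / (y - 1)], the inequality [ln (1 + x) <= x] bounds the inverse of
   coth by [(y - 1)^-1]. *)
- apply: (@squeeze_cvgr _ _ _ _ (cst 0) (fun y : R => (y - 1)^-1)).
  + near=> y; have y1 : 1 < y by near: y; exact: nbhs_pinfty_gt.
    have y1' : 0 < y - 1 by lra.
    have y1'' : 0 < y + 1 by lra.
    rewrite /= divr_ge0 ?subr_ge0 ?ler_ln ?posrE//=; last by lra.
    rewrite ler_pdivrMr// -ln_div ?posrE//.
    have -> : (y + 1) / (y - 1) = 1 + (y - 1)^-1 * 2 by field; lra.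
    by apply: le_ln1Dx; rewrite (lt_trans (ltrN10 R))// mulr_gt0 ?invr_gt0.
  + exact: cvg_cst.
  + apply/(gtr0_cvgV0 (f := fun y : R => y - 1)); last exact: cvg_addrr.
    by near=> y; rewrite subr_gt0; near: y; exact: nbhs_pinfty_gt.
- apply/(gtr0_cvgV0 (f := fun y : R => y)); last exact: cvg_id.
  by near=> y; near: y; exact: nbhs_pinfty_gt.
Unshelve. all: by end_near. Qed.

End Trigonometry.

(** * Lengths of segments *)

Section EdgeLength.
Context {R : realType} (Lam : R).
Hypothesis HLam : [\/ Lam = 1, Lam = -1 | Lam = 0].
Notation mu := (@lebesgue_measure R).
Notation q := (detX Lam).
Notation B := (bilX Lam).
Local Notation D x y := (metric_num Lam x y y).

(** Thus [D] is the Gram determinant with the factor [Lam] removed. For [Lam = 0] the right-hand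
    side vanishes, which determines [B x y] up to its sign. *)
Lemma gramD (x y : 'rV[R]_4) : Lam * D x y = q x * q y - B x y ^+ 2.
Proof. by rewrite metric_num_bilX !detXE /bilX /mink; ring. Qed.

Lemma detX_segment (x y : 'rV[R]_4) t : q ((1 - t) *: x + t *: y) =
  (1 - t) ^+ 2 * q x + 2 * t * (1 - t) * B x y + t ^+ 2 * q y.
Proof. by rewrite !detXE /bilX /mink !coE; ring. Qed.

(** The numerator of the metric depends only on the bivector of the point and the tangent vector,
    and along the segment this bivector is constantly that of [x] and [y]. *)
Lemma metric_segment (x y : 'rV[R]_4) t :
  metric Lam ((1 - t) *: x + t *: y) (y - x) (y - x) =
  D x y / q ((1 - t) *: x + t *: y) ^+ 2.
Proof.
rewrite /metric; congr (_ / _).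
by rewrite -/(metric_num _ _ _ _) /metric_num /mink !coE; ring.
Qed.

(** Positivity at the two ends says nothing about the sign of [B x y]; positivity along the whole
    segment does. *)
Lemma bilX_segment_gt (x y : 'rV[R]_4) :
  (forall t, 0 <= t <= 1 -> 0 < q ((1 - t) *: x + t *: y)) ->
  - Num.sqrt (q x * q y) < B x y.
Proof.
move=> hq.
have qx : 0 < q x by have := hq 0; rewrite subr0 scale1r scale0r addr0; apply; rewrite lexx ler01.
have qy : 0 < q y by have := hq 1; rewrite subrr scale1r scale0r add0r; apply; rewrite lexx ler01.
rewrite sqrtrM ?ltW//; have := sqr_sqrtr (ltW qx); have := sqr_sqrtr (ltW qy).
have : 0 < Num.sqrt (q x) by rewrite sqrtr_gt0.
have : 0 < Num.sqrt (q y) by rewrite sqrtr_gt0.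
move: (Num.sqrt (q x)) (Num.sqrt (q y)) => r s s0 r0 es er.
have rs0 : 0 < r + s by lra.
(* At this parameter the segment meets the ray through the sum of the normalised end points, where
   the form is a positive multiple of [r * s + B x y]. *)
have t01 : 0 <= r / (r + s) <= 1.
  by rewrite divr_ge0 ?(ltW r0) ?(ltW rs0)//= ler_pdivrMr// mul1r lerDl ltW.
have := hq _ t01; rewrite detX_segment -er -es.
have -> : 1 - r / (r + s) = s / (r + s) by field; lra.
have -> : (s / (r + s)) ^+ 2 * r ^+ 2 + 2 * (r / (r + s)) * (s / (r + s)) * B x y +
   (r / (r + s)) ^+ 2 * s ^+ 2 = 2 * (r * s) / (r + s) ^+ 2 * (r * s + B x y).
  by field; lra.
rewrite pmulr_rgt0; first lra.
by rewrite divr_gt0 ?exprn_gt0// !mulr_gt0.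
Qed.

Lemma cvg_affine_inv a b : 0 < a -> a * t^-1 + b @[t --> (0 : R)^'+] --> +oo.
Proof.
move=> a0; apply/cvgryPge => A; have [Ab|Ab] := leP (A - b) 0; near=> t;
  have t0 : 0 < t by [near: t; exact: nbhs_right_gt].
  have h : 0 < a * t^-1 by rewrite mulr_gt0// invr_gt0.
  by lra.
rewrite -lerBlDr ler_pdivlMr// mulrC -ler_pdivlMr//.
by near: t; apply: nbhs_right_le; rewrite divr_gt0.
Unshelve. all: by end_near. Qed.

(** The integrand is [sqrt D / q x_t] for the point [x_t] at parameter [t]. Since [N t = B x x_t]
    and [t * r = sqrt (D x x_t)], the function [F t] is the expected distance from [x] to [x_t]. It
    serves as primitive on []0, 1]] and tends to 0 at the left end, where its argument goes to
    infinity. *)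
Lemma seg_length_acot (x y : 'rV[R]_4) :
  (forall t, 0 <= t <= 1 -> 0 < q ((1 - t) *: x + t *: y)) ->
  0 < seg_length Lam x y ->
  [/\ 0 < D x y, acot_dom Lam (B x y / Num.sqrt (D x y)) &
      seg_length Lam x y = acot Lam (B x y / Num.sqrt (D x y))].
Proof.
move=> hq; rewrite /seg_length.
have qx : 0 < q x by have := hq 0; rewrite subr0 scale1r scale0r addr0; apply; rewrite lexx ler01.
have qy : 0 < q y by have := hq 1; rewrite subrr scale1r scale0r add0r; apply; rewrite lexx ler01.
have Bgt := bilX_segment_gt hq; have LD := gramD x y.
have eqI : (\int[mu]_(t in `[0%R, 1%R])
      (Num.sqrt (metric Lam ((1 - t) *: x + t *: y) (y - x) (y - x)))%:E =
    \int[mu]_(t in `[0%R, 1%R]) (Num.sqrt (D x y) *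
      (q ((1 - t) *: x + t *: y))^-1)%:E)%E.
  apply: eq_integral.
  move=> t /set_mem /=; rewrite in_itv/= => t01; rewrite metric_segment.
  have q0 := hq t t01; have [D0|D0] := leP (D x y) 0.
    rewrite [RHS](_ : _ = 0%:E); last by rewrite ler0_sqrtr// mul0r.
    by rewrite ler0_sqrtr// mulr_le0_ge0// invr_ge0 sqr_ge0.
  by rewrite sqrtrM ?ltW// sqrtrV ?sqr_ge0// sqrtr_sqr gtr0_norm.
(* Square roots of nonpositive numbers are [0], so [D x y <= 0] would give length [0]. *)
rewrite /Rintegral eqI {eqI}; have [D0|D0] := leP (D x y) 0.
  rewrite ler0_sqrtr// integral0_eq ?ltxx// => t _; rewrite mul0r//.
set r := Num.sqrt (D x y); have r0 : 0 < r by rewrite sqrtr_gt0.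
have r2 : r ^+ 2 = D x y by rewrite sqr_sqrtr// ltW.
rewrite -r2 in LD.
have dB : acot_dom Lam (B x y / r).
  have qs : Num.sqrt (q x * q y) ^+ 2 = q x * q y by rewrite sqr_sqrtr// mulr_ge0// ltW.
  have s0 : 0 < Num.sqrt (q x * q y) by rewrite sqrtr_gt0 mulr_gt0.
  move: Bgt qs s0; move: (Num.sqrt (q x * q y)) => s Bgt qs s0.
  have Bs : 0 < B x y + s by lra.
  have r20 : 0 < r ^+ 2 by rewrite exprn_gt0.
  split=> L; have := LD; rewrite [X in X * _ = _]L => {}LD.
    have sB : s < B x y.
      rewrite -subr_gt0 -(pmulr_lgt0 _ Bs); have : (B x y - s) * (B x y + s) = r ^+ 2.
        by lra.
      by move=> ->.
    have rB : 0 < B x y + r by lra.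
    rewrite ltr_pdivlMr// mul1r -subr_gt0 -(pmulr_lgt0 _ rB).
    have -> : (B x y - r) * (B x y + r) = s ^+ 2 by lra.
    by rewrite exprn_gt0.
  rewrite divr_gt0//; have /eqP : (B x y - s) * (B x y + s) = 0 by lra.
  by rewrite mulf_eq0 => /orP[] /eqP; lra.
pose N t := (1 - t) * q x + t * B x y.
pose F t := acot Lam (N t / (t * r)).
pose f t := r * (q ((1 - t) *: x + t *: y))^-1.
have dN t : 0 < t -> t <= 1 -> acot_dom Lam (N t / (t * r)).
  move=> t0 t1; apply: (acot_dom_le dB).
  rewrite ler_pdivlMr ?mulr_gt0// mulrCA divfK ?gt_eqF// /N lerDr.
  by rewrite mulr_ge0 ?subr_ge0// ltW.
have qd (t : R) : exists d, is_derive t 1 (fun t => q ((1 - t) *: x + t *: y)) d.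
  have h := is_deriveD1 (is_deriveM1 (is_derive_affine (q x - 2 * B x y + q y)
    (2 * B x y - 2 * q x) t) (is_derive_id t 1)) (is_derive_cst (q x) t 1).
  eexists; move: h; congr (is_derive _ _ _ _).
  by apply/funext => s /=; rewrite detX_segment; ring.
have -> : (\int[mu]_(t in `[0%R, 1%R]) (f t)%:E = (F 1 - 0)%:E)%E; last first.
  split => //=; rewrite subr0 /F /N subrr mul0r add0r !mul1r//.
apply: ge0_FTC_oc => //.
- by move=> t /andP[t0 t1]; rewrite mulr_ge0 ?invr_ge0 ?ltW// hq// t1 ltW.
- move=> t /andP[t0 t1]; have qt : 0 < q ((1 - t) *: x + t *: y) by rewrite hq// t1 ltW.
  have tr : t * r != 0 by rewrite mulf_neq0// gt_eqF.
  have hN : is_derive t 1 (fun t => N t / (t * r)) (- q x / (t ^+ 2 * r)).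
    have h := is_deriveD1 (is_deriveZ1 (q x / r) (is_deriveV1 (lt0r_neq0 t0) (is_derive_id t 1)))
       (is_derive_cst ((B x y - q x) / r) t 1).
    have h2 : is_derive t 1 (fun t => q x / r * t^-1 + (B x y - q x) / r) (- q x / (t ^+ 2 * r)).
      by apply: (is_derive_eq h); rewrite addr0; field; rewrite !gt_eqF.
    apply: near_eq_is_derive h2; near=> s.
    have s0 : 0 < s by near: s; exact: lt_nbhsr.
    by rewrite /N; field; rewrite !gt_eqF.
  have h := is_derive_comp1 (f := acot Lam) (g := fun t => N t / (t * r)) (is_derive_acot HLam (dN t t0 t1)) hN.
  apply: (is_derive_eq h); rewrite /f detX_segment.
  (* This is [gramD] for [x] and the point at parameter [t]. *)
  have e : N t ^+ 2 + Lam * (t * r) ^+ 2 = q x * ((1 - t) ^+ 2 * q x + 2 * t * (1 - t) * B x y + t ^+ 2 * q y).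
    rewrite exprMn mulrCA LD /N; ring.
  have -> : (N t / (t * r)) ^+ 2 + Lam = (N t ^+ 2 + Lam * (t * r) ^+ 2) / (t * r) ^+ 2.
    by field; rewrite !gt_eqF.
  rewrite e; rewrite detX_segment in qt; field; rewrite !gt_eqF//.
- move=> t /andP[t0 t1]; have [d hd] := qd t.
  have qt : q ((1 - t) *: x + t *: y) != 0 by rewrite gt_eqF// hq// t1 ltW.
  exact: is_derive_continuous (is_deriveZ1 r (is_deriveV1 qt hd)).
- have h : (q x / r * t^-1 + (B x y - q x) / r) @[t --> (0 : R)^'+] --> +oo.
    by apply: cvg_affine_inv; rewrite divr_gt0.
  have := cvg_comp _ _ h (cvg_acot HLam).
  apply: cvg_trans; apply: near_eq_cvg; near=> t.
  have t0 : 0 < t by near: t; exact: nbhs_right_gt.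
  by rewrite /= /F /N; congr acot; field; rewrite !gt_eqF.
Unshelve. all: by end_near. Qed.

End EdgeLength.

(** * Integrals over slices of the tetrahedron *)

Section FiberIntegral.
Context {R : realType} (Lam : R).
Hypothesis HLam : [\/ Lam = 1, Lam = -1 | Lam = 0].
Notation mu := (@lebesgue_measure R).
Notation c := (c_ Lam).
Notation s := (s_ Lam).

(** The value at [0] is the limit, which makes the function continuous there. *)
Definition zcot (z : R) : R := if z == 0 then 1 else z * c z / s z.

Definition arc0 (z : R) := z = 0 \/ arclen Lam z.

Lemma c_gtN1 z : arc0 z -> -1 < c z.
Proof.
move=> [->|az]; first by rewrite c_0//; lra.
have sz := s_gt0 HLam az; have e := c2s2 HLam z.
move: (s z) (az.1) az.2 sz e; rewrite c_E; case: HLam => ->; rewrite !lamE => t z0 zpi t0 e.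
- rewrite lt_neqAle cos_geN1 andbT eq_sym; apply/eqP => cz.
  by move: e; rewrite cz mul1r; have := exprn_gt0 2 t0; lra.
- by have := expR_gt0 z; have := expR_gt0 (- z); lra.
- by rewrite /=; lra.
Qed.

Variable rho : R.
Hypothesis rho0 : 0 < rho.

(** The normalised quadratic form on the slice [X], with [rho ^+ 2 = 1 + Lam * X ^+ 2]. *)
Definition quad (p u : R) := u ^+ 2 + 2 * u * p + rho ^+ 2.

Lemma quad_gt0 p u : - rho < p -> 0 <= u -> 0 < quad p u.
Proof.
move=> rp; rewrite le_eqVlt => /predU1P[<-|u0].
  by rewrite /quad mulr0 mul0r expr0n /= !add0r exprn_gt0.
have : 0 < u * (p + rho) by rewrite mulr_gt0//; lra.
by have := sqr_ge0 (u - rho); rewrite /quad; lra.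
Qed.

Lemma is_derive_quad p (u : R) : is_derive u 1 (quad p) (2 * (u + p)).
Proof.
have h := is_deriveD1 (is_deriveM1 (is_derive_affine 1 (2 * p) u) (is_derive_id u 1))
  (is_derive_cst (rho ^+ 2) u 1).
have -> : quad p = (fun t => (1 * t + 2 * p) * t + cst (rho ^+ 2) t).
  by apply/funext => t; rewrite /quad /=; ring.
by apply: (is_derive_eq h); ring.
Qed.

(** As [quad] has slope [2 u] in [p], the obvious primitive [- 1 / (2 u quad)] breaks down at
    [u = 0]. Subtracting its value at [p1] cancels the factor [u] and yields the primitive used
    here. *)
Lemma integral_quad_p p1 p2 u : - rho < p1 -> p1 <= p2 -> 0 <= u ->
  (\int[mu]_(p in `[p1, p2]) (quad p u ^- 2)%:E =
   ((p2 - p1) / (quad p1 u * quad p2 u))%:E)%E.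
Proof.
move=> rp1 p12 u0; move: p12; rewrite le_eqVlt => /predU1P[<-|p12].
  by rewrite set_itv1 integral_set1 subrr mul0r.
have q0 p : p1 <= p -> quad p u != 0 by move=> pp; rewrite gt_eqF// quad_gt0//; lra.
have dq (p : R) : is_derive p 1 (quad ^~ u) (2 * u).
  have -> : quad ^~ u = (fun t => 2 * u * t + (u ^+ 2 + rho ^+ 2)).
    by apply/funext => t; rewrite /quad; ring.
  exact: is_derive_affine.
have -> : (p2 - p1) / (quad p1 u * quad p2 u) =
    (fun p => (p - p1) / (quad p1 u * quad p u)) p2 -
    (fun p => (p - p1) / (quad p1 u * quad p u)) p1 by rewrite /= subrr mul0r subr0.
apply: (@FTC_cc _ (fun p => quad p u ^- 2)
  (fun p => (p - p1) / (quad p1 u * quad p u))) => //.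
- move=> p /andP[pp _]; have q1 := q0 _ (lexx p1); have qp := q0 _ pp.
  have h := is_deriveM1 (is_deriveB1 (is_derive_id p 1) (is_derive_cst p1 p 1))
    (is_deriveV1 (f := fun t => quad p1 u * quad t u) (mulf_neq0 q1 qp) (is_deriveZ1 (quad p1 u) (dq p))).
  apply: (is_derive_eq h) => /=.
  have e : quad p1 u = quad p u - 2 * u * (p - p1) by rewrite /quad; ring.
  by move: q1 qp; rewrite e; move: (quad p u) => b q1 qp; field; rewrite q1 qp.
- move=> p /andP[pp _]; have qp := q0 _ pp.
  have h := is_deriveV1 (f := fun t => quad t u * quad t u) (mulf_neq0 qp qp) (is_deriveM1 (dq p) (dq p)).
  exact: is_derive_continuous h.
Qed.

(** A primitive in [u] of [- p / quad p u] for [p = rho * c z], vanishing at infinity. It comes from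
    completing the square, [quad p u = (u + p)^2 + Lam (rho s z)^2]; for [z = 0] only the square is
    left. *)
Definition psi (z u : R) :=
  if z == 0 then rho / (u + rho) else c z / s z * acot Lam ((u + rho * c z) / (rho * s z)).

Lemma psi_dom z u : arclen Lam z -> 0 <= u -> acot_dom Lam ((u + rho * c z) / (rho * s z)).
Proof.
move=> az u0; have sz := s_gt0 HLam az; apply: (acot_dom_le (cot_dom HLam az)).
rewrite ler_pdivlMr ?mulr_gt0// [rho * s z]mulrC mulrA divfK ?gt_eqF// mulrC.
by rewrite lerDr.
Qed.

Lemma is_derive_psi z (u : R) : arc0 z -> 0 <= u ->
  is_derive u 1 (psi z) (- (rho * c z / quad (rho * c z) u)).
Proof.
move=> [->|az] u0; rewrite /psi.
  rewrite eqxx c_0// mulr1; have ur : u + rho != 0 by rewrite gt_eqF// ltr_wpDl.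
  have h := is_deriveZ1 rho (is_deriveV1 (f := fun t => t + rho) ur (is_deriveD1 (is_derive_id u 1) (is_derive_cst rho u 1))).
  apply: (is_derive_eq h) => /=.
  have -> : quad rho u = (u + rho) ^+ 2 by rewrite /quad; ring.
  by rewrite addr0 mulr1; field.
rewrite gt_eqF ?az.1//; have sz := s_gt0 HLam az; have dz := psi_dom az u0.
have rs : rho * s z != 0 by rewrite mulf_neq0// gt_eqF.
have hg : is_derive u 1 (fun u => (u + rho * c z) / (rho * s z)) (rho * s z)^-1.
  have -> : (fun u => (u + rho * c z) / (rho * s z)) =
      (fun u => (rho * s z)^-1 * u + rho * c z / (rho * s z)).
    by apply/funext => t; rewrite mulrDl mulrC.
  exact: is_derive_affine.
have h := is_deriveZ1 (c z / s z) (is_derive_comp1 (f := acot Lam)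
  (g := fun u => (u + rho * c z) / (rho * s z)) (is_derive_acot HLam dz) hg).
apply: (is_derive_eq h).
have q0 : quad (rho * c z) u != 0.
  rewrite gt_eqF// quad_gt0//; have := c_gtN1 (or_intror az).
  by rewrite -(ltr_pM2l rho0) mulrN1.
have -> : ((u + rho * c z) / (rho * s z)) ^+ 2 + Lam = quad (rho * c z) u / (rho * s z) ^+ 2.
  have e := c2s2 HLam z.
  have -> : quad (rho * c z) u = (u + rho * c z) ^+ 2 + Lam * (rho * s z) ^+ 2.
    have e' : rho ^+ 2 = rho ^+ 2 * (c z ^+ 2 + Lam * s z ^+ 2) by rewrite e mulr1.
    by rewrite /quad e'; ring.
  by field; rewrite !gt_eqF.
by field; rewrite q0 !gt_eqF.
Qed.

Lemma psi0 z : arc0 z -> psi z 0 = zcot z.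
Proof.
move=> [->|az]; rewrite /psi /zcot ?eqxx ?add0r ?divff ?gt_eqF// ?az.1//.
have sz := s_gt0 HLam az.
have -> : rho * c z / (rho * s z) = c z / s z by field; rewrite !gt_eqF.
by rewrite acotK//; ring.
Qed.

Lemma cvg_psi z : arc0 z -> psi z u @[u --> +oo] --> 0.
Proof.
move=> [->|az]; rewrite /psi.
  rewrite eqxx -[X in _ --> X](mulr0 rho).
  apply: cvgM; first exact: cvg_cst.
  apply/(gtr0_cvgV0 (f := fun u : R => u + rho)); last exact: cvg_addrr.
  by near=> u; rewrite ltr_wpDl//; near: u; exact: nbhs_pinfty_ge.
rewrite gt_eqF ?az.1// -[X in _ --> X](mulr0 (c z / s z)).
have sz := s_gt0 HLam az.
apply: cvgM; first exact: cvg_cst.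
have h : (u + rho * c z) / (rho * s z) @[u --> (+oo : set_system R)] --> +oo.
  apply/cvgryPge => A; near=> u.
  rewrite ler_pdivlMr ?mulr_gt0// -lerBlDr.
  by near: u; apply: nbhs_pinfty_ge; exact: num_real.
exact: cvg_comp _ _ h (cvg_acot HLam).
Unshelve. all: by end_near. Qed.

Lemma cvg_ln_quad p1 p2 : - rho < p1 -> p1 <= p2 ->
  ln (quad p2 u) - ln (quad p1 u) @[u --> +oo] --> 0.
Proof.
move=> rp1 p12.
apply: (@squeeze_cvgr _ _ _ _ (cst 0) (fun u : R => 4 * (p2 - p1) * u^-1)).
- near=> u.
  (* Beyond [4 * rho] one has [quad p1 u >= u ^+ 2 / 2], because [p1 > - rho]. *)
  have u4 : 4 * rho < u by near: u; apply: nbhs_pinfty_gt; exact: num_real.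
  have r0 : 0 < rho by exact: rho0.
  have u0 : 0 < u by lra.
  have q1 : 0 < quad p1 u by rewrite quad_gt0// ltW.
  have q2 : 0 < quad p2 u by rewrite quad_gt0 ?ltW//; lra.
  have pu : 0 <= u * (p2 - p1) by rewrite mulr_ge0//; lra.
  rewrite /= subr_ge0 ler_ln ?posrE//; apply/andP; split.
    by rewrite /quad; lra.
  rewrite -ln_div ?posrE//.
  have -> : quad p2 u / quad p1 u = 1 + 2 * (u * (p2 - p1)) / quad p1 u.
    by move: q1; rewrite /quad => q1; field; rewrite gt_eqF.
  have w0 : 0 <= 2 * (u * (p2 - p1)) / quad p1 u by rewrite divr_ge0 ?(ltW q1)// mulr_ge0.
  apply: (@le_trans _ _ (2 * (u * (p2 - p1)) / quad p1 u)).
    by apply: le_ln1Dx; lra.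
  rewrite ler_pdivrMr//.
  have -> : 2 * (u * (p2 - p1)) = 4 * (p2 - p1) / u * (u ^+ 2 / 2) by field; rewrite gt_eqF.
  rewrite ler_wpM2l//; first by rewrite divr_ge0 ?(ltW u0)// mulr_ge0// subr_ge0.
  have h1 : 0 < u * (u - 4 * rho) by rewrite mulr_gt0//; lra.
  have h2 : 0 < u * (p1 + rho) by rewrite mulr_gt0//; lra.
  have := sqr_ge0 rho; rewrite /quad; lra.
- exact: cvg_cst.
- rewrite -[X in _ --> X](mulr0 (4 * (p2 - p1))); apply: cvgM; first exact: cvg_cst.
  apply/(gtr0_cvgV0 (f := fun y : R => y)); last exact: cvg_id.
  by near=> y; near: y; exact: nbhs_pinfty_gt.
Unshelve. all: by end_near. Qed.

(** From [quad p u = u (u + 2 p) + rho^2] the inner integral equals [(2 rho^2)^-1] times the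
    difference of [(u + 2 p) / quad p u] at [p2] and [p1]. Here [u + p] is half the derivative of
    [quad] and integrates to a logarithm, while [psi] accounts for the remaining [p]. The logarithms
    cancel both at [u = 0] and at infinity, so only [psi z 0 = zcot z] survives. *)
Lemma fiber_integral z1 z2 : arc0 z1 -> arc0 z2 -> c z1 <= c z2 ->
  (\int[mu]_(u in `[0%R, +oo[) \int[mu]_(p in `[(rho * c z1)%R, (rho * c z2)%R]) (quad p u ^- 2)%:E =
   ((zcot z2 - zcot z1) / (2 * rho ^+ 2))%:E)%E.
Proof.
move=> a1 a2 c12; set p1 := rho * c z1; set p2 := rho * c z2.
have rp1 : - rho < p1 by have := c_gtN1 a1; rewrite -(ltr_pM2l rho0) mulrN1.
have p12 : p1 <= p2 by rewrite ler_pM2l.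
have rp2 : - rho < p2 by lra.
pose K u := (p2 - p1) * (quad p1 u * quad p2 u)^-1.
pose G u := (2 * rho ^+ 2)^-1 * (2^-1 * (ln (quad p2 u) - ln (quad p1 u)) + (psi z1 u - psi z2 u)).
transitivity (\int[mu]_(u in `[0%R, +oo[) (K u)%:E)%E.
  apply: eq_integral => u /set_mem /=; rewrite in_itv/= andbT => u0.
  exact: integral_quad_p.
have q1 u : 0 <= u -> 0 < quad p1 u by exact: quad_gt0.
have q2 u : 0 <= u -> 0 < quad p2 u by exact: quad_gt0.
have dG (u : R) : 0 <= u -> is_derive u 1 G (K u).
  move=> u0.
  have l1 := is_derive_comp1 (f := @ln R) (g := quad p1) (is_derive1_ln (q1 u u0)) (is_derive_quad p1 u).
  have l2 := is_derive_comp1 (f := @ln R) (g := quad p2) (is_derive1_ln (q2 u u0)) (is_derive_quad p2 u).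
  have h := is_deriveZ1 (2 * rho ^+ 2)^-1 (is_deriveD1 (is_deriveZ1 2^-1 (is_deriveB1 l2 l1))
     (is_deriveB1 (is_derive_psi a1 u0) (is_derive_psi a2 u0))).
  apply: (is_derive_eq h); rewrite -/p1 -/p2 /K.
  have := lt0r_neq0 (q1 u u0); have := lt0r_neq0 (q2 u u0); rewrite /quad => n2 n1.
  by field; rewrite n1 n2 gt_eqF.
have G0 : G 0 = (zcot z1 - zcot z2) / (2 * rho ^+ 2).
  by rewrite /G /quad !mulr0 !mul0r subrr mulr0 add0r !psi0// mulrC.
have -> : (((zcot z2 - zcot z1) / (2 * rho ^+ 2))%:E = 0%:E - (G 0)%:E)%E.
  by rewrite G0 -EFinB sub0r -mulNr opprB.
apply: (@ge0_continuous_FTC2y _ K G 0 0).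
- move=> u u0; rewrite mulr_ge0// ?subr_ge0// invr_ge0 mulr_ge0// ltW ?q1 ?q2//.
- apply: continuous_in_subspaceT => u /set_mem /=; rewrite in_itv/= andbT => u0.
  exact: is_derive_continuous (is_deriveZ1 (p2 - p1) (is_deriveV1
    (f := fun u => quad p1 u * quad p2 u) (mulf_neq0 (lt0r_neq0 (q1 u u0)) (lt0r_neq0 (q2 u u0)))
    (is_deriveM1 (is_derive_quad p1 u) (is_derive_quad p2 u)))).
- have -> : (0 : R) = (2 * rho ^+ 2)^-1 * (2^-1 * 0 + (0 - 0)) by rewrite subrr mulr0 addr0 mulr0.
  apply: cvgM; first exact: cvg_cst.
  apply: cvgD; last by apply: cvgB; exact: cvg_psi.
  by apply: cvgM; [exact: cvg_cst|exact: cvg_ln_quad].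
- by move=> u u0; have [] := dG u (ltW u0).
- have /is_derive_continuous h := dG 0 (lexx 0).
  exact: cvg_at_right_filter.
- by move=> u; rewrite in_itv/= andbT => u0; rewrite derive1E; have [] := dG u (ltW u0).
Qed.

End FiberIntegral.

(** * The primitive of [zcot] and the Clausen function *)

Section ClausenPrimitive.
Context {R : realType} (Lam : R).
Hypothesis HLam : [\/ Lam = 1, Lam = -1 | Lam = 0].
Notation mu := (@lebesgue_measure R).
Notation c := (c_ Lam).
Notation s := (s_ Lam).
Notation zcot := (zcot Lam).
Notation arclen := (arclen Lam).
Notation arc0 := (arc0 Lam).

Lemma arclen_le z m : arclen m -> 0 < z -> z <= m -> arclen z.
Proof. by move=> [_ h] z0 zm; split => // L; apply: le_lt_trans zm _; exact: h. Qed.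

Lemma arc0_le z m : arclen m -> 0 <= z -> z <= m -> arc0 z.
Proof.
by move=> am; rewrite le_eqVlt => /predU1P[<- _|z0 zm]; [left|right; exact: (arclen_le am)].
Qed.

Lemma zcotN z : zcot (- z) = zcot z.
Proof.
by rewrite /zcot oppr_eq0 s_N// c_N//; case: ifP => // _; rewrite invrN mulrN !mulNr opprK.
Qed.

Lemma s_neq0 z : z != 0 -> arc0 `|z| -> s z != 0.
Proof.
move=> z0 [/eqP|az]; first by rewrite normr_eq0 (negbTE z0).
have := s_gt0 HLam az; case: (ltrgt0P z) z0 => [zp|zn|->] //.
  by move=> _ sz; rewrite gt_eqF.
by rewrite s_N// oppr_gt0 => _ sz; rewrite lt_eqF.
Qed.

Lemma cvg_s_ratio : s t / t @[t --> (0 : R)^'] --> (1 : R).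
Proof.
have [d e] := is_derive_s HLam 0; rewrite c_0// in e.
have : (fun h : R => h^-1 *: ((s \o shift 0) (h *: (1 : R)) - s 0)) @ 0^' --> (1 : R).
  by rewrite -[X in _ --> X]e; exact: d.
apply: cvg_trans; apply: near_eq_cvg; near=> t.
by rewrite /= s_0// subr0 addr0 /GRing.scale /= mulr1 mulrC.
Unshelve. all: by end_near. Qed.

Lemma continuous_zcot z : arc0 `|z| -> {for z, continuous zcot}.
Proof.
move=> az; have [->|z0] := eqVneq z 0.
  have zcot0 : zcot 0 = 1 by rewrite /zcot eqxx.
  apply/continuous_withinNx; rewrite zcot0.
  have h : c t * (s t / t)^-1 @[t --> (0 : R)^'] --> (1 : R).
    rewrite -[X in _ --> X]mulr1; apply: cvgM.
      have /is_derive_continuous/continuous_withinNx := is_derive_c HLam 0.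
      by rewrite c_0.
    by rewrite -[X in _ --> X]invr1; apply: cvgV; [exact: oner_neq0|exact: cvg_s_ratio].
  apply: cvg_trans h; apply: near_eq_cvg; near=> t.
  have t0 : t != 0 by near: t; exact: nbhs_dnbhs_neq.
  by rewrite /zcot (negbTE t0) invf_div mulrA [c t * t]mulrC.
have sz := s_neq0 z0 az.
have h := is_deriveM1 (is_deriveM1 (is_derive_id z 1) (is_derive_c HLam z))
  (is_deriveV1 sz (is_derive_s HLam z)).
have zcotz : zcot z = z * c z * (s z)^-1 by rewrite /zcot (negbTE z0).
have := is_derive_continuous h; rewrite /prop_for /continuous_at zcotz.
apply: cvg_trans; apply: near_eq_cvg; near=> t.
have t0 : t != 0.
  by near: t; have := @open_nbhs_nbhs R^o z [set x | x != 0] (conj (@open_neq R 0) z0).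
by rewrite /zcot (negbTE t0).
Unshelve. all: by end_near. Qed.

(** The domain is symmetric about [0] because the argument [t + de] met on the slices takes both
    signs. The integral starts at [- m] and is normalised afterwards, so that [0] is an interior
    point. *)
Lemma zcot_primitive m : arclen m ->
  exists2 Psi : R -> R, Psi 0 = 0 & forall z : R, `|z| < m -> is_derive z 1 Psi (zcot z).
Proof.
move=> am; have m0 := am.1.
pose F z := \int[mu]_(t in `[- m, z]) zcot t.
exists (fun z => F z - F 0); first by rewrite subrr.
move=> z zm; have /andP[mz zm'] : - m < z < m by rewrite -ltr_norml.
have cz (t : R) : - m <= t <= m -> {for t, continuous zcot}.
  by rewrite -ler_norml => tm; apply: continuous_zcot; exact: (arc0_le am).
have ig : mu.-integrable `[- m, m] (EFin \o zcot).
  apply: continuous_compact_integrable; first exact: segment_compact.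
  by apply: continuous_in_subspaceT => t /set_mem /=; rewrite in_itv/=; exact: cz.
have [dF F'] := continuous_FTC1_closed zm' ig mz (cz z ltac:(by rewrite !ltW)).
have h : is_derive z 1 F (zcot z) by split; [exact: dF|rewrite -F' derive1E].
by apply: (is_derive_eq (is_deriveB1 h (is_derive_cst (F 0) z 1))); rewrite subr0.
Qed.

Variables (m : R) (Psi : R -> R).
Hypothesis am : arclen m.
Hypothesis Psi0 : Psi 0 = 0.
Hypothesis dPsi : forall z : R, `|z| < m -> is_derive z 1 Psi (zcot z).

(** Since [zcot] is even, [Psi z] and [- Psi (- z)] both compute its integral over [[0, z]]. *)
Lemma PsiN z : 0 <= z < m -> Psi (- z) = - Psi z.
Proof.
move=> /andP[]; rewrite le_eqVlt => /predU1P[<-|z0 zm].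
  by rewrite oppr0 Psi0 oppr0.
have tm (t : R) : 0 <= t <= z -> `|t| < m by move=> /andP[t0 tz]; rewrite ger0_norm//; lra.
have e1 : (\int[mu]_(t in `[0%R, z]) (zcot t)%:E = (Psi z - Psi 0)%:E)%E.
  apply: FTC_cc => // t tz; first by apply: dPsi; exact: tm.
  by apply: continuous_zcot; apply: (arc0_le am); rewrite ?normr_ge0// ltW// tm.
have e2 : (\int[mu]_(t in `[0%R, z]) (zcot t)%:E = (- Psi (- z) - - Psi (- 0))%:E)%E.
  apply: (@FTC_cc _ zcot (fun t => - Psi (- t))) => // t tz.
    have tm' : `|- t| < m by rewrite normrN tm.
    have h := is_deriveZ1 (-1) (is_derive_comp1 (f := Psi) (g := -%R) (dPsi tm') (is_deriveNid t 1)).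
    have -> : (fun t => - Psi (- t)) = (fun t => -1 * Psi (- t)) by apply/funext => x; rewrite mulN1r.
    by apply: (is_derive_eq h); rewrite zcotN mulN1r mulrN mulr1 opprK.
  by apply: continuous_zcot; apply: (arc0_le am); rewrite ?normr_ge0// ltW// tm.
move: e2; rewrite e1 oppr0 Psi0 !oppr0 !addr0 => -[->].
by rewrite opprK.
Qed.

Lemma ln_ge (x : R) : 0 < x -> 1 - x^-1 <= ln x.
Proof.
move=> x0; have xV : 0 < x^-1 by rewrite invr_gt0.
have : ln (1 + (x^-1 - 1)) <= x^-1 - 1 by apply: le_ln1Dx; lra.
by rewrite addrC subrK lnV ?posrE//; lra.
Qed.

Lemma cvg_zlns : t * ln (s t) @[t --> (0 : R)^'+] --> (0 : R).
Proof.
have m0 := am.1.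
have near0 : \forall t \near (0 : R)^'+, 0 < t /\ 0 < s t.
  near=> t; have t0 : 0 < t by near: t; exact: nbhs_right_gt.
  split => //; apply: (s_gt0 HLam); apply: (arclen_le am) => //.
  by near: t; exact: nbhs_right_le.
have cs : s t @[t --> (0 : R)^'+] --> (0 : R).
  have /is_derive_continuous h := is_derive_s HLam 0.
  by have := cvg_at_right_filter h; rewrite s_0.
have ct : t @[t --> (0 : R)^'+] --> (0 : R) by apply: cvg_at_right_filter; exact: cvg_id.
(* The upper bound is [ln s <= s - 1]. The lower one applies [1 - x^-1 <= ln x] to the square root
   of [s], because [t / sqrt s] tends to [0] whereas [t / s] does not. *)
apply: (@squeeze_cvgr _ _ _ _ (fun t => 2 * t - 2 * ((s t / t)^-1 * Num.sqrt (s t)))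
  (fun t => t * (s t - 1))).
- near=> t; have [t0 st] : 0 < t /\ 0 < s t by near: t; exact: near0.
  have r0 : 0 < Num.sqrt (s t) by rewrite sqrtr_gt0.
  have r2 : s t = Num.sqrt (s t) ^+ 2 by rewrite sqr_sqrtr// ltW.
  apply/andP; split.
    have -> : 2 * t - 2 * ((s t / t)^-1 * Num.sqrt (s t)) = t * (2 * (1 - (Num.sqrt (s t))^-1)).
      by rewrite {1}r2; field; rewrite !gt_eqF.
    rewrite ler_pM2l// {2}r2 lnXn// -[ln _ *+ 2]mulr_natl ler_pM2l//; exact: ln_ge.
  rewrite ler_pM2l//; have := @le_ln1Dx R (s t - 1).
  have -> : 1 + (s t - 1) = s t by ring.
  by apply; lra.
- have z0 : 2 * 0 - 2 * (1^-1 * Num.sqrt 0) = 0 :> R by rewrite sqrtr0 !mulr0 subrr.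
  rewrite -[X in _ --> X]z0.
  apply: cvgB; first by apply: cvgM; [exact: cvg_cst|exact: ct].
  apply: cvgM; first exact: cvg_cst.
  apply: cvgM.
    apply: cvgV; first exact: oner_neq0.
    exact: cvg_dnbhs_at_right cvg_s_ratio.
  apply: (@cvg_comp _ _ _ s (@Num.sqrt R) _ _ _ cs); exact: sqrt_continuous.
- rewrite -[X in _ --> X](mul0r (0 - 1)); apply: cvgM => //.
  by apply: cvgB => //; exact: cvg_cst.
Unshelve. all: by end_near. Qed.

Lemma measurable_s : measurable_fun setT s.
Proof. by apply: continuous_measurable_fun => t; exact: is_derive_continuous (is_derive_s HLam t). Qed.

Definition lns (t : R) : R := ln `|2 * s (t / 2)|.

Lemma measurable_lns : measurable_fun setT lns.
Proof.
apply: (measurableT_comp (@measurable_ln R)).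
apply: (measurableT_comp (@normr_measurable R setT)).
apply: measurable_funM => //; apply: (measurableT_comp measurable_s).
exact: measurable_funM.
Qed.

Lemma s_le_exp t : 0 <= t -> s t <= expR t.
Proof.
move=> t0; have e1 : 1 <= expR t by rewrite -expR0 ler_expR.
rewrite s_E; case: HLam => ->; rewrite !lamE.
- exact: le_trans (sin_le1 t) e1.
- by rewrite ler_pdivrMr//; have := expR_gt0 (- t); have := expR_gt0 t; lra.
- by have := expR_ge1Dx t; rewrite /=; lra.
Qed.

(** Integration by parts: [z * ln (s z) - Psi z] is a primitive of [ln (s z)]. The integrand is
    unbounded below at [0], so the nonnegative function [K - lns] is integrated instead;
    [K = ln 2 + z] is an upper bound for [lns] by [s_le_exp]. *)
Lemma integral_lns z : 0 < z < m ->
  \int[mu]_(t in `[0, 2 * z]) lns t = 2 * (z * ln (s z) - Psi z) + 2 * z * ln 2.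
Proof.
move=> /andP[z0 zm]; pose K : R := ln 2 + z.
have sP t : 0 < t -> t <= 2 * z -> 0 < s (t / 2).
  by move=> t0 tz; apply: (s_gt0 HLam); apply: (arclen_le am); lra.
have lnsE t : 0 < t -> t <= 2 * z -> lns t = ln 2 + ln (s (t / 2)).
  by move=> t0 tz; have st := sP t t0 tz; rewrite /lns gtr0_norm ?mulr_gt0// lnM// posrE.
pose f t := K - lns t.
pose g t := K - (ln 2 + ln (s (t / 2))).
pose F t := K * t - (2 * (t / 2 * ln (s (t / 2)) - Psi (t / 2)) + t * ln 2).
have dhalf (t : R) : is_derive t 1 (fun t => t / 2) (2^-1 : R).
  have h := is_deriveZ1 2^-1 (is_derive_id t 1).
  have -> : (fun t : R => t / 2) = (fun t => 2^-1 * t) by apply/funext => x; rewrite mulrC.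
  by apply: (is_derive_eq h); rewrite mulr1.
have dls (t : R) : 0 < t -> t <= 2 * z ->
    is_derive t 1 (fun t => ln (s (t / 2))) ((s (t / 2))^-1 * (c (t / 2) * 2^-1)).
  move=> t0 tz; have st := sP t t0 tz.
  have h := is_derive_comp1 (f := s) (g := fun t => t / 2) (is_derive_s HLam (t / 2)) (dhalf t).
  exact: (is_derive_comp1 (f := @ln R) (g := fun t => s (t / 2)) (is_derive1_ln st) h).
have Ff : (\int[mu]_(t in `[0%R, (2 * z)%R]) (g t)%:E = (F (2 * z) - 0)%:E)%E.
  apply: ge0_FTC_oc.
  - by lra.
  - move=> t /andP[t0 tz]; have st := sP t t0 tz.
    rewrite /g /K subr_ge0 lerD2l -[leRHS]expRK ler_ln ?posrE ?expR_gt0//.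
    by apply: le_trans (s_le_exp _) _; rewrite ?ler_expR; lra.
  - move=> t /andP[t0 tz]; have st := sP t t0 tz.
    have tm : `|t / 2| < m by rewrite ger0_norm; lra.
    have hP := is_derive_comp1 (f := Psi) (g := fun t => t / 2) (dPsi tm) (dhalf t).
    have h := is_deriveB1 (is_deriveZ1 K (is_derive_id t 1)) (is_deriveD1 (is_deriveZ1 2
      (is_deriveB1 (is_deriveM1 (dhalf t) (dls t t0 tz)) hP)) (is_deriveM1 (is_derive_id t 1)
      (is_derive_cst (ln 2 : R) t 1))).
    apply: (is_derive_eq h); rewrite /g /zcot gt_eqF ?divr_gt0// /cst.
    by field; rewrite gt_eqF.
  - move=> t /andP[t0 tz]; have st := sP t t0 tz.
    exact: is_derive_continuous (is_deriveB1 (is_derive_cst K t 1)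
      (is_deriveD1 (is_derive_cst (ln 2 : R) t 1) (dls t t0 tz))).
  - have ch : t / 2 @[t --> (0 : R)^'+] --> (0 : R)^'+.
      move=> P [e /= e0 he]; exists e => //= t te t0; apply: he; last exact: divr_gt0.
      move: te; rewrite /= !sub0r !normrN !gtr0_norm ?divr_gt0//; lra.
    have c0 : t @[t --> (0 : R)^'+] --> (0 : R) by apply: cvg_at_right_filter; exact: cvg_id.
    have z00 : K * 0 - (2 * (0 - 0) + 0 * ln 2) = 0 :> R by rewrite !(mulr0, mul0r, subrr, addr0).
    rewrite -[X in _ --> X]z00.
    apply: cvgB; first by apply: cvgM; [exact: cvg_cst|exact: c0].
    apply: cvgD; last by apply: cvgM; [exact: c0|exact: cvg_cst].
    apply: cvgM; first exact: cvg_cst.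
    apply: cvgB; first exact: (cvg_comp _ _ ch cvg_zlns).
    have m0 : `|0 : R| < m by rewrite normr0 am.1.
    have /is_derive_continuous hc := dPsi m0.
    have := cvg_at_right_filter hc; rewrite Psi0 => hP.
    exact: (cvg_comp _ _ ch hP).
have mf : measurable_fun setT f by apply: measurable_funB => //; exact: measurable_lns.
have mg : measurable_fun setT g.
  apply: measurable_funB => //; apply: measurable_funD => //.
  apply: (measurableT_comp (@measurable_ln R)); apply: (measurableT_comp measurable_s).
  exact: measurable_funM.
(* On this interval [f] and [g] differ only at [0], where the convention [ln 0 = 0] applies in
   different places. *)
have {}Ff : (\int[mu]_(t in `[0%R, (2 * z)%R]) (f t)%:E = (F (2 * z))%:E)%E.
  rewrite subr0 in Ff; rewrite -Ff.
  apply: (eq_integral_except (r := 0)) => //.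
  - by apply: measurable_funTS; exact/measurable_EFinP.
  - by apply: measurable_funTS; exact/measurable_EFinP.
  - move=> t /=; rewrite in_itv/= => /andP[t0 tz] tn0.
    by rewrite /f lnsE// lt_neqAle eq_sym tn0.
have f0 t : 0 <= t <= 2 * z -> 0 <= f t.
  move=> /andP[]; rewrite le_eqVlt => /predU1P[<- _|t0 tz].
    have l2 : 0 < ln (2 : R) by rewrite ln_gt0// ltr1n.
    have -> : f 0 = K by rewrite /f /lns mul0r s_0// mulr0 normr0 (ln0 (lexx 0)) subr0.
    by rewrite /K; lra.
  have st := sP t t0 tz; rewrite /f lnsE// /K subr_ge0 lerD2l -[leRHS]expRK ler_ln ?posrE ?expR_gt0//.
  by apply: le_trans (s_le_exp _) _; rewrite ?ler_expR; lra.
have if_ : mu.-integrable `[0, 2 * z] (EFin \o f).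
  apply/integrableP; split; first by apply: measurable_funTS; exact/measurable_EFinP.
  have -> : (\int[mu]_(t in `[0%R, (2 * z)%R]) `|(EFin \o f) t| =
      \int[mu]_(t in `[0%R, (2 * z)%R]) (f t)%:E)%E; last by rewrite Ff ltry.
  apply: eq_integral => t /set_mem /=; rewrite in_itv/= => tz; by rewrite ger0_norm// f0.
have iK : mu.-integrable `[0, 2 * z] (EFin \o cst K).
  apply: continuous_compact_integrable; first exact: segment_compact.
  by apply: continuous_subspaceT => t; exact: cvg_cst.
have -> : \int[mu]_(t in `[0, 2 * z]) lns t = \int[mu]_(t in `[0, 2 * z]) (cst K t - f t).
  by apply: eq_Rintegral => t _; rewrite /f /=; ring.
have muD : mu `[0%R, (2 * z)%R]%classic = (2 * z)%:E.
  have := @lebesgue_measure_itv R `[0, 2 * z].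
  by rewrite /= lte_fin ifT ?oppr0 ?adde0//; lra.
rewrite RintegralB// Rintegral_cst// /Rintegral Ff [X in fine X]muD /=.
by rewrite /F (_ : 2 * z / 2 = z); [ring|field].
Qed.

Lemma integral_opp (f : R -> \bar R) : measurable_fun setT f ->
  (\int[mu]_x f x = \int[mu]_x f (- x)%R)%E.
Proof.
move=> mf; have N1 : (-1 : R) != 0 by rewrite oppr_eq0 oner_neq0.
have h (g : R -> \bar R) : measurable_fun setT g -> (forall x, (0 <= g x)%E) ->
    (\int[mu]_x g x = \int[mu]_x g (- x)%R)%E.
  move=> mg g0; rewrite (ge0_integral_affine 0 N1 mg g0) normrN1 mul1e.
  by apply: eq_integral => x _; rewrite addr0 mulN1r.
rewrite integralE [RHS]integralE; congr (_ - _)%E.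
  apply: (etrans (h _ (measurable_funepos mf) (funepos_ge0 f))).
  by apply: eq_integral => x _; rewrite !funeposE.
apply: (etrans (h _ (measurable_funeneg mf) (funeneg_ge0 f))).
by apply: eq_integral => x _; rewrite !funenegE.
Qed.

Lemma lnsN t : lns (- t) = lns t.
Proof. by rewrite /lns mulNr s_N// mulrN normrN. Qed.

Lemma Cl_double z : 0 < z < m ->
  Cl Lam (2 * z) = 2 * Psi z - 2 * z * ln (s z) - 2 * z * ln 2.
Proof.
move=> zm; have /andP[z0 _] := zm.
rewrite /Cl /oriented_int ifT; last by lra.
by rewrite -[X in - X]/(\int[mu]_(t in `[0, 2 * z]) lns t) integral_lns//; ring.
Qed.

Lemma ClN x : 0 < x -> Cl Lam (- x) = - Cl Lam x.
Proof.
move=> x0; rewrite /Cl /oriented_int ifF; last by apply/negbTE; rewrite -ltNge oppr_lt0.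
rewrite ifT ?ltW//; congr (- - _).
rewrite -/lns [LHS]/Rintegral [RHS]/Rintegral; congr fine.
rewrite integral_mkcond [RHS]integral_mkcond integral_opp; last first.
  apply/(measurable_restrictT _ _).1 => //.
  by apply: measurable_funTS; apply/measurable_EFinP; exact: measurable_lns.
apply: eq_integral => t _; rewrite !patchE.
have -> : (- t \in `[- x, 0]%classic) = (t \in `[0, x]%classic).
  by apply/idP/idP => /set_mem /=; rewrite in_itv/= => /andP[h1 h2]; apply/mem_set; rewrite /= in_itv/=; lra.
by case: ifP => // _; rewrite -[LHS]/((lns (- t))%:E) lnsN.
Qed.

End ClausenPrimitive.

(** * Slices of the normalised tetrahedron *)

Section SliceIntegral.
Context {R : realType} (Lam : R).
Hypothesis HLam1 : Lam = 1 \/ Lam = -1.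
Notation mu := (@lebesgue_measure R).
Notation c := (c_ Lam).
Notation s := (s_ Lam).
Notation zcot := (zcot Lam).
Notation arclen := (arclen Lam).
Notation arc0 := (arc0 Lam).

Lemma HLam3 : [\/ Lam = 1, Lam = -1 | Lam = 0].
Proof. by case: HLam1; [exact: Or31|exact: Or32]. Qed.
Let HLam := HLam3.

Lemma LamK : Lam * Lam = 1. Proof. by case: HLam1 => ->; lra. Qed.

Definition harc (t : R) := Lam = 1 -> - (pi / 2) < t < pi / 2.

Lemma c_gt0 t : harc t -> 0 < c t.
Proof.
rewrite /harc c_E; case: HLam1 => ->; rewrite !lamE => h.
  by apply: cos_gt0_pihalf; exact: h.
by have := expR_gt0 t; have := expR_gt0 (- t); lra.
Qed.

(** The inverse function of [s / c], that is, arctan or artanh. *)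
Definition atn (x : R) : R :=
  if Lam == 1 then atan x else (ln (1 + x) - ln (1 - x)) / 2.

Definition atn_dom (x : R) := Lam = -1 -> -1 < x < 1.

Lemma atnE : atn = if Lam == 1 then @atan R else (fun x => (ln (1 + x) - ln (1 - x)) / 2).
Proof. by apply/funext => x; rewrite /atn; case: ifP. Qed.

Lemma atn_domP x : atn_dom x -> 0 < 1 + Lam * x ^+ 2.
Proof.
rewrite /atn_dom; case: HLam1 => -> h; first by have := sqr_ge0 x; lra.
have /andP[h1 h2] := h erefl.
have : 0 < (1 - x) * (1 + x) by rewrite mulr_gt0; lra.
by lra.
Qed.

Lemma tan_dom t : harc t -> atn_dom (s t / c t).
Proof.
move=> ht L; have ct := c_gt0 ht; rewrite ltr_pdivrMr// ltr_pdivlMr// mulN1r mul1r.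
rewrite s_E c_E L !lamE; have := expR_gt0 t; have := expR_gt0 (- t); lra.
Qed.

Lemma is_derive_atn (x : R) : atn_dom x -> is_derive x 1 atn (1 + Lam * x ^+ 2)^-1.
Proof.
rewrite /atn_dom atnE; case: HLam1 => ->; rewrite !lamE => h.
  by rewrite mul1r; exact: is_derive1_atan.
have /andP[h1 h2] := h erefl.
have p1 : 0 < 1 + x by lra.
have p2 : 0 < 1 - x by lra.
have e1 := is_derive_comp1 (g := fun t => 1 + t) (is_derive1_ln p1)
  (is_deriveD1 (is_derive_cst (1 : R) x 1) (is_derive_id x 1)).
have e2 := is_derive_comp1 (g := fun t => 1 - t) (is_derive1_ln p2)
  (is_deriveB1 (is_derive_cst (1 : R) x 1) (is_derive_id x 1)).
have e := is_deriveM1 (is_deriveB1 e1 e2) (is_derive_cst (2^-1 : R) x 1).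
apply: (is_derive_eq e) => /=.
have p3 : 0 < (1 - x) * (1 + x) by rewrite mulr_gt0.
by field; rewrite !gt_eqF//; lra.
Qed.

Lemma atn_tan x : atn_dom x -> harc (atn x) /\ s (atn x) = x * c (atn x).
Proof.
rewrite /atn_dom /harc atnE s_E c_E; case: HLam1 => ->; rewrite !lamE => h.
  split; first by rewrite atan_gtNpi2 atan_ltpi2.
  have ca : 0 < cos (atan x) by apply: cos_gt0_pihalf; rewrite atan_gtNpi2 atan_ltpi2.
  by rewrite -{2}[x]atanK /tan divfK// gt_eqF.
have /andP[h1 h2] := h erefl.
have p1 : 0 < 1 + x by lra.
have p2 : 0 < 1 - x by lra.
set z := ((ln (1 + x) - ln (1 - x)) / 2); split; first by move/eqP; rewrite N1_neq1.
have e2 : expR z * (1 - x) = expR (- z) * (1 + x).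
  have : expR (z + z) = (1 + x) / (1 - x).
    have -> : z + z = ln (1 + x) - ln (1 - x) by rewrite /z; lra.
    by rewrite expRD expRN !lnK// posrE.
  rewrite expRD => e; apply: (mulfI (lt0r_neq0 (expR_gt0 z))).
  by rewrite !mulrA expRxMexpNx_1 mul1r e divfK// gt_eqF.
by rewrite mulrA; congr (_ / 2); lra.
Qed.

Lemma atnK t : harc t -> atn (s t / c t) = t.
Proof.
move=> ht; have ct := c_gt0 ht; move: ht ct; rewrite /harc atnE s_E c_E.
case: HLam1 => ->; rewrite !lamE => ht ct.
  by rewrite -[X in atan X]/(tan t) tanK// in_itv/= ht.
have e1 := expR_gt0 t; have e2 := expR_gt0 (- t).
have -> : 1 + (expR t - expR (- t)) / 2 / ((expR t + expR (- t)) / 2) =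
    expR t / ((expR t + expR (- t)) / 2) by field; lra.
have -> : 1 - (expR t - expR (- t)) / 2 / ((expR t + expR (- t)) / 2) =
    expR (- t) / ((expR t + expR (- t)) / 2) by field; lra.
have e3 : 0 < expR t + expR (- t) by lra.
by rewrite !ln_div ?posrE ?expR_gt0 ?divr_gt0// !expRK; lra.
Qed.

Lemma s_ge0 z m : arclen m -> 0 <= z <= m -> 0 <= s z.
Proof.
move=> am /andP[]; rewrite le_eqVlt => /predU1P[<-|z0 zm]; first by rewrite s_0.
by rewrite ltW// s_gt0//; exact: (arclen_le am).
Qed.

(** The factor [Lam] unifies the two curvatures: on nonnegative arguments cos decreases and cosh
    increases, so [Lam * c] decreases in both cases. *)
Lemma c_sub a b : Lam * (c a - c b) = 2 * (s ((a + b) / 2) * s ((b - a) / 2)).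
Proof.
have -> : c a = c ((a + b) / 2 + - ((b - a) / 2)) by congr (c _); field.
have -> : c b = c ((a + b) / 2 + (b - a) / 2) by congr (c _); field.
transitivity (2 * (Lam * Lam) * (s ((a + b) / 2) * s ((b - a) / 2))).
  by rewrite !c_D// s_N// c_N//; ring.
by rewrite LamK mulr1.
Qed.

Lemma Lam_c_le m a b : arclen m -> `|a| <= b -> b <= m -> Lam * c b <= Lam * c a.
Proof.
move=> am; rewrite ler_norml => /andP[ab ab'] bm.
rewrite -subr_ge0 -mulrBr c_sub mulr_ge0// mulr_ge0//; apply: (s_ge0 am); lra.
Qed.

(** For [Lam = -1] the two ends of the interval exchange their roles, and the factor [Lam] in the
    value corrects the sign. *)
Lemma fiber_integral_Lam rho z z' : 0 < rho -> arc0 z -> arc0 z' ->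
  Lam * c z' <= Lam * c z ->
  (\int[mu]_(u in `[0%R, +oo[)
     \int[mu]_(p in [set p : R | (Lam * (rho * c z') <= Lam * p <= Lam * (rho * c z))%R])
       ((u ^+ 2 + 2 * u * p + rho ^+ 2) ^- 2)%:E =
   (Lam * (zcot z - zcot z') / (2 * rho ^+ 2))%:E)%E.
Proof.
move=> r0 az az' cc.
have setE : [set p : R | Lam * (rho * c z') <= Lam * p <= Lam * (rho * c z)] =
    if Lam == 1 then `[rho * c z', rho * c z]%classic else `[rho * c z, rho * c z']%classic.
  apply/seteqP; split => p /=; case: HLam1 => L; rewrite [in Lam == 1]L !lamE /= in_itv/=;
    rewrite [X in X * p]L [X in X * (rho * c z')]L [X in X * (rho * c z)]L; lra.
have cc' : if Lam == 1 then c z' <= c z else c z <= c z'.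
  by case: HLam1 cc => L; rewrite [in Lam == 1]L !lamE [X in X * c z']L [X in X * c z]L; lra.
have res : (zcot z - zcot z') / (2 * rho ^+ 2) = - ((zcot z' - zcot z) / (2 * rho ^+ 2)) by lra.
have HL : Lam = if Lam == 1 then 1 else -1.
  by case: HLam1 => L; rewrite [in RHS]L !lamE.
rewrite setE [X in X * _ / _]HL; case: ifP cc' => _ cc'.
  by rewrite (fiber_integral HLam r0 az' az)// mul1r.
by rewrite (fiber_integral HLam r0 az az')// mulN1r mulNr res opprK.
Qed.

Variables (m al be : R).
Hypotheses (am : arclen m) (al0 : 0 < al) (be0 : 0 < be) (abm : al + be < m).
(** The three vertices with [u = 0] lie at the parameters [- h], [h] and [de]. *)
Let h := (al + be) / 2.
Let de := (be - al) / 2.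

(* The slice x_1 = X, x_2 = 1 of the normalised tetrahedron, bounded by the
   faces opposite to its vertices 4, 3 and 2; the remaining face is u = 0. *)
Definition region (X : R) : set R := [set p |
  [/\ Lam * p <= Lam * (c de - Lam * X * s de),
      Lam * (c (al + h) - Lam * X * s (al + h)) <= Lam * p &
      Lam * (c (be + h) + Lam * X * s (be + h)) <= Lam * p]].

(* Which of the two lower bounds of [region (s t / c t)] is active. *)
Definition far (t : R) := if t <= de then al + h + t else be + h - t.

Lemma harc_h t : - h <= t <= h -> harc t.
Proof.
move=> /andP[t1 t2] L; have mpi := am.2 L; move: t1 t2 abm; rewrite /h => t1 t2 ab.
by apply/andP; split; lra.
Qed.

Lemma far_bounds t : - h <= t <= h -> [/\ `|t + de| <= far t, 0 < far t & far t <= al + be].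
Proof.
have a0 := al0; have b0 := be0.
rewrite /far /h /de => /andP[t1 t2]; case: (leP t ((be - al) / 2)) => td;
  by split; rewrite ?ler_norml; lra.
Qed.

(** At [X = s t / c t] the addition formulas turn the affine bounds into quotients [c z / c t]. The
    difference of the two lower bounds is a nonnegative multiple of [s (t - de)], so they change
    over at [t = de]. *)
Lemma region_far t : - h <= t <= h -> region (s t / c t) =
  [set p | Lam * ((c t)^-1 * c (far t)) <= Lam * p <= Lam * ((c t)^-1 * c (t + de))].
Proof.
move=> th; have ct := c_gt0 (harc_h th).
have e1 : c de - Lam * (s t / c t) * s de = (c t)^-1 * c (t + de).
  by rewrite (c_D HLam t de); field; rewrite gt_eqF.
have e2 : c (al + h) - Lam * (s t / c t) * s (al + h) = (c t)^-1 * c (al + h + t).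
  by rewrite (c_D HLam (al + h) t); field; rewrite gt_eqF.
have e3 : c (be + h) + Lam * (s t / c t) * s (be + h) = (c t)^-1 * c (be + h - t).
  by rewrite (c_D HLam (be + h) (- t)) s_N// c_N//; field; rewrite gt_eqF.
have cmp : Lam * (c (be + h - t) - c (al + h + t)) = 2 * (s (al + be) * s (t - de)).
  by rewrite c_sub; congr (2 * (s _ * s _)); rewrite /h /de; field.
have sab : 0 <= s (al + be) by apply: (s_ge0 am); have := al0; have := be0; have := abm; lra.
have ict : 0 < (c t)^-1 by rewrite invr_gt0.
have a0 := al0; have b0 := be0; have ab := abm; move/andP: th => [t1 t2].
have mono x y : Lam * x <= Lam * y -> Lam * ((c t)^-1 * x) <= Lam * ((c t)^-1 * y).
  by move=> xy; rewrite !(mulrCA Lam) ler_pM2l.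
apply/seteqP; split => p; rewrite /region /far /= e1 e2 e3.
  by move=> [h1 h2 h3]; case: ifP => _; rewrite h1 ?h2 ?h3.
case: ifP => td /andP[h1 h2]; split => //.
  apply: le_trans h1; apply: mono; rewrite -subr_ge0 -mulrBr -opprB mulrN cmp -mulrN -mulrN -s_N//.
  rewrite !mulr_ge0//; apply: (s_ge0 am); move: t1 td; rewrite /h /de => t1 td; lra.
move/negbT: td; rewrite -ltNge => td.
apply: le_trans h1; apply: mono; rewrite -subr_ge0 -mulrBr cmp.
rewrite !mulr_ge0//; apply: (s_ge0 am); move: t2 td; rewrite /h /de => t2 td; lra.
Qed.

Lemma slice_integral t : - h <= t <= h ->
  (\int[mu]_(u in `[0%R, +oo[) \int[mu]_(p in region (s t / c t)%R)
     ((u ^+ 2 + 2 * u * p + (1 + Lam * (s t / c t) ^+ 2)) ^- 2)%:E =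
   (Lam * (zcot (t + de) - zcot (far t)) / (2 * (1 + Lam * (s t / c t) ^+ 2)))%:E)%E.
Proof.
move=> th; have ct := c_gt0 (harc_h th); have [f1 f2 f3] := far_bounds th.
(* Hence the fibre integral is taken with [rho = (c t)^-1]. *)
have -> : 1 + Lam * (s t / c t) ^+ 2 = (c t)^-1 ^+ 2.
  apply: (mulIf (lt0r_neq0 (exprn_gt0 2 ct))).
  rewrite mulrDl mul1r -mulrA -exprMn divfK ?gt_eqF// c2s2//.
  by rewrite -exprMn mulVf ?gt_eqF// expr1n.
have fm : far t <= m by apply: le_trans f3 (ltW abm).
have -> : zcot (t + de) = zcot `|t + de|.
  by case: (ger0P (t + de)) => // _; rewrite zcotN.
have cE : c (t + de) = c `|t + de| by case: (ger0P (t + de)) => // _; rewrite c_N.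
rewrite region_far// cE; apply: fiber_integral_Lam.
- by rewrite invr_gt0.
- exact: (arc0_le am) (normr_ge0 _) (le_trans f1 fm).
- by right; exact: (arclen_le am).
- by apply: (Lam_c_le am) => //; rewrite normr_id.
Qed.

Variable Psi : R -> R.
Hypothesis Psi0 : Psi 0 = 0.
Hypothesis dPsi : forall z : R, `|z| < m -> is_derive z 1 Psi (zcot z).

Let T := s h / c h.
Let Td := s de / c de.

Lemma h_bounds : - h <= h <= h /\ - h <= de <= h.
Proof. by have a0 := al0; have b0 := be0; rewrite /h /de; lra. Qed.

Lemma tan_le a b : - h <= a <= h -> - h <= b <= h -> (s a / c a <= s b / c b) = (a <= b).
Proof.
move=> ha hb; have ca := c_gt0 (harc_h ha); have cb := c_gt0 (harc_h hb).
rewrite ler_pdivrMr// mulrAC ler_pdivlMr//.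
have e : s b * c a - s a * c b = s (b - a) by rewrite s_D// s_N// c_N//; ring.
have a0 := al0; have b0 := be0; have ab := abm.
move: ha hb; rewrite /h => /andP[a1 a2] /andP[b1 b2].
rewrite -subr_ge0 e; apply/idP/idP => [sba|ba].
  rewrite leNgt; apply/negP => ba.
  have : 0 < s (a - b) by apply: (s_gt0 HLam); apply: (arclen_le am); lra.
  by rewrite -opprB s_N//; lra.
by apply: (s_ge0 am); lra.
Qed.

Lemma atn_itv x : - T <= x <= T -> [/\ atn_dom x, - h <= atn x <= h & x = s (atn x) / c (atn x)].
Proof.
have [hh hd] := h_bounds; have ch := c_gt0 (harc_h hh).
move=> /andP[x1 x2].
have dx : atn_dom x.
  move=> L; have /andP[t1 t2] := tan_dom (harc_h hh) L; rewrite -/T in t1 t2; lra.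
have [hx sx] := atn_tan dx; have cx := c_gt0 hx.
have xE : x = s (atn x) / c (atn x) by rewrite sx mulfK// gt_eqF.
split => //.
have a0 := al0; have b0 := be0; have ab := abm.
have half (y : R) : arclen (h + h) -> harc y -> s (y - h) <= 0 -> y <= h.
  move=> ahh hy sy; rewrite leNgt; apply/negP => hlt.
  suff : 0 < s (y - h) by lra.
  apply: (s_gt0 HLam); split; first by lra.
  by move=> L; have /andP[y1 y2] := hy L; have := pi_gt0 R; move: hlt; rewrite /h; lra.
have ahh : arclen (h + h) by apply: (arclen_le am); rewrite /h; lra.
have leT (y : R) : harc y -> s y <= T * c y -> y <= h.
  move=> hy; rewrite /T mulrAC ler_pdivlMr// => sy; apply: half => //.
  by rewrite s_D// s_N// c_N//; lra.
apply/andP; split.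
  rewrite lerNl; apply: leT.
    by move=> L; have /andP[y1 y2] := hx L; apply/andP; split; lra.
  rewrite s_N// c_N// sx -mulNr ler_pM2r//; lra.
by apply: leT => //; rewrite sx ler_pM2r.
Qed.

(** Here [k] is the slope of [far]: [1] up to [de] and [-1] beyond. The factor [k] in front of [Psi]
    compensates the inner derivative because [k * k = 1]. *)
Lemma slice_primitive (x d e : R) (k : R) : - T <= x <= T -> (k = 1 \/ k = -1) ->
  `|atn x + d| < m -> `|k * atn x + e| < m ->
  is_derive x 1 (fun x => Lam / 2 * (Psi (atn x + d) - k * Psi (k * atn x + e)))
    (Lam * (zcot (atn x + d) - zcot (k * atn x + e)) / (2 * (1 + Lam * x ^+ 2))) /\
  {for x, continuous (fun x => Lam * (zcot (atn x + d) - zcot (k * atn x + e)) / (2 * (1 + Lam * x ^+ 2)))}.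
Proof.
move=> xT k1 hd he; have [dx hx xE] := atn_itv xT.
have q0 := atn_domP dx; have da := is_derive_atn dx.
have d1 := is_deriveD1 da (is_derive_cst d x 1).
have d2 := is_deriveD1 (is_deriveZ1 k da) (is_derive_cst e x 1).
have P1 := is_derive_comp1 (g := fun t => atn t + d) (dPsi hd) d1.
have P2 := is_derive_comp1 (g := fun t => k * atn t + e) (dPsi he) d2.
split.
  apply: (is_derive_eq (is_deriveZ1 (Lam / 2) (is_deriveB1 P1 (is_deriveZ1 k P2)))).
  have kk : k * k = 1 by case: k1 => ->; ring.
  rewrite /= !addr0; set w := (1 + Lam * x ^+ 2)^-1; have -> : k * (zcot (k * atn x + e) * (k * w)) =
    (k * k) * (zcot (k * atn x + e) * w) by ring.
  by rewrite kk /w; field; rewrite gt_eqF.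
have z1 : {for atn x + d, continuous zcot}.
  by apply: continuous_zcot => //; apply: (arc0_le am) => //; apply: ltW.
have z2 : {for k * atn x + e, continuous zcot}.
  by apply: continuous_zcot => //; apply: (arc0_le am) => //; apply: ltW.
have c1 := continuous_comp (is_derive_continuous d1) z1.
have c2 := continuous_comp (is_derive_continuous d2) z2.
apply: cvgM.
  apply: cvgM; first exact: cvg_cst.
  exact: cvgB c1 c2.
apply: cvgV; first by rewrite mulf_neq0 ?pnatr_eq0// gt_eqF.
apply: cvgM; first exact: cvg_cst.
apply: cvgD; first exact: cvg_cst.
apply: cvgM; first exact: cvg_cst.
exact: exprn_continuous.
Qed.

(** The integral splits at [Td], where [far] changes slope. There the terms [Psi (de + de)] of the
    two primitives cancel and [Psi (al + be)] occurs twice. At the ends the arguments are [- al],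
    [al] and [be], [be], and oddness of [Psi] combines them. *)
Lemma slab_integral :
  (\int[mu]_(X in `[(- T)%R, T]) \int[mu]_(u in `[0%R, +oo[) \int[mu]_(p in region X)
     ((u ^+ 2 + 2 * u * p + (1 + Lam * X ^+ 2)) ^- 2)%:E =
   (Lam * (Psi al + Psi be - Psi (al + be)))%:E)%E.
Proof.
have [hh hd] := h_bounds; have a0 := al0; have b0 := be0; have ab := abm.
pose F k d e x := Lam / 2 * (Psi (atn x + d) - k * Psi (k * atn x + e)).
pose f k d e x := Lam * (zcot (atn x + d) - zcot (k * atn x + e)) / (2 * (1 + Lam * x ^+ 2)).
pose G X := (\int[mu]_(u in `[0%R, +oo[) \int[mu]_(p in region X)
     ((u ^+ 2 + 2 * u * p + (1 + Lam * X ^+ 2)) ^- 2)%:E)%E.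
have G0 X : (0 <= G X)%E.
  apply: integral_ge0 => u _; apply: integral_ge0 => p _.
  by rewrite lee_fin invr_ge0 sqr_ge0.
have hN : - h <= - h <= h by move: hh; lra.
have TN : - T = s (- h) / c (- h) by rewrite s_N// c_N// mulNr.
have lt_tan a b : - h <= a <= h -> - h <= b <= h -> a < b -> s a / c a < s b / c b.
  by move=> ha hb; rewrite !ltNge tan_le.
have Tlt : - T < Td by rewrite TN; apply: lt_tan => //; rewrite /h /de; lra.
have dlt : Td < T by apply: lt_tan => //; rewrite /h /de; lra.
have E1 x : - T <= x <= Td -> G x = (f 1 de (al + h) x)%:E.
  move=> /andP[x1 x2]; have xT : - T <= x <= T by apply/andP; split; lra.
  have [_ hx xE] := atn_itv xT.
  have xd : atn x <= de by rewrite -(tan_le hx hd) -xE.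
  by rewrite /G [in LHS]xE (slice_integral hx) -xE /far xd /f mul1r [al + h + _]addrC.
have E2 x : Td < x <= T -> G x = (f (-1) de (be + h) x)%:E.
  move=> /andP[x1 x2]; have xT : - T <= x <= T by apply/andP; split; lra.
  have [_ hx xE] := atn_itv xT.
  have xd : (atn x <= de) = false by apply/negbTE; rewrite -(tan_le hx hd) -xE -ltNge.
  by rewrite /G [in LHS]xE (slice_integral hx) -xE /far xd /f mulN1r [be + h + _]addrC.
have D1 x : - T <= x <= Td -> is_derive x 1 (F 1 de (al + h)) (f 1 de (al + h) x) /\
    {for x, continuous (f 1 de (al + h))}.
  move=> /andP[x1 x2]; have xT : - T <= x <= T by apply/andP; split; lra.
  have [_ hx xE] := atn_itv xT.
  have : atn x <= de by rewrite -(tan_le hx hd) -xE.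
  move: hx; rewrite /h /de => /andP[t1 t2] t3.
  apply: slice_primitive; [exact: xT|by left| |]; rewrite ?mul1r ltr_norml /h /de; apply/andP; split; lra.
have D2 x : Td <= x <= T -> is_derive x 1 (F (-1) de (be + h)) (f (-1) de (be + h) x) /\
    {for x, continuous (f (-1) de (be + h))}.
  move=> /andP[x1 x2]; have xT : - T <= x <= T by apply/andP; split; lra.
  have [_ hx xE] := atn_itv xT.
  have : de <= atn x by rewrite -(tan_le hd hx) -xE.
  move: hx; rewrite /h /de => /andP[t1 t2] t3.
  apply: slice_primitive; [exact: xT|by right| |]; rewrite ?mulN1r ltr_norml /h /de; apply/andP; split; lra.
have I1 : (\int[mu]_(x in `[(- T)%R, Td]) G x = (F 1 de (al + h) Td - F 1 de (al + h) (- T))%:E)%E.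
  transitivity (\int[mu]_(x in `[(- T)%R, Td]) (f 1 de (al + h) x)%:E)%E.
    by apply: eq_integral => x /set_mem /=; rewrite in_itv/=; exact: E1.
  by apply: (@FTC_cc _ (f 1 de (al + h)) (F 1 de (al + h)) _ _ Tlt) => x xx; have [] := D1 x xx.
have mf2 : measurable_fun `[Td, T] (f (-1) de (be + h)).
  apply: subspace_continuous_measurable_fun => //.
  apply: continuous_in_subspaceT => x /set_mem /=; rewrite in_itv/= => /andP[x1 x2].
  by apply D2; lra.
have mf1 : measurable_fun `[- T, Td] (f 1 de (al + h)).
  apply: subspace_continuous_measurable_fun => //.
  apply: continuous_in_subspaceT => x /set_mem /=; rewrite in_itv/= => /andP[x1 x2].
  by apply D1; lra.
have mf2' : measurable_fun `]Td, T] (f (-1) de (be + h)).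
  apply: measurable_funS mf2 => // x /=; rewrite !in_itv/=; lra.
have I2 : (\int[mu]_(x in `]Td, T]) G x = (F (-1) de (be + h) T - F (-1) de (be + h) Td)%:E)%E.
  transitivity (\int[mu]_(x in `]Td, T]) (f (-1) de (be + h) x)%:E)%E.
    by apply: eq_integral => x /set_mem /=; rewrite in_itv/=; exact: E2.
  rewrite integral_itv_obnd_cbnd; last exact/measurable_EFinP.
  by apply: (@FTC_cc _ (f (-1) de (be + h)) (F (-1) de (be + h)) _ _ dlt) => x xx; have [] := D2 x xx.
have -> : `[- T, T]%classic = `[- T, Td]%classic `|` `]Td, T]%classic.
  apply/seteqP; split => x /=; rewrite !in_itv/=; last by case; lra.
  by move=> /andP[x1 x2]; have [xd|xd] := leP x Td; [left|right]; lra.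
have disj : [disjoint `[- T, Td]%classic & `]Td, T]%classic].
  apply/disj_setPS => x /= []; rewrite !in_itv/= => /andP[_ x1] /andP[x2 _].
  by move: (lt_le_trans x2 x1); rewrite ltxx.
have mG : measurable_fun (`[- T, Td]%classic `|` `]Td, T]%classic) G.
  apply/measurable_funU => //; split.
    apply: (eq_measurable_fun (EFin \o f 1 de (al + h))); last exact/measurable_EFinP.
    by move=> x /set_mem /=; rewrite in_itv/= => xT; rewrite -[RHS]/(G x) E1.
  apply: (eq_measurable_fun (EFin \o f (-1) de (be + h))); last exact/measurable_EFinP.
  by move=> x /set_mem /=; rewrite in_itv/= => xT; rewrite -[RHS]/(G x) E2.
rewrite ge0_integral_setU//; last (by move=> x _; exact: G0).
rewrite I1 I2 -EFinD; congr EFin.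
rewrite /F TN /T /Td !atnK; try exact: harc_h.
have -> : - h + de = - al by rewrite /h /de; field.
have -> : 1 * de + (al + h) = al + be by rewrite /h /de; field.
have -> : 1 * - h + (al + h) = al by ring.
have -> : h + de = be by rewrite /h /de; field.
have -> : -1 * h + (be + h) = be by ring.
have -> : -1 * de + (be + h) = al + be by rewrite /h /de; field.
have -> : Psi (- al) = - Psi al by apply: (PsiN HLam am Psi0 dPsi); lra.
by field.
Qed.
End SliceIntegral.

(** * Tetrahedra *)

Section TetrahedronGram.
Context {R : realType} (Lam : R).
Hypothesis HLam : [\/ Lam = 1, Lam = -1 | Lam = 0].
Notation c := (c_ Lam).
Notation s := (s_ Lam).
Notation q := (detX Lam).
Notation B := (bilX Lam).
Notation D x y := (metric_num Lam x y y).

(** The length only gives the ratio of [B x y] and the root of [D x y]. The scale is recovered from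
    [gramD] together with [c ^+ 2 + Lam * s ^+ 2 = 1], uniformly in [Lam]. *)
Lemma edge_bilX (x y : 'rV[R]_4) (l : R) :
  (forall t, 0 <= t <= 1 -> 0 < q ((1 - t) *: x + t *: y)) ->
  seg_length Lam x y = l -> 0 < l ->
  [/\ arclen Lam l, D x y = q x * q y * s l ^+ 2 &
      B x y = Num.sqrt (q x) * Num.sqrt (q y) * c l].
Proof.
move=> hq hl l0.
have qx : 0 < q x by have := hq 0; rewrite subr0 scale1r scale0r addr0; apply; rewrite lexx ler01.
have qy : 0 < q y by have := hq 1; rewrite subrr scale1r scale0r add0r; apply; rewrite lexx ler01.
have [|D0 dom e] := seg_length_acot HLam hq; first by rewrite hl.
have [arc] := acot_arc HLam dom; rewrite -e hl in arc *.
have sl := s_gt0 HLam arc; have c2s2l := c2s2 HLam l.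
have := gramD Lam x y; have := sqr_sqrtr (ltW D0).
have : 0 < Num.sqrt (D x y) by rewrite sqrtr_gt0.
move: (Num.sqrt (D x y)) => d d0 dE LD cE.
have {}cE : c l * d = B x y * s l by rewrite cE; field; rewrite gt_eqF.
have DE : D x y = q x * q y * s l ^+ 2.
  transitivity ((c l ^+ 2 + Lam * s l ^+ 2) * d ^+ 2); first by rewrite c2s2l mul1r dE.
  have -> : (c l ^+ 2 + Lam * s l ^+ 2) * d ^+ 2 = (c l * d) ^+ 2 + s l ^+ 2 * (Lam * d ^+ 2) by ring.
  by rewrite cE dE LD; ring.
split => //; rewrite -sqrtrM ?ltW//.
have dq : d = s l * Num.sqrt (q x * q y).
  apply/eqP; rewrite -(eqrXn2 (n := 2))//; last 2 first.
  - exact: ltW.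
  - exact: mulr_ge0 (ltW sl) (sqrtr_ge0 _).
  by rewrite exprMn sqr_sqrtr ?mulr_ge0 ?(ltW qx) ?(ltW qy)// dE DE mulrC.
by apply: (mulIf (lt0r_neq0 sl)); rewrite -cE dq; ring.
Qed.

Definition tetra_edge (a b : R) (i j : nat) : R :=
  (nth [::] [:: [:: 0; a; b; a + b]; [:: a; 0; a + b; b];
                [:: b; a + b; 0; a]; [:: a + b; b; a; 0]] i)`_j.

(** Stated for an arbitrary symmetric [g], so that it serves the bilinear form as well as [D]. *)
Lemma tetra_edgeP (a b : R) (f : R -> R) (r : 'I_4 -> R) (g : 'I_4 -> 'I_4 -> R) :
  (forall i j, g i j = g j i) -> (forall i, g i i = r i * r i * f 0) ->
  let gE i j l := g (inord i) (inord j) = r (inord i) * r (inord j) * f l in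
  gE 0 1 a -> gE 2 3 a -> gE 0 2 b -> gE 1 3 b -> gE 0 3 (a + b) -> gE 1 2 (a + b) ->
  forall i j, g i j = r i * r j * f (tetra_edge a b i j).
Proof.
move=> gs gd /= g01 g23 g02 g13 g03 g12 i j; have edgeC k l : tetra_edge a b k l = tetra_edge a b l k.
  rewrite /tetra_edge; case: k => [|[|[|[|k]]]]; case: l => [|[|[|[|l]]]]//=; by rewrite ?nth_nil.
have edge0 (k : 'I_4) : tetra_edge a b k k = 0 by case: k => -[|[|[|[|]]]].
have gE k l : (k < l < 4)%N -> g (inord k) (inord l) = r (inord k) * r (inord l) * f (tetra_edge a b k l).
  by move: k l => [|[|[|k]]] [|[|[|[|l]]]]; rewrite ?andbF.
have lt (k l : 'I_4) : (k < l)%N -> g k l = r k * r l * f (tetra_edge a b k l).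
  by move=> kl; have := gE k l; rewrite !inord_val kl ltn_ord; exact.
case: (ltngtP i j) => [/lt//|/lt h|/val_inj ->]; last by rewrite gd edge0.
by rewrite gs h edgeC [r j * _]mulrC.
Qed.

(** The [r i] normalise the vertices. For [Lam = 0] the entries of [B] reduce to [r i * r j], and
    the lengths are retained by the last clause. *)
Lemma tetrahedron_gram (V : 'M[R]_4) (a b : R) :
  lightlike_tetrahedron Lam V -> 0 < a -> 0 < b ->
  has_edge_lengths Lam V a b (a + b) ->
  exists r : 'I_4 -> R, [/\ arclen Lam (a + b), forall i, 0 < r i,
    forall i j, B (row i V) (row j V) = r i * r j * c (tetra_edge a b i j) &
    forall i j, D (row i V) (row j V) = (r i * r j) ^+ 2 * s (tetra_edge a b i j) ^+ 2].
Proof.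
move=> [fV cV _ _] a0 b0 [[e01 e23] [e02 e13] [e03 e12]].
have hseg i j t : 0 <= t <= 1 -> 0 < q ((1 - t) *: row i V + t *: row j V).
  move=> /andP[t0 t1]; apply: cV; exists ((1 - t) *: delta_mx 0 i + t *: delta_mx 0 j); split.
  - by move=> k; rewrite !mxE; apply: addr_ge0; apply: mulr_ge0; rewrite ?ler0n// subr_ge0.
  - rewrite (eq_bigr (fun k => (1 - t) * (k == i)%:R + t * (k == j)%:R)); last first.
      by move=> k _; rewrite !mxE eqxx.
    rewrite big_split/= -!mulr_sumr.
    have h (l : 'I_4) : \sum_(k < 4) ((k == l)%:R : R) = 1.
      rewrite (bigD1 l)//= eqxx big1 ?addr0// => k /negbTE->//.
    by rewrite !h !mulr1 subrK oner_neq0.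
  by rewrite mulmxDl -!scalemxAl -!rowE.
have qpos i : 0 < q (row i V).
  by have := hseg i i 0; rewrite subr0 scale1r scale0r addr0; apply; rewrite lexx ler01.
have Bsym x y : B x y = B y x by rewrite /bilX /mink; ring.
have Dsym x y : D x y = D y x by rewrite /metric_num /mink !coE; ring.
have Bxx x : B x x = q x by rewrite detXE /bilX; ring.
have Dxx x : D x x = 0 by rewrite /metric_num /mink !coE; ring.
exists (fun i => Num.sqrt (q (row i V))).
have ab0 : 0 < a + b by rewrite addr_gt0.
have Eh i j l : edge_length Lam V i j = l -> 0 < l -> _ :=
  fun e l0 => edge_bilX (hseg (inord i) (inord j)) e l0.
have [A01 D01 B01] := Eh _ _ _ e01 a0; have [A23 D23 B23] := Eh _ _ _ e23 a0.
have [A02 D02 B02] := Eh _ _ _ e02 b0; have [A13 D13 B13] := Eh _ _ _ e13 b0.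
have [A03 D03 B03] := Eh _ _ _ e03 ab0; have [A12 D12 B12] := Eh _ _ _ e12 ab0.
have sq i : Num.sqrt (q (row i V)) ^+ 2 = q (row i V) by rewrite sqr_sqrtr// ltW.
split => [//|i|i j|i j]; first by rewrite sqrtr_gt0.
- apply: (@tetra_edgeP a b c (fun i => Num.sqrt (q (row i V))) (fun i j => B (row i V) (row j V))) => [k l|k||||||].
  + exact: Bsym.
  + by rewrite Bxx c_0// mulr1 -expr2 sq.
  + exact: B01. + exact: B23. + exact: B02. + exact: B13. + exact: B03. + exact: B12.
- rewrite [(_ * _) ^+ 2]exprMn !sq.
  apply: (@tetra_edgeP a b (fun x => s x ^+ 2) (fun i => q (row i V)) (fun i j => D (row i V) (row j V))) => [k l|k||||||].
  + exact: Dsym.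
  + by rewrite Dxx s_0// expr0n mulr0.
  + exact: D01. + exact: D23. + exact: D02. + exact: D13. + exact: D03. + exact: D12.
Qed.

End TetrahedronGram.

(** * Passage to a tetrahedron with the same Gram matrix *)

Section GramReduction.
Context {R : realType} (Lam : R).
Notation mu := (@lebesgue_measure R).

Lemma proj_int_iterated (F : 'rV[R]_4 -> R) : density F ->
  (proj_int F = \int[mu]_X \int[mu]_u \int[mu]_p (F (vec4 X 1 u p))%:E)%E.
Proof.
move=> dF; have mF := measurable_toV1 dF; have F0 := density_ge0 dF.
rewrite /proj_int tonelli1//; last first.
- by move=> y; rewrite lee_fin.
- exact/measurable_EFinP.
apply: eq_integral => X _; rewrite tonelli1//; last first.
- by move=> y; rewrite lee_fin.
- apply/measurable_EFinP; exact: (measurableT_comp mF (measurable_pair1 X)).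
Qed.

Definition curved_coef (i j : nat) : R :=
  (nth [::] [:: [:: - Lam; 0; 0; 0]; [:: 0; 1; 0; 0];
                [:: 0; 0; Lam; 0]; [:: 0; 0; 0; Lam]] i)`_j.

Definition curved_form : 'M[R]_4 := \matrix_(i < 4, j < 4) curved_coef i j.

Lemma curved_formE m (V : 'M[R]_(m, 4)) i j :
  (V *m curved_form *m V^T) i j = bilX Lam (row i V) (row j V).
Proof.
rewrite !mxE sum4 !mxE !sum4 /bilX /mink /co !mxE !inordK// /curved_coef /=.
by ring.
Qed.

(* The quadratic form Lam X^2 + W^2 + u^2 + 2 u p.  The first vertex of the
   tetrahedron will span the u-axis and its opposite face will be u = 0, whose
   normal, the p-axis, is isotropic because this face is lightlike. *)
Definition null_coef (i j : nat) : R :=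
  (nth [::] [:: [:: Lam; 0; 0; 0]; [:: 0; 1; 0; 0];
                [:: 0; 0; 1; 1]; [:: 0; 0; 1; 0]] i)`_j.

Definition null_form : 'M[R]_4 := \matrix_(i < 4, j < 4) null_coef i j.

Lemma null_formE m (N : 'M[R]_(m, 4)) i j :
  (N *m null_form *m N^T) i j = Lam * N i (inord 0) * N j (inord 0) + N i (inord 1) * N j (inord 1)
    + N i (inord 2) * N j (inord 2) + N i (inord 2) * N j (inord 3) + N i (inord 3) * N j (inord 2).
Proof. by rewrite !mxE sum4 !mxE !sum4 !mxE !inordK// /null_coef /=; ring. Qed.

Lemma det_curved_form : \det curved_form = - Lam ^+ 3.
Proof. by rewrite det_nat4 /curved_coef /null_coef /=; ring. Qed.

Lemma det_null_form : \det null_form = - Lam.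
Proof. by rewrite det_nat4 /curved_coef /null_coef /=; ring. Qed.

(** The matrix [K = W^-1 V] carries one form to the other. As these have the determinants
    [- Lam ^+ 3] and [- Lam], which are equal, [K] has determinant of absolute value 1 and leaves
    the volume unchanged. The same comparison shows that [W] is invertible. *)
Lemma vol_gram (V W : 'M[R]_4) : Lam = 1 \/ Lam = -1 -> V \in unitmx ->
  W *m null_form *m W^T = V *m curved_form *m V^T ->
  let F x := (orthant (x *m invmx W))%:R * (x *m null_form *m x^T) 0 0 ^- 2 in
  [/\ W \in unitmx, density F & vol Lam (simplex V) = proj_int F].
Proof.
move=> HL uV WV F; have LK : Lam ^+ 2 = 1 by case: HL => ->; rewrite ?sqrrN expr1n.
have L0 : Lam != 0 by case: HL => ->; rewrite ?oppr_eq0 oner_neq0.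
have uW : W \in unitmx.
  have := congr1 determinant WV; rewrite !det_mulmx !det_tr det_curved_form det_null_form => e.
  rewrite unitmxE unitfE; apply/eqP => W0; move/eqP: e.
  rewrite W0 !mul0r eq_sym !mulf_eq0 oppr_eq0 expf_eq0/= (negbTE L0) orbF orbb.
  by move: uV; rewrite unitmxE unitfE => /negbTE->.
pose M := invmx W; pose K := M *m V.
have KK : K *m curved_form *m K^T = null_form.
  have -> : K *m curved_form *m K^T = M *m (V *m curved_form *m V^T) *m M^T.
    by rewrite /K trmx_mul !mulmxA.
  have -> : M *m (V *m curved_form *m V^T) *m M^T = (M *m W) *m null_form *m (M *m W)^T.
    by rewrite -WV trmx_mul !mulmxA.
  by rewrite mulVmx// mul1mx trmx1 mulmx1.
have dM : \det M != 0 by rewrite det_inv invr_eq0 -unitfE -unitmxE.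
have dK : `|\det K| = 1.
  have := congr1 determinant KK.
  rewrite (det_mulmx _ K^T) (det_mulmx K) !det_tr det_curved_form det_null_form => e.
  have /eqP : `|\det K| ^+ 2 = 1.
    rewrite real_normK ?num_real//; apply: (mulIf L0).
    have -> : Lam = - (- Lam ^+ 3) by rewrite opprK exprS LK mulr1.
    by rewrite mul1r mulrN expr2 mulrAC e exprS LK mulr1 opprK.
  by rewrite sqrf_eq1 => /orP[/eqP//|/eqP K1]; have := normr_ge0 (\det K); rewrite K1; lra.
have FE : (fun x => cone_density (fun a => detX Lam (a *m V)) (x *m M)) = F.
  apply/funext => x; rewrite /cone_density -mulmxA -/K; congr (_ * _ ^- 2).
  rewrite -KK; have -> : x *m (K *m curved_form *m K^T) *m x^T =
      (x *m K) *m curved_form *m (x *m K)^T by rewrite (trmx_mul x K) !mulmxA.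
  have row0 (y : 'rV[R]_4) : row 0 y = y by apply/rowP => k; rewrite mxE.
  by rewrite curved_formE row0 detXE /bilX expr2.
split => //; first by rewrite -FE; apply: density_lin => //; exact: density_simplex.
rewrite vol_simplex// (proj_int_lin dM (density_simplex Lam V)) FE muleA -EFinM -normrM.
by rewrite [_ * \det M]mulrC -det_mulmx dK mul1e.
Qed.
End GramReduction.

Section CurvedVolume.
Context {R : realType} (Lam : R).
Hypothesis HLam1 : Lam = 1 \/ Lam = -1.
Notation mu := (@lebesgue_measure R).
Notation c := (c_ Lam).
Notation s := (s_ Lam).
Notation arclen := (arclen Lam).
Let HLam := HLam3 HLam1.

Variables (m al be : R).
Hypotheses (am : arclen m) (al0 : 0 < al) (be0 : 0 < be) (abm : al + be < m).
Let h := (al + be) / 2.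
Let de := (be - al) / 2.
Let T := s h / c h.

(* Vertices with the prescribed Gram matrix with respect to [null_form]. *)
Definition null_vertex (i j : nat) : R :=
  (nth [::] [:: [:: 0; 0; 1; 0]; [:: - s h; c h; 0; c al];
                [:: s h; c h; 0; c be]; [:: s de; c de; 0; c (al + be)]] i)`_j.

Lemma null_vertex_gram i j : (i < 4)%N -> (j < 4)%N ->
  Lam * null_vertex i 0 * null_vertex j 0 + null_vertex i 1 * null_vertex j 1
    + null_vertex i 2 * null_vertex j 2 + null_vertex i 2 * null_vertex j 3
    + null_vertex i 3 * null_vertex j 2 = c (tetra_edge al be i j).
Proof.
have alE : al = h - de by rewrite /h /de; field.
have beE : be = h + de by rewrite /h /de; field.
have abE : al + be = h + h by rewrite /h; field.
have e1 := c2s2 HLam h; have e2 := c2s2 HLam de.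
have ca : c al = c h * c de + Lam * s h * s de by rewrite alE c_D// c_N// s_N//; ring.
have cb : c be = c h * c de - Lam * s h * s de by rewrite beE c_D//; ring.
have cab : c (al + be) = c h ^+ 2 - Lam * s h ^+ 2 by rewrite abE c_D//; ring.
have c0 := c_0 HLam.
by case: i => [|[|[|[|i]]]]; case: j => [|[|[|[|j]]]] => //= _ _;
  rewrite /null_vertex /tetra_edge /= ?c0 ?ca ?cb ?cab; lra.
Qed.

(** Each face inequality states that one barycentric coordinate is nonnegative, by the identities
    [k2], [k3] and [k4]. The bounds on [X] follow from nonnegative coordinates by [T1] and [T2];
    they make the outer domain of integration explicit. *)
Lemma region_orthant (b : 'rV[R]_4) X u p :
  X = - s h * co b 2 + s h * co b 3 + s de * co b 4 ->
  1 = c h * co b 2 + c h * co b 3 + c de * co b 4 ->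
  u = co b 1 ->
  p = c al * co b 2 + c be * co b 3 + c (al + be) * co b 4 ->
  orthant b <-> [/\ 0 <= u, - T <= X <= T & region Lam al be X p].
Proof.
rewrite /orthant; move: (co b 1) (co b 2) (co b 3) (co b 4) => b1 b2 b3 b4 XE bE -> pE.
have [hh hd] := h_bounds al0 be0; rewrite -/h -/de in hh hd.
have ch : 0 < c h by apply: (c_gt0 HLam1); apply: (harc_h am abm).
have cd : 0 < c de by apply: (c_gt0 HLam1); apply: (harc_h am abm).
have arc z : 0 < z -> z <= al + be -> 0 < s z.
  by move=> z0 zab; apply: (s_gt0 HLam); apply: (arclen_le am) => //; apply: le_trans zab (ltW abm).
have a0 := al0; have b0 := be0.
have sa : 0 < s al by apply: arc; lra.
have sb : 0 < s be by apply: arc; lra.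
have sab : 0 < s (al + be) by apply: arc; lra.
have sh : 0 < s h by apply: arc; rewrite /h; lra.
have cB x y : c x * c y + Lam * s x * s y = c (x - y) by rewrite c_D// c_N// s_N//; ring.
have cD x y : c x * c y - Lam * s x * s y = c (x + y) by rewrite c_D.
have alE : al = h - de by rewrite /h /de; field.
have beE : be = h + de by rewrite /h /de; field.
have Th : T * c h = s h by rewrite /T divfK// gt_eqF.
(* The constant is the value, at the fourth vertex, of the linear form that vanishes on the opposite
   face. The next two identities arise in the same way from the third and second vertex. *)
have k4 : Lam * (c de - Lam * X * s de - p) = 2 * (s be * s al) * b4.
  have -> : 2 * (s be * s al) = Lam * (c (de + de) - c (al + be)).
    by rewrite (c_sub HLam1); congr (2 * (s _ * s _)); rewrite /de; field.
  have e1 : c al = c h * c de + Lam * s h * s de by rewrite cB -alE.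
  have e2 : c be = c h * c de - Lam * s h * s de by rewrite cD -beE.
  rewrite -[c de in LHS]mulr1 bE XE pE -(cD de de) e1 e2; ring.
have k3 : Lam * (p - (c (al + h) - Lam * X * s (al + h))) = 2 * (s (al + be) * s al) * b3.
  have -> : 2 * (s (al + be) * s al) = Lam * (c be - c (al + h + h)).
    by rewrite (c_sub HLam1); congr (2 * (s _ * s _)); rewrite /h; field.
  have e1 : c al = c (al + h) * c h + Lam * s (al + h) * s h by rewrite cB addrK.
  have e2 : c (al + be) = c (al + h) * c de - Lam * s (al + h) * s de.
    by rewrite cD; congr (c_ Lam _); rewrite /h /de; field.
  rewrite -[c (al + h) in LHS]mulr1 bE XE pE -(cD (al + h) h) e2 e1; ring.
have k2 : Lam * (p - (c (be + h) + Lam * X * s (be + h))) = 2 * (s (al + be) * s be) * b2.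
  have -> : 2 * (s (al + be) * s be) = Lam * (c al - c (be + h + h)).
    by rewrite (c_sub HLam1); congr (2 * (s _ * s _)); rewrite /h; field.
  have e1 : c be = c (be + h) * c h + Lam * s (be + h) * s h by rewrite cB addrK.
  have e2 : c (al + be) = c (be + h) * c de + Lam * s (be + h) * s de.
    by rewrite cB; congr (c_ Lam _); rewrite /h /de; field.
  rewrite -[c (be + h) in LHS]mulr1 bE XE pE -(cD (be + h) h) e2 e1; ring.
have sE : s h = s h * (c h * b2 + c h * b3 + c de * b4) by rewrite -bE mulr1.
have T1 : T * c h - X * c h = 2 * s h * c h * b2 + s al * b4.
  have -> : s al = s h * c de - c h * s de by rewrite [in LHS]alE s_D// c_N// s_N//; ring.
  by rewrite Th {1}sE XE; ring.
have T2 : X * c h + T * c h = 2 * s h * c h * b3 + s be * b4.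
  have -> : s be = s h * c de + c h * s de by rewrite [in LHS]beE s_D.
  by rewrite Th {1}sE XE; ring.
have pk (x y : R) : 0 < x -> (0 <= x * y) = (0 <= y) by move=> x0; rewrite pmulr_rge0.
have regE : region Lam al be X p <-> [/\ 0 <= b2, 0 <= b3 & 0 <= b4].
  have p4 : 0 < 2 * (s be * s al) by rewrite !mulr_gt0.
  have p3 : 0 < 2 * (s (al + be) * s al) by rewrite !mulr_gt0.
  have p2 : 0 < 2 * (s (al + be) * s be) by rewrite !mulr_gt0.
  rewrite /region /= -/h -/de -(pk _ b2 p2) -(pk _ b3 p3) -(pk _ b4 p4) -k2 -k3 -k4 !mulrBr !subr_ge0.
  by split=> -[].
split.
  case/orP => /and4P[u1 u2 u3 u4]; last first.
    (* The normalisation [W = 1] excludes the nonpositive half of [orthant]. *)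
    have := mulr_ge0_le0 (ltW ch) u2; have := mulr_ge0_le0 (ltW ch) u3.
    by have := mulr_ge0_le0 (ltW cd) u4; lra.
  split => //; last by apply/regE.
  have t1 : 0 <= 2 * s h * c h * b2 + s al * b4 by rewrite addr_ge0 ?mulr_ge0// ltW.
  have t2 : 0 <= 2 * s h * c h * b3 + s be * b4 by rewrite addr_ge0 ?mulr_ge0// ltW.
  move: t1 t2; rewrite -T1 -T2 subr_ge0 -mulrDl => t1 t2.
  move: t2; rewrite pmulr_lge0// => t2; move: t1; rewrite ler_pM2r// => t1.
  by apply/andP; split; lra.
by move=> [u0 _ /regE[r2 r3 r4]]; rewrite u0 r2 r3 r4.
Qed.

Lemma vol_curved (V : 'M[R]_4) (r : 'I_4 -> R) (Psi : R -> R) : V \in unitmx ->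
  (forall i, 0 < r i) ->
  (forall i j, bilX Lam (row i V) (row j V) = r i * r j * c (tetra_edge al be i j)) ->
  Psi 0 = 0 -> (forall z : R, `|z| < m -> is_derive z 1 Psi (zcot Lam z)) ->
  vol Lam (simplex V) = (Lam * (Psi al + Psi be - Psi (al + be)))%:E.
Proof.
move=> uV r0 gV Psi0 dPsi.
pose W := \matrix_(i < 4, j < 4) (r i * null_vertex i j).
have WE i k : (k < 4)%N -> W i (inord k) = r i * null_vertex i k.
  by move=> k4; rewrite mxE inordK.
have WV : W *m null_form Lam *m W^T = V *m curved_form Lam *m V^T.
  apply/matrixP => i j; rewrite null_formE curved_formE gV -null_vertex_gram// !WE//.
  by ring.
have [uW dF ->] := vol_gram HLam1 uV WV.
rewrite proj_int_iterated// -(slab_integral HLam1 am al0 be0 abm Psi0 dPsi).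
have Fout X u p : orthant (vec4 X 1 u p *m invmx W) <->
    [/\ 0 <= u, - T <= X <= T & region Lam al be X p].
  (* Absorbing the positive factors [r i] into the coefficients replaces the rows of [W] by the
     normalised vertices. *)
  set a := _ *m _; pose b := \row_i (r i * a 0 i).
  have xE k : (k < 4)%N -> [:: X; 1; u; p]`_k = r (inord 0) * a 0 (inord 0) * null_vertex 0 k +
      r (inord 1) * a 0 (inord 1) * null_vertex 1 k + r (inord 2) * a 0 (inord 2) * null_vertex 2 k +
      r (inord 3) * a 0 (inord 3) * null_vertex 3 k.
    move=> k4; have : vec4 X 1 u p 0 (inord k) = (a *m W) 0 (inord k) by rewrite mulmxKV.
    by rewrite mxE inordK// => ->; rewrite mxE sum4 !WE// !inordK//; ring.
  have bE i : b 0 i = r i * a 0 i by rewrite mxE.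
  have <- : orthant b = orthant a.
    by rewrite /orthant /co !bE !pmulr_rge0 ?pmulr_rle0.
  apply: region_orthant; rewrite /co !bE /=.
  - by have := xE 0%N erefl; rewrite /null_vertex /= => ->; ring.
  - by have := xE 1%N erefl; rewrite /null_vertex /= => ->; ring.
  - by have := xE 2%N erefl; rewrite /null_vertex /= => ->; ring.
  - by have := xE 3%N erefl; rewrite /null_vertex /= => ->; ring.
have QE X u p : (vec4 X 1 u p *m null_form Lam *m (vec4 X 1 u p)^T) 0 0 =
    u ^+ 2 + 2 * u * p + (1 + Lam * X ^+ 2).
  by rewrite null_formE /vec4 !mxE !inordK//=; ring.
rewrite [RHS]integral_mkcond; apply: eq_integral => X _; rewrite patchE.
have [/set_mem XT|XT] := boolP (X \in _); last first.
  apply: integral0_eq => u _; apply: integral0_eq => p _; rewrite QE.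
  case: (boolP (orthant _)) => [/Fout[_ XT' _]|]; last by rewrite mul0r.
  by move: XT; rewrite mem_set//= in_itv.
rewrite [RHS]integral_mkcond; apply: eq_integral => u _; rewrite patchE.
have [/set_mem u0|u0] := boolP (u \in _); last first.
  apply: integral0_eq => p _; rewrite QE.
  case: (boolP (orthant _)) => [/Fout[u0' _ _]|]; last by rewrite mul0r.
  by move: u0; rewrite mem_set//= in_itv/= u0'.
rewrite [RHS]integral_mkcond; apply: eq_integral => p _; rewrite patchE QE.
move: XT u0; rewrite /= !in_itv/= andbT => XT u0.
case: (boolP (orthant _)) => [/Fout[_ _ rp]|no]; first by rewrite mem_set// mul1r.
by rewrite memNset ?mul0r// => rp; move/negP: no; apply; apply/Fout.
Qed.

End CurvedVolume.

(** * The flat case *)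

Section FlatVolume.
Context {R : realType}.
Notation mu := (@lebesgue_measure R).

Lemma is_deriveX1 (f : R -> R) (x df : R) n : is_derive x 1 f df ->
  is_derive x 1 (fun t => f t ^+ n.+1) (n.+1%:R * f x ^+ n * df).
Proof.
move=> h; elim: n => [|n IHn].
  rewrite [X in is_derive _ _ X _](_ : _ = f); last by apply/funext => t; rewrite expr1.
  by apply: (is_derive_eq h); rewrite expr0 !mul1r.
rewrite [X in is_derive _ _ X _](_ : _ = fun t => f t * f t ^+ n.+1); last first.
  by apply/funext => t; rewrite exprS.
by apply: (is_derive_eq (is_deriveM1 h IHn)); rewrite -[n.+2]addn1 natrD exprS; ring.
Qed.

(** The factor [d] carries the constant of the preceding integration when the lemma is iterated. *)
Lemma integral_inv_pow n (k d : R) : 0 < k -> 0 <= d ->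
  (\int[mu]_(x in `[0%R, +oo[) (d * (k + x)^-1 ^+ n.+2)%:E =
   (d / n.+1%:R * k^-1 ^+ n.+1)%:E)%E.
Proof.
move=> k0 d0.
pose F x := - (d / n.+1%:R) * (k + x)^-1 ^+ n.+1.
have dV (x : R) : 0 <= x -> is_derive x 1 (fun x => (k + x)^-1) (- (k + x) ^- 2).
  move=> x0; have kx : k + x != 0 by rewrite gt_eqF//; lra.
  apply: (is_derive_eq (is_deriveV1 (f := fun x => k + x) kx
    (is_deriveD1 (is_derive_cst k x 1) (is_derive_id x 1)))).
  by rewrite add0r mulr1.
have dF (x : R) : 0 <= x -> is_derive x 1 F (d * (k + x)^-1 ^+ n.+2).
  move=> x0; apply: (is_derive_eq (is_deriveZ1 _ (is_deriveX1 n (dV x x0)))).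
  have n0 : n.+1%:R != 0 :> R by rewrite pnatr_eq0.
  rewrite -exprVn; move: (k + x)^-1 => v; rewrite /= !exprS expr0; by field.
have -> : ((d / n.+1%:R * k^-1 ^+ n.+1)%:E = 0%:E - (F 0)%:E)%E.
  by rewrite /F addr0 -EFinB sub0r mulNr opprK.
apply: (@ge0_continuous_FTC2y _ (fun x => d * (k + x)^-1 ^+ n.+2) F 0 0).
- by move=> x x0; rewrite mulr_ge0// exprn_ge0// invr_ge0; lra.
- apply: continuous_in_subspaceT => x /set_mem /=; rewrite in_itv/= andbT => x0.
  exact: is_derive_continuous (is_deriveZ1 d (is_deriveX1 n.+1 (dV x x0))).
- have -> : (0 : R) = - (d / n.+1%:R) * 0 ^+ n.+1 by rewrite expr0n mulr0.
  apply: cvgM; first exact: cvg_cst.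
  have h : (k + x)^-1 @[x --> (+oo : set_system R)] --> (0 : R).
    apply/(gtr0_cvgV0 (f := fun x : R => k + x)); last exact: cvg_addrl.
    by near=> x; rewrite ltr_wpDr//; near: x; exact: nbhs_pinfty_ge.
  exact: (@continuous_cvg _ _ _ _ _ _ _ _ (@exprn_continuous R n.+1 0) h).
- by move=> x x0; have [] := dF x (ltW x0).
- have /is_derive_continuous h := dF 0 (lexx 0).
  exact: cvg_at_right_filter.
- by move=> x; rewrite in_itv/= andbT => x0; rewrite derive1E; have [] := dF x (ltW x0).
Unshelve. all: by end_near. Qed.

Definition sum_co (a : 'rV[R]_4) : R := co a 1 + co a 2 + co a 3 + co a 4.

(** Integrating the fourth power of the inverse of [1 + X + u + p] over the positive octant gives
    the factors [1/3], [1/2] and [1]; the product is the volume of the standard simplex. *)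
Lemma proj_int_standard : density (cone_density (fun a => sum_co a ^+ 2)) ->
  proj_int (cone_density (fun a => sum_co a ^+ 2)) = (6^-1)%:E.
Proof.
move=> dF; rewrite proj_int_iterated//.
pose g (X u p : R) : \bar R := (1 * (1 + X + u + p)^-1 ^+ 4)%:E.
have gE X u p : (cone_density (fun a => sum_co a ^+ 2) (vec4 X 1 u p))%:E =
    if [&& 0 <= X, 0 <= u & 0 <= p] then g X u p else 0%:E.
  rewrite /cone_density /orthant /sum_co !co_vec4//= ler01 ler10 !andbF orbF /=.
  case: ifP => _; last by rewrite mul0r.
  by rewrite /g -exprM exprVn !mul1r; congr (((_ ^+ 4)^-1)%:E); ring.
transitivity (\int[mu]_(X in `[0%R, +oo[) \int[mu]_(u in `[0%R, +oo[) \int[mu]_(p in `[0%R, +oo[) g X u p)%E.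
  rewrite [RHS]integral_mkcond; apply: eq_integral => X _; rewrite patchE.
  rewrite [X \in _](_ : _ = (0 <= X)); last by rewrite mem_setE in_itv/= andbT.
  have [X0|X0] := boolP (0 <= X); last first.
    by apply: integral0_eq => u _; apply: integral0_eq => p _; rewrite gE (negbTE X0).
  rewrite [RHS]integral_mkcond; apply: eq_integral => u _; rewrite patchE.
  rewrite [u \in _](_ : _ = (0 <= u)); last by rewrite mem_setE in_itv/= andbT.
  have [u0|u0] := boolP (0 <= u); last first.
    by apply: integral0_eq => p _; rewrite gE (negbTE u0) andbF.
  rewrite [RHS]integral_mkcond; apply: eq_integral => p _; rewrite patchE gE X0 u0 /=.
  by rewrite mem_setE in_itv/= andbT.
transitivity (\int[mu]_(X in `[0%R, +oo[) (6^-1 * (1 + X)^-1 ^+ 2)%:E)%E; last first.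
  by rewrite integral_inv_pow//; congr EFin; rewrite invr1 expr1n; field.
apply: eq_integral => X /set_mem /=; rewrite in_itv/= andbT => X0.
transitivity (\int[mu]_(u in `[0%R, +oo[) (3^-1 * (1 + X + u)^-1 ^+ 3)%:E)%E.
  apply: eq_integral => u /set_mem /=; rewrite in_itv/= andbT => u0.
  by rewrite /g integral_inv_pow ?mul1r//; lra.
by rewrite integral_inv_pow//; [congr (_ * _)%:E; field|lra].
Qed.

(** With equal second coordinates only the edge vectors from the first vertex matter. The square of
    their determinant is minus their Gram determinant, the form having one negative direction, and
    polarisation expresses the Gram entries by the six squared lengths. *)
Lemma det_flat_gram (y : nat -> nat -> R) (a b : R) :
  let d i j := - (y i 0%N - y j 0%N) ^+ 2 + (y i 2%N - y j 2%N) ^+ 2 + (y i 3%N - y j 3%N) ^+ 2 in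
  y 0%N 1%N ^+ 2 = 1 -> y 1%N 1%N = y 0%N 1%N -> y 2%N 1%N = y 0%N 1%N -> y 3%N 1%N = y 0%N 1%N ->
  d 0%N 1%N = a ^+ 2 -> d 2%N 3%N = a ^+ 2 -> d 0%N 2%N = b ^+ 2 -> d 1%N 3%N = b ^+ 2 ->
  d 0%N 3%N = (a + b) ^+ 2 -> d 1%N 2%N = (a + b) ^+ 2 ->
  \det (\matrix_(i < 4, j < 4) y i j) ^+ 2 = (2 * a * b * (a + b)) ^+ 2.
Proof.
move=> d e1 y1 y2 y3 d01 d23 d02 d13 d03 d12.
rewrite det_nat4 /= /bump /= y1 y2 y3.
pose e k i := y k i - y 0%N i.
pose g k l := - e k 0%N * e l 0%N + e k 2%N * e l 2%N + e k 3%N * e l 3%N.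
have g11 : g 1%N 1%N = a ^+ 2 by rewrite -d01 /g /e /d; ring.
have g22 : g 2%N 2%N = b ^+ 2 by rewrite -d02 /g /e /d; ring.
have g33 : g 3%N 3%N = (a + b) ^+ 2 by rewrite -d03 /g /e /d; ring.
have pol k l : g k l = (g k k + g l l - d k l) / 2 by rewrite /g /e /d; field.
have g12 : g 1%N 2%N = - (a * b) by rewrite pol g11 g22 d12; field.
have g13 : g 1%N 3%N = a * (a + b) by rewrite pol g11 g33 d13; field.
have g23 : g 2%N 3%N = b * (a + b) by rewrite pol g22 g33 d23; field.
transitivity (y 0%N 1%N ^+ 2 *
  - (g 1%N 1%N * (g 2%N 2%N * g 3%N 3%N - g 2%N 3%N ^+ 2)
  - g 1%N 2%N * (g 1%N 2%N * g 3%N 3%N - g 2%N 3%N * g 1%N 3%N)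
  + g 1%N 3%N * (g 1%N 2%N * g 2%N 3%N - g 2%N 2%N * g 1%N 3%N))); last first.
  by rewrite e1 g11 g22 g33 g12 g13 g23; ring.
by rewrite /g /e; ring.
Qed.

Lemma vol_flat (V : 'M[R]_4) (r : 'I_4 -> R) (a b : R) : V \in unitmx ->
  0 < a -> 0 < b -> (forall i, 0 < r i) ->
  (forall i j, bilX 0 (row i V) (row j V) = r i * r j) ->
  (forall i j, metric_num 0 (row i V) (row j V) (row j V) =
     (r i * r j) ^+ 2 * tetra_edge a b i j ^+ 2) ->
  vol 0 (simplex V) = (3^-1 * (a * b * (a + b)))%:E.
Proof.
move=> uV a0 b0 r0 gV dV.
have rn i : r i != 0 by rewrite gt_eqF.
have VV i j : V i (inord 1) * V j (inord 1) = r i * r j.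
  by rewrite -gV /bilX mul0r addr0 /co !mxE.
pose M := diag_mx (\row_i (r i)^-1); pose Y := M *m V.
have YE i j : Y i j = (r i)^-1 * V i j.
  by rewrite /Y /M mul_diag_mx !mxE.
have Y2 i : Y i (inord 1) ^+ 2 = 1.
  by rewrite YE exprMn [V _ _ ^+ 2]expr2 VV; field; rewrite rn.
(* The rows of [V] were divided by the absolute values [r i], so the second coordinates are all [1]
   or all [-1]: the vertices have representatives on a common side of [x_2 = 0]. *)
have YY i j : Y i (inord 1) = Y j (inord 1).
  have : Y i (inord 1) * Y j (inord 1) = 1 by rewrite !YE mulrACA VV; field; rewrite !rn.
  by move=> e; rewrite -[LHS]mulr1 -(Y2 j) expr2 mulrA e mul1r.
have dM : \det M != 0.
  by rewrite det_diag; apply/prodf_neq0 => i _; rewrite mxE invr_eq0.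
have FE : (fun x => cone_density (fun a => detX 0 (a *m V)) (x *m M)) =
    cone_density (fun a => sum_co a ^+ 2).
  apply/funext => x; rewrite /cone_density; congr (_%:R * _^-2).
    have e k : co (x *m M) k = (r (inord k.-1))^-1 * co x k.
      by rewrite /co mul_mx_diag !mxE mulrC.
    by rewrite /orthant !e !pmulr_rge0 ?pmulr_rle0 ?invr_gt0.
  rewrite -mulmxA -/Y detXE mul0r addr0 /sum_co.
  have -> : co (x *m Y) 2 = Y (inord 0) (inord 1) * (co x 1 + co x 2 + co x 3 + co x 4).
    rewrite {1}/co mxE sum4 (YY (inord 1) (inord 0)) (YY (inord 2) (inord 0)) (YY (inord 3) (inord 0)).
    by rewrite /co /=; ring.
  by rewrite exprMn Y2 mul1r.
have dF := density_lin dM (density_simplex 0 V).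
rewrite vol_simplex// (proj_int_lin dM (density_simplex 0 V)) FE muleA -EFinM -normrM.
rewrite FE in dF; rewrite proj_int_standard// -EFinM; congr EFin.
rewrite [\det V * _]mulrC -det_mulmx -/Y.
(* The determinant of the normalised vertices is six times the volume up to sign. *)
suff -> : `|\det Y| = 2 * a * b * (a + b) by field.
have ab0 : 0 <= 2 * a * b * (a + b) by rewrite !mulr_ge0// ltW// addr_gt0.
apply/eqP; rewrite -(eqrXn2 (n := 2))// real_normK ?num_real//; apply/eqP.
pose y i j := Y (inord i) (inord j).
have -> : Y = \matrix_(i < 4, j < 4) y i j by apply/matrixP => i j; rewrite mxE /y !inord_val.
have dE i j : - (y i 0%N - y j 0%N) ^+ 2 + (y i 2%N - y j 2%N) ^+ 2 + (y i 3%N - y j 3%N) ^+ 2 =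
    tetra_edge a b (inord i : 'I_4) (inord j : 'I_4) ^+ 2.
  have VE k l : V k l = r k * Y k l by rewrite YE mulrA mulfV// mul1r.
  have rr : (r (inord i) * r (inord j)) ^+ 2 != 0 by rewrite expf_neq0// mulf_neq0.
  apply: (mulfI rr); rewrite -dV /metric_num mul0r addr0 /mink !coE /co !mxE /= !VE.
  rewrite (YY (inord j) (inord i)); have := Y2 (inord i).
  rewrite /y; move: (Y _ (inord 1)) => e e2.
  transitivity ((r (inord i) * r (inord j)) ^+ 2 * e ^+ 2 *
    (- (Y (inord i) (inord 0) - Y (inord j) (inord 0)) ^+ 2 +
    (Y (inord i) (inord 2) - Y (inord j) (inord 2)) ^+ 2 +
    (Y (inord i) (inord 3) - Y (inord j) (inord 3)) ^+ 2)); first by rewrite e2 mulr1.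
  by ring.
by apply: det_flat_gram; rewrite ?dE ?/y ?Y2 /tetra_edge ?inordK.
Qed.

End FlatVolume.

Section TetrahedronVolume.
Context {R : realType} (Lam : R).
Variables (V : 'M[R]_4) (a b : R).
Hypotheses (HV : lightlike_tetrahedron Lam V) (a0 : 0 < a) (b0 : 0 < b)
  (hV : has_edge_lengths Lam V a b (a + b)).

Lemma tetrahedron_unitmx : V \in unitmx.
Proof. by rewrite -row_free_unit; case: HV. Qed.

Lemma curved_tetrahedron_volume : Lam = 1 \/ Lam = -1 ->
  vol Lam (simplex V) =
    ((2 * Lam)^-1 * (Cl Lam (2 * a) + Cl Lam (2 * b) + Cl Lam (2 * - (a + b)))
     + Lam^-1 * (a * ln `|s_ Lam a| + b * ln `|s_ Lam b|
                 + - (a + b) * ln `|s_ Lam (- (a + b))|))%:E.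
Proof.
move=> HLam1; have HLam := HLam3 HLam1.
have [r [arc r0 gV _]] := tetrahedron_gram HLam HV a0 b0 hV.
have ab0 : 0 < a + b by rewrite addr_gt0.
(* For [Lam = 1] take the midpoint between [a + b] and [pi]; for [Lam = -1] any larger number will
   do. *)
have [m am abm] : exists2 m, arclen Lam m & a + b < m.
  case: HLam1 => L.
    have abpi := arc.2 L; exists ((a + b + pi) / 2); last by lra.
    by split; [have := pi_gt0 R; lra|move=> _; lra].
  exists (a + b + 1); last by lra.
  by split => [|L1]; [lra|move: L; rewrite L1; lra].
have [Psi Psi0 dPsi] := zcot_primitive HLam am.
rewrite (vol_curved HLam1 am a0 b0 abm tetrahedron_unitmx r0 gV Psi0 dPsi).
have sE z : 0 < z -> z < m -> `|s_ Lam z| = s_ Lam z.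
  by move=> z0 zm; rewrite gtr0_norm// s_gt0//; apply: (arclen_le am) (ltW zm).
have ClE z : 0 < z -> z < m -> Cl Lam (2 * z) = 2 * Psi z - 2 * z * ln (s_ Lam z) - 2 * z * ln 2.
  by move=> z0 zm; apply: (Cl_double HLam am) => //; rewrite z0.
congr EFin; rewrite (s_N HLam) normrN (mulrN 2) (ClN HLam); last by rewrite mulr_gt0.
have pa := a0; have pb := b0; have am' : a < m by lra.
have bm : b < m by lra.
rewrite !sE ?ClE//.
have LV : Lam^-1 = Lam by case: HLam1 => ->; rewrite ?invrN invr1.
(* The terms with [ln 2] cancel, their coefficients being proportional to [a], [b] and
   [- (a + b)]. *)
by rewrite invfM LV; field.
Qed.

Lemma flat_tetrahedron_volume : Lam = 0 ->
  vol Lam (simplex V) = (- (3^-1 * a * b * - (a + b)))%:E.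
Proof.
move=> L; have HLam : [\/ Lam = 1, Lam = -1 | Lam = 0] by exact: Or33.
have [r [_ r0 gV dV]] := tetrahedron_gram HLam HV a0 b0 hV.
have uV := tetrahedron_unitmx.
move: gV dV; rewrite s_E c_E; rewrite L !lamE => gV dV.
rewrite (vol_flat uV a0 b0 r0 _ dV); last by move=> i j; rewrite gV mulr1.
by congr EFin; field.
Qed.

End TetrahedronVolume.

Unset Implicit Arguments.

Theorem theorem5p2 (R : realType) (Lam : R) (V : 'M[R]_4) (alpha beta : R)
    (HLam : Lam \in [:: -1; 0; 1])
    (HV : lightlike_tetrahedron Lam V)
    (Halpha : 0 < alpha) (Hbeta : 0 < beta)
    (Hedges : has_edge_lengths Lam V alpha beta (alpha + beta)) :
  let gamma := - (alpha + beta) in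
  (Lam != 0 ->
     vol Lam (simplex V) =
       ((2 * Lam)^-1 * (Cl Lam (2 * alpha) + Cl Lam (2 * beta)
                        + Cl Lam (2 * gamma))
        + Lam^-1 * (alpha * ln `|s_ Lam alpha| + beta * ln `|s_ Lam beta|
                    + gamma * ln `|s_ Lam gamma|))%:E) /\
  (Lam = 0 ->
     vol Lam (simplex V) = (- (3^-1 * alpha * beta * gamma))%:E).
Proof.
move=> gamma; split=> L; last exact: flat_tetrahedron_volume.
apply: curved_tetrahedron_volume => //.
by move: HLam; rewrite !inE (negbTE L) /= => /orP[] /eqP ->; [right|left].
Qed.
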